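(* Suppose that for all $i,j\in I$: $(C_{i,j}<-1)\Rightarrow(r_i=-C_{j,i}=1)$. Let $V\in\mathrm{Mod}(\mathcal U_q(\hat{\mathfrak g}))$. 1) If $V$ is an $l$-highest weight module then $\chi_q(V)$ has a finite number of dominant monomials. 2) $V$ has a finite composition series if and only if $\chi_q(V)$ has a finite number of dominant monomials.
   Context: **Cartan data.** $C=(C_{i,j})_{1\le i,j\le n}$ is a symmetrizable generalized Cartan matrix ($C_{i,j}\in\mathbb Z$, $C_{i,i}=2$, $C_{i,j}\le 0$ for $i\neq j$, $C_{i,j}=0\Leftrightarrow C_{j,i}=0$), $I=\{1,\dots,n\}$, $D=\mathrm{diag}(r_1,\dots,r_n)$ with positive integers $r_i$ such that $B=DC$ is symmetric. $q\in\mathbb C^*$ is not a root of unity, with rational powers fixed compatibly ($q^{s+t}=q^sq^t$); $q_i=q^{r_i}$, $[l]_q=\frac{q^l-q^{-l}}{q-q^{-1}}$, and $\begin{bmatrix}s\\k\end{bmatrix}_{q_i}$ is the $q_i$-binomial coefficient. $(\mathfrak h,\{\alpha_i\},\{\alpha_i^\vee\})$ is a realization of $C$: $\mathfrak h$ is a $\mathbb Q$-vector space of dimension $2n-\mathrm{rank}(C)$, the $\alpha_i\in\mathfrak h^*$ and the $\alpha_i^\vee\in\mathfrak h$ are linearly independent families, $\alpha_j(\alpha_i^\vee)=C_{i,j}$. A non-degenerate symmetric bilinear form on $\mathfrak h^*$ with $(\alpha_i,v)=v(r_i\alpha_i^\vee)$ is fixed; it gives an isomorphism $\nu:\mathfrak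 h^*\to\mathfrak h$, with $\lambda(\nu(\mu))=\mu(\nu(\lambda))$, $\nu(\alpha_i)=r_i\alpha_i^\vee$. $P=\{\lambda\in\mathfrak h^*\mid\lambda(\alpha_i^\vee)\in\mathbb Z\ \forall i\}$, $P^+=\{\lambda\in P\mid\lambda(\alpha_i^\vee)\ge0\ \forall i\}$, $Q^+=\sum_i\mathbb N\alpha_i$, $\mathcal S(\lambda)=\lambda-Q^+$. **Quantum affinization.** $\mathcal U_q(\hat{\mathfrak g})$ is the $\mathbb C$-algebra with generators $x_{i,r}^{\pm}$ ($i\in I,r\in\mathbb Z$), $k_h$ ($h\in\mathfrak h$), $h_{i,m}$ ($i\in I,m\in\mathbb Z\setminus\{0\}$) and relations: $k_hk_{h'}=k_{h+h'}$, $k_0=1$; all $k_h,h_{i,m}$ commute pairwise; $k_hx_{j,r}^{\pm}k_{-h}=q^{\pm\alpha_j(h)}x_{j,r}^{\pm}$; $h_{i,m}x_{j,r}^{\pm}-x_{j,r}^{\pm}h_{i,m}=\pm\frac1m[mB_{i,j}]_q x_{j,m+r}^{\pm}$; $x_{i,r}^+x_{j,s}^--x_{j,s}^-x_{i,r}^+=\delta_{i,j}\frac{\phi^+_{i,r+s}-\phi^-_{i,r+s}}{q_i-q_i^{-1}}$; $(w-q^{\pm B_{i,j}}z)x_i^{\pm}(z)x_j^{\pm}(w)=(q^{\pm B_{i,j}}w-z)x_j^{\pm}(w)x_i^{\pm}(z)$; and the affine quantum Serre relations: for $i\ne j$, $s=1-C_{i,j}$, $\sum_{\pi\in\Sigma_s}\sum_{k=0}^s(-1)^k\begin{bmatrix}s\\k\end{bmatrix}_{q_i}x_i^{\pm}(w_{\pi(1)})\cdots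 x_i^{\pm}(w_{\pi(k)})x_j^{\pm}(z)x_i^{\pm}(w_{\pi(k+1)})\cdots x_i^{\pm}(w_{\pi(s)})=0$. Here $x_i^\pm(w)=\sum_r x_{i,r}^\pm w^r$ and $\sum_{m\ge0}\phi^{\pm}_{i,\pm m}z^{\pm m}=k_{\pm r_i\alpha_i^\vee}\exp(\pm(q-q^{-1})\sum_{m\ge1}h_{i,\pm m}z^{\pm m})$, $\phi^+_{i,m}=0$ for $m<0$, $\phi^-_{i,m}=0$ for $m>0$. **Modules.** $V_\omega=\{v\mid k_h v=q^{\omega(h)}v\ \forall h\in\mathfrak h\}$ for $\omega\in\mathfrak h^*$. $\mathrm{Mod}(\mathcal U_q(\hat{\mathfrak g}))$ is the category of $\mathcal U_q(\hat{\mathfrak g})$-modules $V=\bigoplus_\omega V_\omega$ with all $V_\omega$ finite dimensional, all weights in a finite union $\bigcup_j\mathcal S(\lambda_j)$, and such that for all $\omega,i$ there is $R\ge0$ with $V_{\omega\pm r\alpha_i}=\{0\}$ for $r\ge R$. An $l$-weight is a couple $(\lambda,\Psi)$, $\lambda\in P$, $\Psi=(\Psi^\pm_{i,\pm m})_{i\in I,m\ge0}$, $\Psi^\pm_{i,\pm m}\in\mathbb C$, $\Psi^\pm_{i,0}=q_i^{\pm\lambda(\alpha_i^\vee)}$. $V$ is an $l$-highest weight module (of $l$-highest weight $(\lambda,\Psi)$) if there is $v\in V_\lambda$ with $V=\mathcal U_q(\hat{\mathfrak g}).v$, $x^+_{i,r}v=0$, $\phi^\pm_{i,\pm m}v=\Psi^\pm_{i,\pm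 m}v$ for all $i\in I,r\in\mathbb Z,m\ge0$. **$q$-characters.** For $V\in\mathrm{Mod}(\mathcal U_q(\hat{\mathfrak g}))$, $V_{\lambda,\Psi}=\{v\in V_\lambda\mid\exists p\ge0,\forall i\in I,m\ge0,(\phi^\pm_{i,\pm m}-\Psi^\pm_{i,\pm m})^pv=0\}$. $QP_l^+$ is the set of $l$-weights $(\mu,\gamma)$ with $\mu\in P^+-Q^+$ for which there are polynomials $Q_i,R_i$ ($i\in I$), $Q_i(0)=R_i(0)=1$, with $\sum_{m\ge0}\gamma^\pm_{i,\pm m}z^{\pm m}=q_i^{\deg Q_i-\deg R_i}\frac{Q_i(zq_i^{-1})R_i(zq_i)}{Q_i(zq_i)R_i(zq_i^{-1})}$ in $\mathbb C[[z]]$ (resp. $\mathbb C[[z^{-1}]]$). $A$ is the commutative group of monomials $m=\prod_{i\in I,a\in\mathbb C^*}Y_{i,a}^{u_{i,a}(m)}k_{\omega(m)}$ ($u_{i,a}(m)\in\mathbb Z$ almost all zero, $\omega(m)\in\mathfrak h$, $\alpha_i(\omega(m))=r_i\sum_au_{i,a}(m)$), with $k_hk_{h'}=k_{h+h'}$. For $(\mu,\gamma)\in QP_l^+$ with $Q_i=\prod_a(1-za)^{\mu_{i,a}}$, $R_i=\prod_a(1-za)^{\nu_{i,a}}$, $Y_{\mu,\gamma}=k_{\nu(\mu)}\prod_{i,a}Y_{i,a}^{\mu_{i,a}-\nu_{i,a}}\in A$. $\chi_q(V)=\sum_{(\lambda,\gamma)\in QP_l^+}\dim(V_{\lambda,\gamma})Y_{\lambda,\gamma}\in\mathbb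 Z^A$. The monomials of $\chi_q(V)$ are the $m\in A$ with non-zero coefficient. A monomial $m\in A$ is dominant if $u_{i,a}(m)\ge0$ for all $i\in I,a\in\mathbb C^*$. *)

(* Defs.v *)
From HB Require Import structures.
From mathcomp Require Import all_boot all_order all_fingroup all_algebra.
From mathcomp Require Import generic_quotient ring_quotient.
From mathcomp Require Import finmap monalg.
From mathcomp Require Import complex.
From mathcomp Require Import boolp classical_sets functions cardinality fsbigop.
From mathcomp Require Import reals.

Set Implicit Arguments.
Unset Strict Implicit.
Unset Printing Implicit Defensive.

Import Order.TTheory GRing.Theory Num.Theory.

Local Open Scope classical_set_scope.
Local Open Scope quotient_scope.
Local Open Scope ring_scope.

Section Presentation.
Variables (K : nzRingType) (A : lalgType K).

Definition two_sided_ideal (J : set A) : Prop :=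
  [/\ J 0, forall x y, J x -> J y -> J (x - y)
    & forall a x b, J x -> J (a * x * b)].

Variable S : set A.

Definition gen_ideal : {pred A} :=
  fun x => `[< forall J, two_sided_ideal J -> S `<=` J -> J x >].

Fact gen_ideal_zmod_closed : GRing.zmod_closed gen_ideal.
Proof.
split; first by apply/asboolP => J [].
move=> x y /asboolP Jx /asboolP Jy; apply/asboolP => J idJ SJ.
by case: (idJ) => _ JB _; apply: JB; [exact: Jx | exact: Jy].
Qed.

HB.instance Definition _ :=
  GRing.isZmodClosed.Build A gen_ideal gen_ideal_zmod_closed.

Lemma gen_ideal_mul a x b : x \in gen_ideal -> a * x * b \in gen_ideal.
Proof.
move=> /asboolP Jx; apply/asboolP => J idJ SJ.
by case: (idJ) => _ _ JM; apply: JM; exact: Jx.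
Qed.

Lemma gen_ideal_mull a x : x \in gen_ideal -> a * x \in gen_ideal.
Proof. by move/(gen_ideal_mul a 1); rewrite mulr1. Qed.

Lemma gen_ideal_mulr x b : x \in gen_ideal -> x * b \in gen_ideal.
Proof. by move/(gen_ideal_mul 1 b); rewrite mul1r. Qed.

Definition presented := Quotient.quot gen_ideal.
HB.instance Definition _ := GRing.Zmodule.on presented.

Definition presented_pi (x : A) : presented := \pi_(Quotient.quot gen_ideal) x.
Local Notation pi := presented_pi.

Lemma presented_eq x y : (pi x == pi y) = (x - y \in gen_ideal).
Proof. by rewrite /pi -Quotient.idealrBE. Qed.

Lemma presented_reprK (u : presented) : pi (repr u) = u.
Proof. exact: reprK. Qed.

Fact presented_pi_is_zmod_morphism : zmod_morphism pi.
Proof. by move=> x y; rewrite /pi raddfB. Qed.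
HB.instance Definition _ :=
  GRing.isZmodMorphism.Build A presented pi presented_pi_is_zmod_morphism.

Definition presented_one : presented := pi 1.
Definition presented_mul (u v : presented) : presented := pi (repr u * repr v).
Definition presented_scale (c : K) (u : presented) : presented :=
  pi (c *: repr u).

Lemma presented_pi_mul x y : presented_mul (pi x) (pi y) = pi (x * y).
Proof.
apply/eqP; rewrite presented_eq.
have dx : repr (pi x) - x \in gen_ideal.
  by rewrite -presented_eq presented_reprK.
have dy : repr (pi y) - y \in gen_ideal.
  by rewrite -presented_eq presented_reprK.
rewrite -(subrK (repr (pi x) * y) (_ * _)) -addrA -mulrBl -mulrBr.
by apply: rpredD; [exact: gen_ideal_mull | exact: gen_ideal_mulr].
Qed.

Lemma presented_pi_scale c x : presented_scale c (pi x) = pi (c *: x).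
Proof.
apply/eqP; rewrite presented_eq -scalerBr -[X in c *: X]mul1r scalerAl.
by rewrite gen_ideal_mull // -presented_eq presented_reprK.
Qed.

Fact presented_mulA : associative presented_mul.
Proof.
move=> u v w.
by rewrite -(presented_reprK u) -(presented_reprK v) -(presented_reprK w)
  !presented_pi_mul mulrA.
Qed.
Fact presented_mul1 : left_id presented_one presented_mul.
Proof. by move=> u; rewrite -(presented_reprK u) presented_pi_mul mul1r. Qed.
Fact presented_mulr1 : right_id presented_one presented_mul.
Proof. by move=> u; rewrite -(presented_reprK u) presented_pi_mul mulr1. Qed.
Fact presented_mulDl : left_distributive presented_mul +%R.
Proof.
move=> u v w.
rewrite -(presented_reprK u) -(presented_reprK v) -(presented_reprK w).
by rewrite -raddfD !presented_pi_mul -raddfD mulrDl.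
Qed.
Fact presented_mulDr : right_distributive presented_mul +%R.
Proof.
move=> u v w.
rewrite -(presented_reprK u) -(presented_reprK v) -(presented_reprK w).
by rewrite -raddfD !presented_pi_mul -raddfD mulrDr.
Qed.

(* [pz] because nothing prevents a presented algebra from being zero. *)
HB.instance Definition _ := GRing.Zmodule_isPzRing.Build presented
  presented_mulA presented_mul1 presented_mulr1 presented_mulDl presented_mulDr.

Fact presented_scaleA a b (u : presented) :
  presented_scale a (presented_scale b u) = presented_scale (a * b) u.
Proof. by rewrite -(presented_reprK u) !presented_pi_scale scalerA. Qed.
Fact presented_scale1 : left_id 1 presented_scale.
Proof. by move=> u; rewrite -(presented_reprK u) presented_pi_scale scale1r. Qed.
Fact presented_scaleDr : right_distributive presented_scale +%R.
Proof.
move=> c u v; rewrite -(presented_reprK u) -(presented_reprK v).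
by rewrite -raddfD !presented_pi_scale -raddfD scalerDr.
Qed.
Fact presented_scaleDl u : {morph presented_scale^~ u : a b / a + b}.
Proof.
move=> a b; rewrite -(presented_reprK u).
by rewrite !presented_pi_scale -raddfD scalerDl.
Qed.

HB.instance Definition _ := GRing.Zmodule_isLmodule.Build K presented
  presented_scaleA presented_scale1 presented_scaleDr presented_scaleDl.

Fact presented_pi_is_monoid_morphism : monoid_morphism pi.
Proof. by split => // x y; rewrite -presented_pi_mul. Qed.
HB.instance Definition _ := GRing.isMonoidMorphism.Build A presented pi
  presented_pi_is_monoid_morphism.

Fact presented_pi_is_scalable : scalable pi.
Proof. by move=> c x; rewrite -presented_pi_scale. Qed.
HB.instance Definition _ := GRing.isScalable.Build K A presented *:%R pi
  presented_pi_is_scalable.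

Lemma presented_scalerAl c (u v : presented) : c *: (u * v) = (c *: u) * v.
Proof.
rewrite -(presented_reprK u) -(presented_reprK v).
by rewrite -rmorphM -!linearZ -rmorphM scalerAl.
Qed.

End Presentation.

Record cartan_datum (n : nat) := CartanDatum {
  cmat : 'M[int]_n;
  cr : 'I_n -> nat;
  cmat_diag : forall i, cmat i i = 2;
  cmat_offdiag : forall i j, i != j -> cmat i j <= 0;
  cmat_eq0 : forall i j, (cmat i j == 0) = (cmat j i == 0);
  cr_gt0 : forall i, (0 < cr i)%N;
  cmat_sym : forall i j, (cr i)%:Z * cmat i j = (cr j)%:Z * cmat j i
}.

Definition bmat n (c : cartan_datum n) (i j : 'I_n) : int :=
  (cr c i)%:Z * cmat c i j.

Notation hstar H := 'Hom(H, rat^o).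

Record realization n (c : cartan_datum n) := Realization {
  car : vectType rat;
  car_dim : \dim {: car} =
    (2 * n - \rank (map_mx intr (cmat c) : 'M[rat]_n))%N;
  root : 'I_n -> hstar car;
  coroot : 'I_n -> car;
  root_free : free [seq root i | i : 'I_n];
  coroot_free : free [seq coroot i | i : 'I_n];
  root_coroot : forall i j, root j (coroot i) = (cmat c i j)%:~R;
  form : hstar car -> hstar car -> rat;
  form_linear : forall a l m v, form (a *: l + m) v = a * form l v + form m v;
  form_sym : forall l m, form l m = form m l;
  form_nondeg : forall l, (forall m, form l m = 0) -> l = 0;
  form_root : forall i v, form (root i) v = v ((cr c i)%:R *: coroot i);
  (* nu is the isomorphism h^* -> h determined by the form *)
  nu : hstar car -> car;
  nu_form : forall l m : hstar car, l (nu m) = form l m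
}.

(* q together with its rational powers: [qpow s] is q ^ s, q itself is
   [qpow 1] *)
Record qparam (C : fieldType) := QParam {
  qpow : rat -> C;
  qpowD : forall s t, qpow (s + t) = qpow s * qpow t;
  qpow1_neq0 : qpow 1 != 0;
  qpow1_not_root : forall m, (0 < m)%N -> qpow 1 ^+ m != 1
}.

Section QNumbers.
Variables (C : fieldType) (q : C).
Definition qint (l : int) : C := (q ^ l - q ^ (- l)) / (q - q^-1).
Definition qfact (s : nat) : C := \prod_(1 <= l < s.+1) qint l.
Definition qbin (s k : nat) : C := qfact s / (qfact k * qfact (s - k)%N).
End QNumbers.

(* Signs are booleans: [false] stands for + and [true] for -, so that the sign
   [e] is the number (-1) ^+ e. *)

Section Affinization.
Variables (R : realType) (n : nat) (c : cartan_datum n) (rl : realization c)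
          (q : qparam R[i]).

Local Notation C := R[i].
Local Notation H := (car rl).
Local Notation B := (bmat c).
Local Notation q1 := (qpow q 1).
Local Notation x_sign e := ((-1) ^+ (e : bool)).

Definition qi (i : 'I_n) : C := qpow q (cr c i)%:R.

Definition gen : choiceType :=
  ((bool * 'I_n * int) + H + ('I_n * {m : int | m != 0}))%type.

Definition free_alg := {malg C[{fmonom gen}]}.
HB.instance Definition _ := GRing.Lalgebra.on free_alg.

Definition fgen (g : gen) : free_alg := << fmu g >>.
Definition fx (e : bool) (i : 'I_n) (r : int) : free_alg :=
  fgen (inl (inl (e, i, r))).
Definition fk (h : H) : free_alg := fgen (inl (inr h)).
Definition fh (i : 'I_n) (m : {m : int | m != 0}) : free_alg :=
  fgen (inr (i, m)).
(* Only used at nonzero m; the value at 0 is a dummy *)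
Definition fhz (i : 'I_n) (m : int) : free_alg :=
  if insub m is Some m' then fh i m' else 0.

(* Coefficient of z^m in exp (\sum_(k >= 1) a k z^k) *)
Definition exp_coef (a : nat -> free_alg) (m : nat) : free_alg :=
  \sum_(l < m.+1) (l`!%:R^-1 : C) *:
     ((\sum_(1 <= k < m.+1) (a k)%:P * 'X^k) ^+ l)`_m.

(* [fphi e i m] is phi^{e}_{i, e m} for m >= 0 *)
Definition fphi (e : bool) (i : 'I_n) (m : nat) : free_alg :=
  fk ((x_sign e * (cr c i)%:R) *: coroot rl i) *
  exp_coef (fun k => (x_sign e * (q1 - q1^-1)) *: fhz i (x_sign e * k%:Z)) m.

Definition fphiz (e : bool) (i : 'I_n) (m : int) : free_alg :=
  if 0 <= x_sign e * m then fphi e i `|m|%N else 0.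

Definition serre_len (i j : 'I_n) : nat := `|1 - cmat c i j|%N.

(* The product over 'I_s is taken in increasing order of the index. *)
Definition serre (e : bool) (i j : 'I_n) (l : 'I_(serre_len i j) -> int)
    (l' : int) : free_alg :=
  \sum_(p : 'S_(serre_len i j)) \sum_(k < (serre_len i j).+1)
    ((-1) ^+ k * qbin (qi i) (serre_len i j) k) *:
    ((\prod_(a < serre_len i j | (a < k)%N) fx e i (l (p a))) * fx e j l' *
     (\prod_(a < serre_len i j | (k <= a)%N) fx e i (l (p a)))).

(* The relations between currents are written coefficientwise: [rel_xx] is the
   coefficient of z^r w^s, [rel_serre] that of
   w_1^(l_1) ... w_s^(l_s) z^(l'). *)
Inductive uq_rel : free_alg -> Prop :=
| rel_kD h h' : uq_rel (fk h * fk h' - fk (h + h'))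
| rel_k0 : uq_rel (fk 0 - 1)
| rel_kk h h' : uq_rel (fk h * fk h' - fk h' * fk h)
| rel_kh h i m : uq_rel (fk h * fh i m - fh i m * fk h)
| rel_hh i m j m' : uq_rel (fh i m * fh j m' - fh j m' * fh i m)
| rel_kx h e j r :
    uq_rel (fk h * fx e j r * fk (- h)
            - qpow q (x_sign e * root rl j h) *: fx e j r)
| rel_hx i m e j r :
    uq_rel (fh i m * fx e j r - fx e j r * fh i m
            - (x_sign e * (sval m)%:~R^-1 * qint q1 (sval m * B i j))
                *: fx e j (sval m + r))
| rel_xpm i j r s :
    uq_rel (fx false i r * fx true j s - fx true j s * fx false i r
            - (i == j)%:R *: ((qi i - (qi i)^-1)^-1
                *: (fphiz false i (r + s) - fphiz true i (r + s))))
| rel_xx e i j r s (b := qpow q (x_sign e * (B i j)%:~R)) :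
    uq_rel ((fx e i r * fx e j (s - 1) - b *: (fx e i (r - 1) * fx e j s))
            - (b *: (fx e j (s - 1) * fx e i r) - fx e j s * fx e i (r - 1)))
| rel_serre e i j l l' : i != j -> uq_rel (@serre e i j l l').

Definition Uq := presented uq_rel.
HB.instance Definition _ := GRing.PzRing.on Uq.
HB.instance Definition _ := GRing.Lmodule.on Uq.

Definition x_ e i r : Uq := presented_pi uq_rel (fx e i r).
Definition k_ h : Uq := presented_pi uq_rel (fk h).
Definition phi_ e i m : Uq := presented_pi uq_rel (fphi e i m).

Definition inP (w : hstar H) : Prop :=
  forall i, exists z : int, w (coroot rl i) = z%:~R.
Definition inPplus (w : hstar H) : Prop :=
  inP w /\ forall i, 0 <= w (coroot rl i).
Definition inQplus (w : hstar H) : Prop :=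
  exists m : 'I_n -> nat, w = \sum_i root rl i *+ m i.
Definition inS (l w : hstar H) : Prop := inQplus (l - w).

(* l-weights (lambda, Psi), where [Psi e i m] is Psi^{e}_{i, e m} *)
Definition lweight : Type := (hstar H * (bool -> 'I_n -> nat -> C))%type.
HB.instance Definition _ := Choice.on lweight.

Definition is_lweight (x : lweight) : Prop :=
  inP x.1 /\ forall e i,
    x.2 e i 0%N = qpow q (x_sign e * ((cr c i)%:R * x.1 (coroot rl i))).

Section Module.
Variable V : lmodType Uq.

Definition cscale (a : C) (v : V) : V := (a *: (1 : Uq)) *: v.

Definition is_basis (d : nat) (b : 'I_d -> V) (W : set V) : Prop :=
  (forall i, W (b i)) /\
  (forall v, W v -> exists! a : {ffun 'I_d -> C}, v = \sum_i cscale (a i) (b i)).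

Definition finite_dim (W : set V) : Prop :=
  exists d (b : 'I_d -> V), is_basis b W.

(* Complex dimension of a finite dimensional subspace (0 by convention if the
   dimension is infinite) *)
Definition cdim (W : set V) : nat :=
  xget 0%N [set d | exists b : 'I_d -> V, is_basis b W].

Definition weight_space (w : hstar H) : set V :=
  [set v | forall h, k_ h *: v = cscale (qpow q (w h)) v].

Definition weight_decomposition : Prop :=
  (forall v, exists (s : seq (hstar H)) (f : hstar H -> V),
     (forall w, weight_space w (f w)) /\ v = \sum_(w <- s) f w) /\
  (forall (s : seq (hstar H)) (f : hstar H -> V), uniq s ->
     (forall w, weight_space w (f w)) -> \sum_(w <- s) f w = 0 ->
     forall w, w \in s -> f w = 0).

Record in_Mod : Prop := InMod {
  Mod_weight : weight_decomposition;
  Mod_findim : forall w, finite_dim (weight_space w);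
  Mod_cone : exists s : seq (hstar H), forall w,
    weight_space w <> [set 0] -> exists2 l, l \in s & inS l w;
  Mod_integrable : forall w i, exists N : nat, forall r, (N <= r)%N ->
    weight_space (w + root rl i *+ r) = [set 0] /\
    weight_space (w - root rl i *+ r) = [set 0]
}.

Definition l_highest_weight : Prop :=
  exists (x : lweight) (v : V),
    [/\ is_lweight x, weight_space x.1 v, forall w : V, exists u : Uq, w = u *: v,
        forall i r, x_ false i r *: v = 0
      & forall e i m, phi_ e i m *: v = cscale (x.2 e i m) v].

Definition is_submodule (W : set V) : Prop :=
  W 0 /\ forall (u : Uq) x y, W x -> W y -> W (u *: x + y).

(* For submodules W' and W: W' is strictly contained in W and, by the
   correspondence between submodules of W / W' and submodules between W' and W,
   the quotient W / W' is simple *)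
Definition simple_step (W W' : set V) : Prop :=
  [/\ W' `<=` W, W' <> W
    & forall N, is_submodule N -> W' `<=` N -> N `<=` W -> N = W' \/ N = W].

Definition has_finite_composition_series : Prop :=
  exists (k : nat) (W : nat -> set V),
    [/\ W 0%N = setT, W k = [set 0],
        forall i, (i <= k)%N -> is_submodule (W i)
      & forall i, (i < k)%N -> simple_step (W i) (W i.+1)].

Definition lweight_space (x : lweight) : set V :=
  [set v | weight_space x.1 v /\ exists p : nat, forall e i m,
     (phi_ e i m - x.2 e i m *: (1 : Uq)) ^+ p *: v = 0].

End Module.

(* f is the expansion at 0 of the rational function num / den, for den with
   nonzero constant term *)
Definition expands_to (f : nat -> C) (num den : {poly C}) : Prop :=
  forall m, \sum_(k < m.+1) f k * den`_(m - k) = num`_m.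

(* z |-> p(za) *)
Definition dilate (p : {poly C}) (a : C) : {poly C} := p \Po (a *: 'X).

(* Coefficients listed in the opposite order: z^(deg p) p(1/z) *)
Definition revp (p : {poly C}) : {poly C} := Poly (rev p).

(* The pair (Q, S) witnesses that (mu, gamma) = x is in QP_l^+ . For the sign
   -, the expansion is in z^-1; numerator and denominator have the same degree
   there, hence it is the expansion at 0 of the quotient of the [revp]. *)
Definition QPl_witness (x : lweight) (Q S : 'I_n -> {poly C}) : Prop :=
  forall i,
    let num := (qi i ^ ((size (Q i)).-1%:Z - (size (S i)).-1%:Z)) *:
                 (dilate (Q i) (qi i)^-1 * dilate (S i) (qi i)) in
    let den := dilate (Q i) (qi i) * dilate (S i) (qi i)^-1 in
    [/\ (Q i).[0] = 1, (S i).[0] = 1, expands_to (x.2 false i) num den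
      & expands_to (x.2 true i) (revp num) (revp den)].

Definition inPplus_minus_Qplus (w : hstar H) : Prop :=
  exists2 l, inPplus l & inS l w.

Definition QPlplus (x : lweight) : Prop :=
  [/\ is_lweight x, inPplus_minus_Qplus x.1 & exists Q S, QPl_witness x Q S].

Definition Cstar : choiceType := {a : C | a != 0}.

(* The group A: a monomial is given by the exponents u_{i,a} and by omega *)
Definition monomial_axiom (m : {fsfun ('I_n * Cstar)%type -> int with 0} * H) :
    bool :=
  [forall i, root rl i m.2 ==
     (cr c i)%:R * \sum_(y <- finsupp m.1 | y.1 == i) (m.1 y)%:~R].
Definition monomial : Type := {m | monomial_axiom m}.

Definition mon_u (m : monomial) (i : 'I_n) (a : Cstar) : int :=
  (sval m).1 (i, a).
Definition mon_omega (m : monomial) : H := (sval m).2.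

Definition dominant (m : monomial) : Prop := forall i a, 0 <= mon_u m i a.

(* m = Y_{mu, gamma}; the exponent of (1 - z a) in Q_i is the multiplicity of
   a^-1 as a root of Q_i *)
Definition is_Y (x : lweight) (m : monomial) : Prop :=
  exists Q S, [/\ QPl_witness x Q S, mon_omega m = nu x.1
    & forall i (a : Cstar), mon_u m i a =
        (mup (sval a)^-1 (Q i))%:Z - (mup (sval a)^-1 (S i))%:Z].

Definition qchar (V : lmodType Uq) (m : monomial) : int :=
  \sum_(x \in [set x | QPlplus x /\ is_Y x m]) (cdim (lweight_space x : set V))%:Z.

Definition dominant_monomials (V : lmodType Uq) : set monomial :=
  [set m | qchar V m != 0 /\ dominant m].

End Affinization.

(* Main.v *)
From HB Require Import structures.
Require Import Defs.
From mathcomp Require Import all_boot all_order all_algebra complex.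
From mathcomp Require Import generic_quotient ring_quotient.
From mathcomp Require Import finmap monalg.
From mathcomp Require Import boolp classical_sets functions cardinality fsbigop.
From mathcomp Require Import reals.
From mathcomp Require Import zify ring lra.


Set Implicit Arguments.
Unset Strict Implicit.
Unset Printing Implicit Defensive.

Import Order.TTheory GRing.Theory Num.Theory.

Local Open Scope classical_set_scope.
Local Open Scope ring_scope.

(** * Finite-dimensional subspaces of a vector space *)

Section Subspaces.
Variables (K : fieldType) (V : lmodType K).
Implicit Types (W E : set V).

Definition subspace W : Prop :=
  W 0 /\ forall a x y, W x -> W y -> W (a *: x + y).

Lemma subspace_add W x y : subspace W -> W x -> W y -> W (x + y).
Proof. by move=> [_ WL] Wx Wy; rewrite -[x]scale1r; apply: WL. Qed.

Lemma subspace_scale W a x : subspace W -> W x -> W (a *: x).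
Proof. by move=> [W0 WL] Wx; rewrite -[_ *: _]addr0; apply: WL. Qed.

Lemma subspace_opp W x : subspace W -> W x -> W (- x).
Proof. by move=> sW Wx; rewrite -scaleN1r; apply: subspace_scale. Qed.

Lemma subspace_sub W x y : subspace W -> W x -> W y -> W (x - y).
Proof. by move=> sW Wx Wy; apply: subspace_add => //; apply: subspace_opp. Qed.

Lemma subspace_sum W (I : Type) (r : seq I) (P : pred I) (F : I -> V) :
  subspace W -> (forall i, P i -> W (F i)) -> W (\sum_(i <- r | P i) F i).
Proof.
move=> sW WF; apply: (big_ind W) => //; first by case: sW.
by move=> x y; apply: subspace_add.
Qed.

Lemma subspaceI W E : subspace W -> subspace E -> subspace (W `&` E).
Proof.
move=> [W0 WL] [E0 EL]; split; first by split.
by move=> a x y [Wx Ex] [Wy Ey]; split; [apply: WL | apply: EL].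
Qed.

Lemma subspace0 : subspace [set 0].
Proof. by split => //= a x y -> ->; rewrite scaler0 addr0. Qed.

Definition lspan d (b : 'I_d -> V) : set V :=
  [set v | exists a : 'I_d -> K, v = \sum_i a i *: b i].

Lemma subspace_lspan d (b : 'I_d -> V) : subspace (lspan b).
Proof.
split; first by exists (fun=> 0); rewrite big1 // => i _; rewrite scale0r.
move=> c x y [a ->] [a' ->]; exists (fun i => c * a i + a' i).
rewrite scaler_sumr -big_split; apply: eq_bigr => i _ /=.
by rewrite scalerDl scalerA.
Qed.

Lemma lspan_mem d (b : 'I_d -> V) i : lspan b (b i).
Proof.
exists (fun j => (j == i)%:R); rewrite (bigD1 i) //= eqxx scale1r.
by rewrite big1 ?addr0 // => j /negPf->; rewrite scale0r.
Qed.

Definition fin_dim W : Prop := exists d (b : 'I_d -> V), W `<=` lspan b.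

Lemma fin_dimS W E : W `<=` E -> fin_dim E -> fin_dim W.
Proof. by move=> WE [d [b Eb]]; exists d, b; apply: subset_trans WE Eb. Qed.

(** The entries [u k j] are the coordinates of one vector [u k] of the
    finite-dimensional space [Hom('I_d, lspan b)], so that infinitely many
    [u k] are dependent; this is what produces relations between currents that
    hold on all of a weight space at once. *)
Lemma linear_relation d D (b : 'I_D -> V) (u : nat -> 'I_d -> V) :
  (forall k j, lspan b (u k j)) ->
  exists2 p : {poly K}, p != 0 &
    forall j, \sum_(k < size p) p`_k *: u k j = 0.
Proof.
move=> /(_ _ _)/cid - ub.
pose A : 'M[K]_((d * D).+1, d * D) :=
  \matrix_(k < (d * D).+1) mxvec (\matrix_(j, l) sval (ub k j) l).
have /rowV0Pn[r /sub_kermxP rA r0] : kermx A != 0.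
  rewrite -mxrank_eq0 mxrank_ker -lt0n subn_gt0 ltnS.
  exact: rank_leq_col.
pose p := rVpoly r.
have pE k : p`_k = if insub k is Some k' then r 0 k' else 0.
  by rewrite coef_rVpoly.
exists p.
  by apply: contra r0 => /eqP p0; rewrite -(rVpolyK r) -/p p0 linear0.
move=> j.
have sp : (size p <= (d * D).+1)%N by apply: size_poly.
rewrite (big_ord_widen _ (fun k => p`_k *: u k j) sp) big_mkcond /=.
rewrite (eq_bigr (fun k : 'I_(d * D).+1 => r 0 k *: u k j)); last first.
  move=> k _; case: ltnP => [kp|pk]; first by rewrite pE valK.
  have := pE k; rewrite valK nth_default // => <-.
  by rewrite scale0r.
rewrite (eq_bigr (fun k => \sum_l (r 0 k * sval (ub k j) l) *: b l)); last first.
  move=> k _; rewrite {1}(svalP (ub k j)) scaler_sumr.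
  by apply: eq_bigr => l _; rewrite scalerA.
rewrite exchange_big big1 //= => l _; rewrite -scaler_suml.
have /rowP/(_ (mxvec_index j l)) := rA.
rewrite !mxE => rA0; rewrite -[RHS](scale0r (b l)); congr (_ *: _).
rewrite -{}[RHS]rA0; apply: eq_bigr => k _.
by rewrite !mxE mxvecE mxE.
Qed.

Definition lfree d (b : 'I_d -> V) : Prop :=
  forall a : 'I_d -> K, \sum_i a i *: b i = 0 -> forall i, a i = 0.

Lemma lfree_bound D (b : 'I_D -> V) d (u : 'I_d -> V) :
  lfree u -> (forall i, lspan b (u i)) -> (d <= D)%N.
Proof.
move=> fu /(_ _)/cid ub.
pose A : 'M[K]_(d, D) := \matrix_(i, l) sval (ub i) l.
suff : \rank A = d by move <-; apply: rank_leq_col.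
apply/eqP; rewrite -/(row_free A) -kermx_eq0; apply/eqP/row_matrixP => i.
rewrite row0; set r := row i _.
have rA : r *m A = 0 by rewrite /r -row_mul mulmx_ker row0.
suff r0 : forall j, r 0 j = 0 by apply/rowP => j; rewrite r0 mxE.
apply: (fu (fun j => r 0 j)).
rewrite (eq_bigr (fun k => \sum_l (r 0 k * sval (ub k) l) *: b l)); last first.
  move=> k _; rewrite {1}(svalP (ub k)) scaler_sumr.
  by apply: eq_bigr => l _; rewrite scalerA.
rewrite exchange_big big1 //= => l _; rewrite -scaler_suml.
have /rowP/(_ l) := rA; rewrite !mxE => rA0.
rewrite -[RHS](scale0r (b l)); congr (_ *: _); rewrite -[RHS]rA0.
by apply: eq_bigr => k _; rewrite !mxE.
Qed.

Definition cons_fam d (v : V) (b : 'I_d -> V) (i : 'I_d.+1) : V :=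
  if unlift ord0 i is Some j then b j else v.

Lemma cons_fam_sum d v (b : 'I_d -> V) (a : 'I_d.+1 -> K) :
  \sum_i a i *: cons_fam v b i =
  a ord0 *: v + \sum_i a (lift ord0 i) *: b i.
Proof.
rewrite big_ord_recl {1}/cons_fam unlift_none.
by under eq_bigr => i _ do rewrite /cons_fam liftK.
Qed.

Lemma lfree_cons d v (b : 'I_d -> V) :
  lfree b -> ~ lspan b v -> lfree (cons_fam v b).
Proof.
move=> fb nv a; rewrite cons_fam_sum => a0.
have av : a ord0 = 0.
  apply/eqP/negP => /negP nz; apply: nv.
  exists (fun i => - (a ord0)^-1 * a (lift ord0 i)).
  move/eqP: a0; rewrite addr_eq0 => /eqP/(congr1 (fun w => (a ord0)^-1 *: w)).
  rewrite scalerA mulVf // scale1r => ->.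
  rewrite scalerN scaler_sumr -sumrN; apply: eq_bigr => i _.
  by rewrite scalerA mulNr scaleNr.
move: a0; rewrite av scale0r add0r => /fb a0 i.
by case: (unliftP ord0 i) => [j|] ->.
Qed.

(** A maximal free family in [W]. *)
Lemma lbasis_exists W : subspace W -> fin_dim W ->
  exists d (b : 'I_d -> V), [/\ lfree b, forall i, W (b i) & W `<=` lspan b].
Proof.
move=> sW [D [c Wc]].
pose P d := `[< exists b : 'I_d -> V, lfree b /\ forall i, W (b i) >].
have P0 : exists d, P d.
  by exists 0%N; apply/asboolP; exists (fun=> 0); split => [a _ []|[]].
have PD d : P d -> (d <= D)%N.
  by move=> /asboolP[b [fb Wb]]; apply: (lfree_bound fb) => i; apply: Wc.
case: (ex_maxnP P0 PD) => d /asboolP[b [fb Wb]] dmax.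
exists d, b; split => // v Wv; apply: contrapT => nv.
suff /dmax : P d.+1 by rewrite ltnn.
apply/asboolP; exists (cons_fam v b); split; first exact: lfree_cons.
by move=> i; rewrite /cons_fam; case: unlift.
Qed.

Definition ldim W : nat :=
  xget 0%N [set d | exists b : 'I_d -> V,
    [/\ lfree b, forall i, W (b i) & W `<=` lspan b]].

Lemma ldimP W : subspace W -> fin_dim W -> exists b : 'I_(ldim W) -> V,
  [/\ lfree b, forall i, W (b i) & W `<=` lspan b].
Proof.
move=> sW fW; have [d [b Hb]] := lbasis_exists sW fW.
rewrite /ldim; case: xgetP => [e -> He //|/(_ d) []]; by exists b.
Qed.

Lemma ldim_le W E : subspace W -> subspace E -> fin_dim E -> W `<=` E ->
  (ldim W <= ldim E)%N.
Proof.
move=> sW sE fE WE; have [b [fb Wb _]] := ldimP sW (fin_dimS WE fE).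
have [c [_ _ Ec]] := ldimP sE fE.
by apply: (lfree_bound fb) => i; apply/Ec/WE.
Qed.

Lemma ldim_lt W E : subspace W -> subspace E -> fin_dim E -> W `<=` E ->
  W <> E -> (ldim W < ldim E)%N.
Proof.
move=> sW sE fE WE nWE; have [b [fb Wb Wsb]] := ldimP sW (fin_dimS WE fE).
have [c [_ _ Ec]] := ldimP sE fE.
have [v [Ev nWv]] : exists v, E v /\ ~ W v.
  apply: contrapT => nv; apply: nWE; apply/seteqP; split => // v Ev.
  by apply: contrapT => nWv; apply: nv; exists v.
apply: (@lfree_bound _ c _ (cons_fam v b)).
  apply: lfree_cons => // -[a av]; apply: nWv; rewrite av.
  by apply: subspace_sum => // i _; apply: subspace_scale.
move=> i; apply: Ec; rewrite /cons_fam.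
by case: unlift => // j; apply: WE.
Qed.

Lemma min_subspace (P : set V -> Prop) E :
  fin_dim E -> (forall W, P W -> subspace W /\ W `<=` E) ->
  (exists W, P W) ->
  exists2 W, P W & forall W', P W' -> W' `<=` W -> W' = W.
Proof.
move=> fE PE [W0 PW0].
have ex : exists d, `[< exists2 W, P W & ldim W = d >].
  by exists (ldim W0); apply/asboolP; exists W0.
case: (ex_minnP ex) => d /asboolP[W PW dW] dmin.
exists W => // W' PW' W'W; apply: contrapT => ne.
have [[sW WE] [sW' _]] := (PE _ PW, PE _ PW').
have /dmin : `[< exists2 W, P W & ldim W = ldim W' >] by apply/asboolP; exists W'.
by rewrite leqNgt -dW (ldim_lt sW' sW) //; apply: fin_dimS fE.
Qed.

Lemma max_subspace (P : set V -> Prop) E :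
  subspace E -> fin_dim E -> (forall W, P W -> subspace W /\ W `<=` E) ->
  (exists W, P W) ->
  exists2 W, P W & forall W', P W' -> W `<=` W' -> W' = W.
Proof.
move=> sE fE PE [W0 PW0].
have ex : exists d, `[< exists2 W, P W & ldim W = d >].
  by exists (ldim W0); apply/asboolP; exists W0.
have le d : `[< exists2 W, P W & ldim W = d >] -> (d <= ldim E)%N.
  by move=> /asboolP[W /PE[sW WE] <-]; apply: ldim_le.
case: (ex_maxnP ex le) => d /asboolP[W PW dW] dmax.
exists W => // W' PW' WW'; apply: contrapT => ne.
have [[sW WE] [sW' W'E]] := (PE _ PW, PE _ PW').
have /dmax : `[< exists2 W, P W & ldim W = ldim W' >] by apply/asboolP; exists W'.
rewrite leqNgt -dW (ldim_lt sW sW') //; first by apply: fin_dimS fE.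
by move=> e; apply: ne.
Qed.

End Subspaces.

(** * Two-sided sequences as modules over polynomials *)

(** The variable acts on sequences indexed by the integers by the shift
    [r |-> r - 1], as multiplication by [z] does on the coefficients of a
    formal series. *)
Section Conv.
Variables (K : comNzRingType) (V : lmodType K).
Implicit Types (p : {poly K}) (g : int -> V).

Definition conv p g : int -> V :=
  fun r => \sum_(k < size p) p`_k *: g (r - k%:Z).

Lemma convE N p g r : (size p <= N)%N ->
  conv p g r = \sum_(k < N) p`_k *: g (r - k%:Z).
Proof.
move=> sp; rewrite /conv (big_ord_widen _ (fun k => p`_k *: g (r - k%:Z)) sp).
rewrite big_mkcond; apply: eq_bigr => k _; case: ltnP => // pk.
by rewrite nth_default // scale0r.
Qed.

Lemma convDp p p' g r : conv (p + p') g r = conv p g r + conv p' g r.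
Proof.
pose N := maxn (size p) (size p').
rewrite (@convE N) ?size_polyD // (@convE N p) ?leq_maxl //.
rewrite (@convE N p') ?leq_maxr // -big_split; apply: eq_bigr => k _ /=.
by rewrite coefD scalerDl.
Qed.

Lemma convZp a p g r : conv (a *: p) g r = a *: conv p g r.
Proof.
rewrite (@convE (size p)) ?size_scale_leq // scaler_sumr.
by apply: eq_bigr => k _; rewrite coefZ scalerA.
Qed.

Lemma conv0p g r : conv 0 g r = 0.
Proof. by rewrite -(scale0r 0) convZp scale0r. Qed.

Lemma convNp p g r : conv (- p) g r = - conv p g r.
Proof. by rewrite -[- p]scaleN1r convZp scaleN1r. Qed.

Lemma convBp p p' g r : conv (p - p') g r = conv p g r - conv p' g r.
Proof. by rewrite convDp convNp. Qed.

Lemma convC a g r : conv a%:P g r = a *: g r.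
Proof.
rewrite (@convE 1) ?size_polyC_leq1 // big_ord1 coefC /=.
by rewrite subr0.
Qed.

Lemma conv1 g r : conv 1 g r = g r.
Proof. by rewrite -polyC1 convC scale1r. Qed.

Lemma convMX p g r : conv (p * 'X) g r = conv p g (r - 1).
Proof.
rewrite (@convE (size p).+1); last first.
  by apply: leq_trans (size_polyMleq _ _) _; rewrite size_polyX addn2.
rewrite big_ord_recl coefMX scale0r add0r; apply: eq_bigr => k _.
by rewrite coefMX /= -addrA -opprD.
Qed.

Lemma convM p p' g r : conv (p * p') g r = conv p (conv p' g) r.
Proof.
elim/poly_ind: p r => [|p c IH] r; first by rewrite mul0r !conv0p.
rewrite mulrDl !convDp mul_polyC convC convZp; congr (_ + _).
by rewrite -mulrA (mulrC 'X) mulrA !convMX IH.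
Qed.

Lemma convMXn p n g r : conv (p * 'X^n) g r = conv p g (r - n%:Z).
Proof.
elim: n r => [|n IH] r; first by rewrite expr0 mulr1 subr0.
by rewrite exprSr mulrA convMX IH -addrA -opprD -PoszD add1n.
Qed.

Lemma convX g r : conv 'X g r = g (r - 1).
Proof. by rewrite -['X]mul1r convMX conv1. Qed.

Lemma conv_XsubC z g r : conv ('X - z%:P) g r = g (r - 1) - z *: g r.
Proof. by rewrite convBp convX convC. Qed.

Lemma convDg p g g' r :
  conv p (fun k => g k + g' k) r = conv p g r + conv p g' r.
Proof.
by rewrite /conv -big_split; apply: eq_bigr => k _ /=; rewrite scalerDr.
Qed.

Lemma convZg p a g r : conv p (fun k => a *: g k) r = a *: conv p g r.
Proof.
rewrite /conv scaler_sumr; apply: eq_bigr => k _.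
by rewrite !scalerA mulrC.
Qed.

Lemma eq_conv p g g' r : g =1 g' -> conv p g r = conv p g' r.
Proof. by move=> gg; apply: eq_bigr => k _; rewrite gg. Qed.

Lemma conv_shift p g r s : conv p (fun k => g (k + s)) r = conv p g (r + s).
Proof. by apply: eq_bigr => k _; congr (_ *: g _); rewrite addrAC. Qed.

Lemma conv_0g p r : conv p (fun=> 0) r = 0 :> V.
Proof. by rewrite /conv big1 // => k _; rewrite scaler0. Qed.

Lemma conv_sum p (I : Type) (s : seq I) (F : I -> int -> V) r :
  conv p (fun k => \sum_(i <- s) F i k) r = \sum_(i <- s) conv p (F i) r.
Proof.
rewrite /conv exchange_big; apply: eq_bigr => k _ /=.
by rewrite scaler_sumr.
Qed.

End Conv.

Lemma conv_linear (K : comNzRingType) (V V' : lmodType K) (f : {linear V -> V'}) p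
    (g : int -> V) r :
  f (conv p g r) = conv p (f \o g) r.
Proof. by rewrite /conv linear_sum; apply: eq_bigr => k _; rewrite linearZ. Qed.

(** * Commuting operators: characters and generalized eigenvectors *)

Section CommutingOperators.
Variables (K : closedFieldType) (V : lmodType K) (Y : Type).
Variable op : Y -> {linear V -> V}.
Hypothesis opC : forall y z w, op y (op z w) = op z (op y w).
Implicit Types (chi : Y -> K) (s : seq (Y -> K)) (E W : set V).

Definition stable E : Prop := forall y w, E w -> E (op y w).

Lemma stable_shift E chi y w : subspace E -> stable E -> E w ->
  E (op y w - chi y *: w).
Proof.
by move=> sE stE Ew; apply: subspace_sub => //; [apply: stE|apply: subspace_scale].
Qed.

(** A linear relation between the iterates of [f] on a vector outside [E']
    factors, and the last factor to leave [E'] gives an eigenvector modulo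
    [E']. *)
Lemma rel_eigenvector1 (f : {linear V -> V}) W E' :
  fin_dim W -> (forall w, W w -> W (f w)) -> subspace W -> subspace E' ->
  (exists2 w, W w & ~ E' w) ->
  exists mu w, [/\ W w, ~ E' w & E' (f w - mu *: w)].
Proof.
move=> [D [b Wb]] fW sW sE' [w0 Ww0 nE'w0].
pose g w (r : int) := iter `|r|%N f w.
have Wg w r : W w -> W (g w r).
  by move=> Ww; rewrite /g; elim: `|r|%N => //= k IH; apply: fW.
have ub k (j : 'I_1) : lspan b (g w0 (- k%:Z)) by apply/Wb/Wg.
have [p p0 /(_ ord0) rel] := linear_relation ub.
have [rs prs] := closed_field_poly_normal p.
have {rel} : E' (conv (\prod_(z <- rs) ('X - z%:P)) (g w0) 0).
  have e : conv p (g w0) 0 = 0.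
    by rewrite -[RHS]rel; apply: eq_bigr => k _; rewrite sub0r.
  suff -> : conv (\prod_(z <- rs) ('X - z%:P)) (g w0) 0 = 0 by case: sE'.
  move: e; rewrite {1}prs convZp => /eqP.
  by rewrite scaler_eq0 lead_coef_eq0 (negPf p0) => /eqP.
elim: rs w0 Ww0 nE'w0 {ub prs} => [|z rs IH] w Ww nE'w.
  by rewrite big_nil conv1.
rewrite big_cons mulrC convM => Ez.
have Wz : W (f w - z *: w).
  by apply: subspace_sub => //; [apply: fW | apply: subspace_scale].
have [E'z|nE'z] := pselect (E' (f w - z *: w)); first by exists z, w.
apply: (IH _ Wz nE'z); move: Ez; congr E'.
apply: eq_bigr => k _; congr (_ *: _).
rewrite convBp convX convC /g sub0r -opprD !abszN -PoszD addn1 /=.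
elim: (k : nat) => //= j IHj.
by rewrite -linearZ -linearB IHj.
Qed.

(** All operators act by scalars modulo [E'] on a minimal stable subspace not
    contained in [E']. *)
Lemma rel_joint_eigenvector E E' : subspace E -> fin_dim E -> stable E ->
  subspace E' -> stable E' -> ~ (E `<=` E') ->
  exists u chi, [/\ E u, ~ E' u & forall y, E' (op y u - chi y *: u)].
Proof.
move=> sE fE stE sE' stE' nEE'.
pose P W := [/\ subspace W, W `<=` E, stable W & ~ (W `<=` E')].
have [||W [sW WE stW nW] Wmin] := @min_subspace _ _ P E fE.
- by move=> W [].
- by exists E; split.
have pick : exists2 w, W w & ~ E' w.
  apply: contrapT => n; apply: nW => w Ww; apply: contrapT => nw.
  by apply: n; exists w.
have ev y : exists mu, forall w, W w -> E' (op y w - mu *: w).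
  have [|mu [w0 [Ww0 nEw0 E'w0]]] :=
    rel_eigenvector1 (fin_dimS WE fE) _ sW sE' pick (f := op y).
    by move=> w; apply: stW.
  exists mu => w Ww.
  pose W' := [set w | W w /\ E' (op y w - mu *: w)].
  suff e : W' = W by move: Ww; rewrite -e => -[].
  apply: Wmin => [|v []//]; split.
  - case: (sW) (sE') => [W0 WL] [E'0 E'L].
    split; first by split=> //=; rewrite linear0 scaler0 subr0.
    move=> a v v' [Wv Ev] [Wv' Ev']; split; first exact: WL.
    have -> : op y (a *: v + v') - mu *: (a *: v + v') =
      a *: (op y v - mu *: v) + (op y v' - mu *: v').
      rewrite linearP scalerDr scalerBr !scalerA (mulrC mu).
      by rewrite opprD addrACA.
    exact: E'L.
  - by move=> v [/WE].
  - move=> z v [Wv Ev]; split; first exact: stW.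
    by rewrite opC -linearZ -linearB; apply: stE'.
  - by move=> sub; apply: nEw0; apply: sub.
have /(_ _)/cid ch := ev.
have [w Ww nw] := pick.
exists w, (fun y => sval (ch y)); split => //; first exact: WE.
by move=> y; apply: (svalP (ch y)).
Qed.

Lemma joint_eigenvector E : subspace E -> fin_dim E -> stable E ->
  (exists2 w, E w & w <> 0) ->
  exists u chi, [/\ E u, u <> 0 & forall y, op y u = chi y *: u].
Proof.
move=> sE fE stE [w Ew w0].
have [||u [chi [Eu u0 uchi]]] :=
  rel_joint_eigenvector sE fE stE (@subspace0 K V).
- by move=> y v /= ->; rewrite linear0.
- by move=> /(_ w Ew).
by exists u, chi; split => // y; apply/eqP; rewrite -subr_eq0; apply/eqP/uchi.
Qed.

(** Vectors killed by every product [\prod_l (op y_l - chi_l y_l)] over the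
    characters [chi_l] in [s], for all choices of the indices [y_l]: those
    having a filtration on which the operators act through the characters in
    [s]. *)
Fixpoint gker s : set V :=
  if s is chi :: s' then [set w | forall y, gker s' (op y w - chi y *: w)]
  else [set 0].

Lemma subspace_gker s : subspace (gker s).
Proof.
elim: s => [|chi s [IH0 IHL]]; first exact: subspace0.
split=> [y|a v w /= Hv Hw y]; first by rewrite linear0 scaler0 subr0.
have -> : op y (a *: v + w) - chi y *: (a *: v + w) =
  a *: (op y v - chi y *: v) + (op y w - chi y *: w).
  by rewrite linearP scalerDr scalerBr !scalerA (mulrC (chi y)) opprD addrACA.
exact: IHL.
Qed.

Lemma stable_gker s : stable (gker s).
Proof.
elim: s => [|chi s IH] y w; first by move=> /= ->; rewrite linear0.
by move=> Hw z /=; rewrite opC -linearZ -linearB; apply: IH.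
Qed.

Lemma gker_cons chi s : gker s `<=` gker (chi :: s).
Proof.
move=> w Hw y; apply: (stable_shift _ _ (subspace_gker s)) => //.
exact: stable_gker.
Qed.

Lemma gker_catr s s' : gker s' `<=` gker (s ++ s').
Proof.
by elim: s => //= chi s IH w Hw; apply: (@gker_cons chi); apply: IH.
Qed.

Lemma gker_catl s s' : gker s `<=` gker (s ++ s').
Proof.
elim: s => [|chi s IH] w /=; last by move=> Hw y; apply: IH.
by move=> ->; case: (subspace_gker s').
Qed.

Lemma gker_eigen s u chi : u <> 0 -> (forall y, op y u = chi y *: u) ->
  gker s u -> chi \in s.
Proof.
move=> u0 uchi; elim: s => [//|chi' s IH] Hu; rewrite inE.
case: eqP => //= ne; apply: IH.
have [y ney] : exists y, chi y != chi' y.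
  apply: contrapT => n; apply: ne; apply/funext => y; apply/eqP.
  by apply: contrapT => /negP nn; apply: n; exists y.
have := Hu y; rewrite uchi -scalerBl.
move=> /(subspace_scale (chi y - chi' y)^-1 (subspace_gker s)).
by rewrite scalerA mulVf ?scale1r // subr_eq0.
Qed.

Lemma fin_dim_gker E : subspace E -> fin_dim E -> stable E ->
  exists s, E `<=` gker s.
Proof.
move=> sE fE stE.
pose P W := exists s, W = E `&` gker s.
have PE W : P W -> subspace W /\ W `<=` E.
  move=> [s ->]; split; last by move=> w [].
  by apply: subspaceI => //; apply: subspace_gker.
have [|_ [s ->] smax] := max_subspace sE fE PE; first by exists (E `&` gker [::]), [::].
exists s; apply: contrapT => nE.
have [u [chi [Eu nu uchi]]] :=
  rel_joint_eigenvector sE fE stE (subspace_gker s) (@stable_gker s) nE.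
have /smax : P (E `&` gker (chi :: s)) by exists (chi :: s).
have -> : E `&` gker (chi :: s) = E `&` gker s <-> False; last first.
  by apply => w [Ew /(@gker_cons chi)].
split=> // /seteqP[sub _]; apply: nu.
by have [] := sub u (conj Eu uchi).
Qed.

(** ** Currents shifted by the commuting operators *)

Variables (X : int -> {linear V -> V}) (m : Y -> int) (c : Y -> K).
Hypothesis opX : forall y r w,
  op y (X r w) = X r (op y w) + c y *: X (r + m y) w.

Definition current (p : {poly K}) (r : int) (w : V) : V :=
  conv p (fun k => X k w) r.

Lemma currentP p r : linear (current p r).
Proof.
move=> a v w; rewrite /current -convZg -convDg; apply: eq_conv => k.
by rewrite linearP.
Qed.

HB.instance Definition _ p r :=
  GRing.isLinear.Build K V V *:%R (current p r) (currentP p r).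

Lemma current0 p r : current p r 0 = 0.
Proof. exact: linear0. Qed.

Lemma currentZp a p r w : current (a *: p) r w = a *: current p r w.
Proof. exact: convZp. Qed.

Lemma current_sum p r d (a : 'I_d -> K) (b : 'I_d -> V) :
  current p r (\sum_i a i *: b i) = \sum_i a i *: current p r (b i).
Proof.
rewrite /current -(eq_bigr _ (fun i _ => convZg _ _ _ _)) -conv_sum.
by apply: eq_conv => k; rewrite linear_sum; apply: eq_bigr => i _; rewrite linearZ.
Qed.

Lemma op_current y p r w : op y (current p r w) =
  current p r (op y w) + c y *: current p (r + m y) w.
Proof.
rewrite /current -conv_shift -convZg -convDg conv_linear; apply: eq_conv => k.
exact: opX.
Qed.

(** A polynomial annihilating the current at one index annihilates it at all
    indices: commutators with the operators of degree [1] and [-1] shift. *)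
Lemma current_annihilator E E' y1 y2 :
  subspace E -> fin_dim E -> fin_dim E' -> stable E ->
  (forall r w, E w -> E' (X r w)) ->
  m y1 = 1 -> c y1 != 0 -> m y2 = -1 -> c y2 != 0 ->
  exists2 p, ~~ root p 0 & forall r w, E w -> current p r w = 0.
Proof.
move=> sE fE [D [b E'b]] stE XE m1 c1 m2 c2.
have [d [e [_ Ee Espan]]] := lbasis_exists sE fE.
have ub k (j : 'I_d) : lspan b (X (- k%:Z) (e j)) by apply/E'b/XE/Ee.
have [p p0 rel] := linear_relation ub.
have [n [q /implyP/(_ p0) q0 pq]] := multiplicity_XsubC p 0.
exists q => //.
have base w : E w -> current q (- n%:Z) w = 0.
  move=> /Espan[a ->]; rewrite current_sum big1 // => j _.
  have -> : current q (- n%:Z) (e j) = current p 0 (e j).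
    by rewrite pq subr0 /current convMXn sub0r.
  suff -> : current p 0 (e j) = 0 by rewrite scaler0.
  rewrite -[RHS](rel j); apply: eq_bigr => k _.
  by rewrite sub0r.
have step y r : c y != 0 -> (forall w, E w -> current q r w = 0) ->
    forall w, E w -> current q (r + m y) w = 0.
  move=> cy q0r w Ew; have := op_current y q r w.
  rewrite (q0r _ Ew) linear0 (q0r _ (stE y _ Ew)) add0r => /eqP.
  by rewrite eq_sym scaler_eq0 (negPf cy) => /eqP.
move=> r; rewrite -(subrK (- n%:Z) r) addrC.
elim/int_rec: (r - _) => [|k IH|k IH] w Ew; first by rewrite addr0; apply: base.
  by rewrite intS (addrC 1) addrA -m1; apply: step.
by rewrite intS opprD (addrC (-1)) addrA -m2; apply: step.
Qed.

Definition shift_char chi (z : K) : Y -> K := fun y => chi y + c y * z ^ (- m y).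

Lemma current_shift_dvd z (k r : int) : z != 0 -> exists g r', forall p w,
  current p (r + k) w - z ^ (- k) *: current p r w =
  current (p * (('X - z%:P) * g)) r' w.
Proof.
move=> z0.
have dv n : exists g, 'X^n - (z ^+ n)%:P = ('X - z%:P) * g.
  by rewrite polyC_exp subrXX; eexists.
have xn p (r' : int) n w : current (p * ('X^n - (z ^+ n)%:P)) r' w =
    current p (r' - n%:Z) w - z ^+ n *: current p r' w.
  by rewrite /current mulrBr convBp convMXn (mulrC p _%:P) mul_polyC convZp.
case: k => n; have [g gE] := dv n; last have {g gE}[g gE] := dv n.+1.
  exists (- (z ^+ n)^-1 *: g), (r + n%:Z) => p w.
  rewrite -!scalerAr currentZp -gE xn addrK.
  rewrite scalerBr !scaleNr scalerA mulVf ?expf_neq0 // scale1r opprK addrC.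
  by rewrite -exprnN.
by exists g, r => p w; rewrite -gE xn NegzE opprK -exprnP.
Qed.

(** If [g * \prod (z - z_l)] annihilates the current on [E], the current cut
    down by [g] moves generalized eigenvectors by the characters attached to
    the points [z_l] only. *)
Lemma gker_current E s rs g w r : subspace E -> stable E -> all (predC1 0) rs ->
  (forall r' v, E v -> current (g * \prod_(z <- rs) ('X - z%:P)) r' v = 0) ->
  E w -> gker s w ->
  gker [seq shift_char chi z | chi <- s, z <- rs] (current g r w).
Proof.
move=> sE stE rs0.
elim: s g w r => [|chi s IHs] g w r.
  by move=> _ _ /= ->; rewrite current0.
move=> g0 Ew Hw; set rest := [seq shift_char chi z | chi <- s, z <- rs].
rewrite -[X in gker X]/([seq shift_char chi z | z <- rs] ++ rest).

suff main rs' : all (predC1 0) rs' ->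
    (exists q, \prod_(z <- rs) ('X - z%:P) = q * \prod_(z <- rs') ('X - z%:P)) ->
    forall g r,
    (forall r' v, E v ->
       current (g * \prod_(z <- rs') ('X - z%:P)) r' v = 0) ->
    gker ([seq shift_char chi z | z <- rs'] ++ rest) (current g r w).
  by apply: main => //; exists 1; rewrite mul1r.
elim: rs' {g r g0} => [|z rs' IHrs] rs'0 [q qE] g r g0.
  rewrite big_nil mulr1 in g0; rewrite g0 //=.
  by case: (subspace_gker rest).
case/andP: rs'0 => z0 rs'0 y.
have -> : op y (current g r w) - shift_char chi z y *: current g r w =
    current g r (op y w - chi y *: w) +
    c y *: (current g (r + m y) w - z ^ (- m y) *: current g r w).
  rewrite op_current /shift_char scalerDl scalerBr scalerA.
  have -> : current g r (op y w - chi y *: w) =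
      current g r (op y w) - chi y *: current g r w.
    rewrite -[op y w - _]addrC -scaleNr.
    by rewrite currentP scaleNr addrC.
  by rewrite opprD addrACA addrA addrAC -!addrA; congr (_ + _); rewrite addrCA.
apply: subspace_add; first exact: subspace_gker.
  apply: (@gker_catr [seq shift_char chi z | z <- rs']).
  apply: IHs; last exact: Hw; last exact: (stable_shift _ _ sE stE).
  by move=> r' v Ev; rewrite qE mulrCA /current convM (eq_conv _ _ (fun k => g0 k v Ev)) conv_0g.
apply: subspace_scale; first exact: subspace_gker.
have [g2 [r' ->]] := current_shift_dvd (m y) r z0.
apply: IHrs => //; first by exists (q * ('X - z%:P)); rewrite qE big_cons mulrA.
move=> r2 v Ev; rewrite [X in current X](_ : _ = g2 * (g * \prod_(z <- z :: rs') ('X - z%:P))).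
  by rewrite /current convM (eq_conv _ _ (fun k => g0 k v Ev)) conv_0g.
by rewrite big_cons !mulrA; congr (_ * _); rewrite mulrC !mulrA.
Qed.

End CommutingOperators.

(** * Representations of the quantum affinization *)

Notation qsign e := ((-1) ^+ (e : bool)).

Section Relations.
Variables (R : realType) (n : nat) (c : cartan_datum n) (rl : realization c)
          (q : qparam R[i]).
Local Notation C := R[i].
Local Notation H := (car rl).
Local Notation B := (bmat c).
Local Notation q1 := (qpow q 1).
Local Notation U := (Uq rl q).
Local Notation rels := (@uq_rel R n c rl q).
Local Notation pi := (presented_pi rels).

Lemma free_scalerAr a (x y : free_alg R rl) : a *: (x * y) = x * (a *: y).
Proof.
have Ccomm (g : {malg C[{fmonom gen rl}]}) : (a%:MP : {malg C[{fmonom gen rl}]}) * g = g * a%:MP.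
  rewrite [LHS]fgmulUg [RHS]fgmulgU; apply: eq_bigr => k _.
  by rewrite mulrC mul1m mulm1.
have e (g : {malg C[{fmonom gen rl}]}) : a *: g = g * a%:MP by rewrite -mul_malgC Ccomm.
by rewrite [LHS](e (x * y)) [in RHS](e y) mulrA.
Qed.

Lemma Uq_scalerAr a (u v : U) : a *: (u * v) = u * (a *: v).
Proof.
rewrite -(presented_reprK u) -(presented_reprK v).
by rewrite -rmorphM -!linearZ -rmorphM free_scalerAr.
Qed.

Lemma Uq_scalerAl a (u v : U) : a *: (u * v) = (a *: u) * v.
Proof. exact: presented_scalerAl. Qed.

Lemma Uq_piM x y : pi (x * y) = pi x * pi y. Proof. exact: rmorphM. Qed.
Lemma Uq_piB x y : pi (x - y) = pi x - pi y. Proof. exact: raddfB. Qed.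
Lemma Uq_piZ a x : pi (a *: x) = a *: pi x. Proof. exact: linearZ. Qed.

Lemma Uq_pi_rel x : rels x -> pi x = 0.
Proof.
move=> rx; rewrite -(linear0 pi); apply/eqP; rewrite presented_eq subr0.
by apply/asboolP => J _; apply.
Qed.

Lemma Uq_pi_relB x y : rels (x - y) -> pi x = pi y.
Proof. by move=> rx; apply/eqP; rewrite presented_eq; move/Uq_pi_rel/eqP: rx; rewrite -(linear0 pi) presented_eq subr0. Qed.

Definition h_ (y : 'I_n * {m : int | m != 0}) : U := pi (fh R rl y.1 y.2).

Lemma pi_product x y z : rels (x * y - z) -> pi x * pi y = pi z.
Proof. by move=> rx; exact: etrans (esym (Uq_piM x y)) (Uq_pi_relB rx). Qed.

Lemma k_add h h' : k_ q h * k_ q h' = k_ q (h + h') :> U.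
Proof. exact: pi_product (rel_kD q h h'). Qed.

Lemma k_zero : k_ q 0 = 1 :> U.
Proof. exact: (Uq_pi_relB (rel_k0 rl q)). Qed.

Lemma pi_commute x y : rels (x * y - y * x) -> pi x * pi y = pi y * pi x.
Proof. by move=> rx; rewrite -(Uq_piM x y) -(Uq_piM y x); exact: Uq_pi_relB. Qed.

Lemma k_h h y : k_ q h * h_ y = h_ y * k_ q h.
Proof. exact: pi_commute (rel_kh q h y.1 y.2). Qed.

Lemma h_h y z : h_ y * h_ z = h_ z * h_ y.
Proof. exact: pi_commute (rel_hh rl q y.1 y.2 z.1 z.2). Qed.

Lemma pi_conjugate x y z a : rels (x * y * z - a *: y) ->
  pi x * pi y * pi z = a *: pi y.
Proof.
by move=> rx; rewrite -(Uq_piM x y) -(Uq_piM (x * y) z) -(Uq_piZ a y); exact: Uq_pi_relB.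
Qed.

Lemma pi_commutator x y z a : rels (x * y - y * x - a *: z) ->
  pi x * pi y - pi y * pi x = a *: pi z.
Proof.
move=> rx; rewrite -(Uq_piM x y) -(Uq_piM y x) -(Uq_piZ a z).
by rewrite -(Uq_piB (x * y) (y * x)); exact: Uq_pi_relB.
Qed.

Lemma k_x h e j r : k_ q h * x_ rl q e j r =
  (qpow q (qsign e * Defs.root rl j h) *: x_ rl q e j r) * k_ q h.
Proof.
have e1 := pi_conjugate (rel_kx q h e j r).
transitivity (k_ q h * x_ rl q e j r * k_ q (- h) * k_ q h).
  by rewrite -mulrA k_add addNr k_zero mulr1.
by congr (_ * _).
Qed.

(** The scalar [c] in [h_y x - x h_y = c x]. *)
Definition h_coef (e : bool) (j : 'I_n) (y : 'I_n * {m : int | m != 0}) : C :=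
  qsign e * (sval y.2)%:~R^-1 * qint q1 (sval y.2 * B y.1 j).

Lemma h_x y e j r : h_ y * x_ rl q e j r =
  x_ rl q e j r * h_ y + h_coef e j y *: x_ rl q e j (r + sval y.2).
Proof.
have e1 : h_ y * x_ rl q e j r - x_ rl q e j r * h_ y =
    h_coef e j y *: x_ rl q e j (sval y.2 + r).
  exact: pi_commutator (rel_hx rl q y.1 y.2 e j r).
by rewrite (addrC r) -e1 addrC subrK.
Qed.

Definition psi_ i (r : int) : U :=
  (qi c q i - (qi c q i)^-1)^-1 *: (pi (fphiz rl q false i r) - pi (fphiz rl q true i r)).

Lemma x_x i j r s : x_ rl q false i r * x_ rl q true j s =
  x_ rl q true j s * x_ rl q false i r + (i == j)%:R *: psi_ i (r + s).
Proof.
have e1 : x_ rl q false i r * x_ rl q true j s - x_ rl q true j s * x_ rl q false i r =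
    (i == j)%:R *: psi_ i (r + s).
  have -> : psi_ i (r + s) = pi ((qi c q i - (qi c q i)^-1)^-1 *:
      (fphiz rl q false i (r + s) - fphiz rl q true i (r + s))).
    by rewrite /psi_ [RHS]Uq_piZ (Uq_piB (fphiz rl q false i (r + s))).
  exact: pi_commutator (rel_xpm rl q i j r s).
by rewrite -e1 addrC subrK.
Qed.

Lemma qpow0 : qpow q 0 = 1.
Proof.
have q0 : qpow q 0 != 0.
  apply: contra_neq (qpow1_neq0 q) => q0.
  by rewrite -[1]addr0 qpowD q0 mulr0.
by apply: (mulfI q0); rewrite mulr1 -qpowD addr0.
Qed.

Lemma qpow_neq0 s : qpow q s != 0.
Proof.
apply: contra_neq (@oner_neq0 C) => e.
by rewrite -qpow0 -(subrr s) qpowD e mul0r.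
Qed.

Lemma qpowN s : qpow q (- s) = (qpow q s)^-1.
Proof.
by apply: (mulIf (qpow_neq0 s)); rewrite -qpowD addNr qpow0 mulVf ?qpow_neq0.
Qed.

Lemma pi_xx x x' y y' b b' :
  rels ((x' * y - b *: (x * y')) - (b' *: (y * x') - y' * x)) ->
  pi x' * pi y - b *: (pi x * pi y') = b' *: (pi y * pi x') - pi y' * pi x.
Proof.
move=> rx; rewrite -(Uq_piM x' y) -(Uq_piM x y') -(Uq_piM y x') -(Uq_piM y' x).
rewrite -(Uq_piZ b (x * y')) -(Uq_piZ b' (y * x')).
rewrite -(Uq_piB (x' * y) (b *: (x * y'))) -(Uq_piB (b' *: (y * x')) (y' * x)).
exact: Uq_pi_relB.
Qed.

Lemma x_xx i r s (Q := qpow q (B i i)%:~R) :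
  x_ rl q true i (r + 1) * x_ rl q true i s -
     Q^-1 *: (x_ rl q true i r * x_ rl q true i (s + 1))
  = Q^-1 *: (x_ rl q true i s * x_ rl q true i (r + 1)) -
     x_ rl q true i (s + 1) * x_ rl q true i r.
Proof.
have := pi_xx (rel_xx rl q true i i (r + 1) (s + 1)).
by rewrite !addrK mulN1r qpowN.
Qed.

End Relations.

Section QPowers.
Variables (F : fieldType) (q : qparam F).

Lemma qpow_nat s m : qpow q (s *+ m) = qpow q s ^+ m.
Proof.
elim: m => [|m IH]; last by rewrite mulrS qpowD IH exprS.
have q0 : qpow q 0 != 0.
  apply: contra_neq (qpow1_neq0 q) => q0.
  by rewrite -[1]addr0 qpowD q0 mulr0.
by apply: (mulfI q0); rewrite mulr1 -qpowD addr0.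
Qed.

Lemma qpow_inj : injective (qpow q).
Proof.
have q0 : qpow q 0 = 1 by rewrite -[0](mulr0n 0) qpow_nat.
suff inj0 r : qpow q r = 1 -> r = 0.
  move=> s t e; apply/eqP; rewrite -subr_eq0; apply/eqP/inj0.
  by rewrite qpowD e -qpowD subrr.
wlog r0 : r / 0 <= r => [th|] qr.
  have /orP[/th->//|r0] := le_total 0 r.
  apply: oppr_inj; rewrite oppr0; apply: th; first by rewrite oppr_ge0.
  by rewrite -[LHS]mul1r -[X in X * _]qr -qpowD subrr.
have aE : numq r = `|numq r|%N by rewrite gez0_abs ?numq_ge0.
have bE : denq r = `|denq r|%N by rewrite gez0_abs ?denq_ge0.
have : qpow q 1 ^+ `|numq r| = 1.
  rewrite -qpow_nat; transitivity (qpow q (r *+ `|denq r|)).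
    congr (qpow q _).
    by rewrite (pmulrn 1 `|numq r|) (pmulrn r `|denq r|) -aE -bE numqE mulrzr.
  by rewrite qpow_nat qr expr1n.
have [/eqP|r1 /eqP] := posnP `|numq r|; first by rewrite absz_eq0 numq_eq0 => /eqP.
by rewrite (negPf (qpow1_not_root q r1)).
Qed.

End QPowers.

(** Relations of degree at most two, transported to a representation; stated
    over an abstract ring so that unification never compares products in the
    quotient algebra. *)
Section ActingProducts.
Variables (K : nzRingType) (A : pzRingType) (sc : K -> A -> A) (V : lmodType K).
Variable f : A -> V -> V.
Hypothesis fD : forall u v w, f (u + v) w = f u w + f v w.
Hypothesis fM : forall u v w, f (u * v) w = f u (f v w).
Hypothesis fZ : forall a u w, f (sc a u) w = a *: f u w.

Lemma act_prod2 u v u' v' w : u * v = u' * v' -> f u (f v w) = f u' (f v' w).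
Proof. by rewrite -!fM => ->. Qed.

Lemma act_prodZ u v a u' v' w : u * v = sc a u' * v' ->
  f u (f v w) = a *: f u' (f v' w).
Proof. by rewrite -fM => ->; rewrite fM fZ. Qed.

Lemma act_prodD u v u' v' a t w : u * v = u' * v' + sc a t ->
  f u (f v w) = f u' (f v' w) + a *: f t w.
Proof. by rewrite -!fM -fZ -fD => ->. Qed.

Lemma act_subr u v w : f (u - v) w = f u w - f v w.
Proof.
have f0 : f 0 w = 0 by apply: (@addrI _ (f 0 w)); rewrite -fD !addr0.
by rewrite fD; congr (_ + _); apply/eqP; rewrite -addr_eq0 -fD addNr f0.
Qed.

Lemma act_prodB u v u' v' a s t s' t' w :
  u * v - sc a (u' * v') = sc a (s * t) - s' * t' ->
  f u (f v w) - a *: f u' (f v' w) = a *: f s (f t w) - f s' (f t' w).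
Proof.
by move=> e; rewrite -!fM -!fZ -!act_subr e.
Qed.

End ActingProducts.

Section Representations.
Variables (R : realType) (n : nat) (c : cartan_datum n) (rl : realization c)
          (q : qparam R[i]).
Local Notation C := R[i].
Local Notation H := (car rl).
Local Notation U := (Uq rl q).
Local Notation hst := (hstar H).

(** Uq-modules presented over the complex numbers, so that weight spaces are
    subspaces of a complex vector space. *)
Record rep := Rep {
  rep_car :> lmodType C;
  act : U -> rep_car -> rep_car;
  act_linear : forall u, linear (act u);
  actD : forall u v w, act (u + v) w = act u w + act v w;
  actM : forall u v w, act (u * v) w = act u (act v w);
  act1 : forall w, act 1 w = w;
  actZ : forall a u w, act (a *: u) w = a *: act u w
}.

HB.instance Definition _ (M : rep) (u : U) :=
  GRing.isLinear.Build C M M *:%R (@act M u) (act_linear u).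

End Representations.

(* The operators are sealed: they all are instances of one action, which
   unification would otherwise try to identify. *)
HB.lock Definition Kop (R : realType) (n : nat) (c : cartan_datum n)
  (rl : realization c) (q : qparam R[i]) (M : rep rl q) (h : car rl) :
  {linear M -> M} := @act R n c rl q M (k_ q h).
HB.lock Definition Hop (R : realType) (n : nat) (c : cartan_datum n)
  (rl : realization c) (q : qparam R[i]) (M : rep rl q)
  (y : 'I_n * {m : int | m != 0}) : {linear M -> M} :=
  @act R n c rl q M (h_ rl q y).
HB.lock Definition Xop (R : realType) (n : nat) (c : cartan_datum n)
  (rl : realization c) (q : qparam R[i]) (M : rep rl q) (e : bool) (i : 'I_n)
  (r : int) : {linear M -> M} := @act R n c rl q M (x_ rl q e i r).
HB.lock Definition Psiop (R : realType) (n : nat) (c : cartan_datum n)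
  (rl : realization c) (q : qparam R[i]) (M : rep rl q) (i : 'I_n) (r : int) :
  {linear M -> M} := @act R n c rl q M (psi_ rl q i r).

Section Weights.
Variables (R : realType) (n : nat) (c : cartan_datum n) (rl : realization c)
          (q : qparam R[i]).
Local Notation C := R[i].
Local Notation H := (car rl).
Local Notation U := (Uq rl q).
Local Notation hst := (hstar H).

Section OneRep.
Variable M : rep rl q.
Implicit Types (w : M) (W : set M).
Local Notation Kop := (Kop M).
Local Notation Hop := (Hop M).
Local Notation Xop := (Xop M).
Local Notation Psiop := (Psiop M).

Definition hdeg (y : 'I_n * {m : int | m != 0}) : int := sval y.2.

Lemma Kop_X h e j r w : Kop h (Xop e j r w) =
  qpow q (qsign e * Defs.root rl j h) *: Xop e j r (Kop h w).
Proof. rewrite Kop.unlock Xop.unlock; exact: (act_prodZ (@actM _ _ _ _ _ M) (@actZ _ _ _ _ _ M) w (k_x q h e j r)). Qed.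

Lemma Kop_H h y w : Kop h (Hop y w) = Hop y (Kop h w).
Proof. rewrite Kop.unlock Hop.unlock; exact: (act_prod2 (@actM _ _ _ _ _ M) w (k_h q h y)). Qed.

Lemma HopC y z w : Hop y (Hop z w) = Hop z (Hop y w).
Proof. rewrite Hop.unlock; exact: (act_prod2 (@actM _ _ _ _ _ M) w (h_h rl q y z)). Qed.

Lemma Hop_X e j y r w : Hop y (Xop e j r w) =
  Xop e j r (Hop y w) + h_coef c q e j y *: Xop e j (r + hdeg y) w.
Proof. rewrite Hop.unlock Xop.unlock; exact: (act_prodD (@actD _ _ _ _ _ M) (@actM _ _ _ _ _ M) (@actZ _ _ _ _ _ M) w (h_x rl q y e j r)). Qed.

Lemma Xop_X i j r s w : Xop false i r (Xop true j s w) =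
  Xop true j s (Xop false i r w) + (i == j)%:R *: Psiop i (r + s) w.
Proof. rewrite Psiop.unlock Xop.unlock; exact: (act_prodD (@actD _ _ _ _ _ M) (@actM _ _ _ _ _ M) (@actZ _ _ _ _ _ M) w (x_x rl q i j r s)). Qed.

Lemma Xop_xx i r s w (Q := qpow q (bmat c i i)%:~R) :
  Xop true i (r + 1) (Xop true i s w) -
     Q^-1 *: Xop true i r (Xop true i (s + 1) w)
  = Q^-1 *: Xop true i s (Xop true i (r + 1) w) -
     Xop true i (s + 1) (Xop true i r w).
Proof. rewrite Xop.unlock; exact: (act_prodB (@actD _ _ _ _ _ M) (@actM _ _ _ _ _ M) (@actZ _ _ _ _ _ M) w (x_xx rl q i r s)). Qed.

Definition wt (l : hst) : set M := [set w | forall h, Kop h w = qpow q (l h) *: w].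

Lemma subspace_wt l : subspace (wt l).
Proof.
split=> [h|a v w Hv Hw h]; first by rewrite linear0 scaler0.
by rewrite linearP Hv Hw scalerDr !scalerA mulrC.
Qed.

Lemma wt_H l : stable Hop (wt l).
Proof. by move=> y w Hw h; rewrite Kop_H Hw linearZ. Qed.

Lemma wt_X l e i r w : wt l w -> wt (l + qsign e *: Defs.root rl i) (Xop e i r w).
Proof.
move=> Hw h; rewrite Kop_X Hw linearZ scalerA -qpowD.
by rewrite add_lfunE scale_lfunE addrC.
Qed.

Lemma wt_Xp l i r w : wt l w -> wt (l + Defs.root rl i) (Xop false i r w).
Proof. by move/(wt_X false i r); rewrite scale1r. Qed.

Lemma wt_Xm l i r w : wt l w -> wt (l - Defs.root rl i) (Xop true i r w).
Proof. by move/(wt_X true i r); rewrite expr1 scaleN1r. Qed.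

Definition submodule W := subspace W /\ forall u w, W w -> W (act u w).

(** Vectors of distinct weights are separated by the operators [k_h], also
    modulo a submodule. *)
Lemma weight_components W (s : seq hst) (f : hst -> M) : submodule W -> uniq s ->
  (forall l, l \in s -> wt l (f l)) -> W (\sum_(l <- s) f l) ->
  forall l, l \in s -> W (f l).
Proof.
move=> [sW stW]; elim: s f => [|l0 s IH] f //= /andP[nl0 us] Hf.
rewrite big_cons => Wsum.
have Ws l : l \in s -> W (f l).
  move=> ls.
  have /existsNP[h /eqP neh] : ~ (forall h, l h = l0 h).
    by move=> e; move: nl0; have /lfunP <- : l =1 l0 := e; rewrite ls.
  pose g (l : hst) := (qpow q (l h) - qpow q (l0 h)) *: f l.
  have : W (g l).
    apply: IH ls => // [l' l's|].
      apply: (subspace_scale _ (subspace_wt l')).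
      by apply: Hf; rewrite inE l's orbT.
    have -> : \sum_(l <- s) g l =
        Kop h (f l0 + \sum_(j <- s) f j) - qpow q (l0 h) *: (f l0 + \sum_(j <- s) f j).
      rewrite linearD linear_sum /= Hf ?mem_head // scalerDr opprD addrACA subrr add0r.
      rewrite scaler_sumr -sumrB; apply: eq_big_seq => l' l's.
      by rewrite Hf ?inE ?l's ?orbT // /g scalerBl.
    apply: (subspace_sub sW); last exact: subspace_scale.
    by rewrite Kop.unlock; exact: stW.
  move/(subspace_scale (qpow q (l h) - qpow q (l0 h))^-1 sW).
  rewrite scalerA mulVf ?scale1r // subr_eq0.
  by apply: contra_neq neh => /qpow_inj.
move=> l; rewrite inE => /orP[/eqP->|]; last exact: Ws.
rewrite -[f l0](addrK (\sum_(j <- s) f j)); apply: subspace_sub => //.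
by rewrite big_seq; apply: subspace_sum.
Qed.

Lemma submodule0 : submodule [set 0].
Proof. by split; [exact: subspace0 | move=> u w /= ->; rewrite linear0]. Qed.

Definition weight_sum w := exists (s : seq hst) (f : hst -> M),
  (forall l, wt l (f l)) /\ w = \sum_(l <- s) f l.

Lemma weight_sum_uniq w : weight_sum w -> exists (s : seq hst) (f : hst -> M),
  [/\ uniq s, forall l, wt l (f l) & w = \sum_(l <- s) f l].
Proof.
move=> [s [f [Hf ->]]].
exists (undup s), (fun l => f l *+ count_mem l s); split; first exact: undup_uniq.
  by move=> l; rewrite -scaler_nat; apply: (subspace_scale _ (subspace_wt l)).
rewrite -big_undup_iterop_count; apply: eq_bigr => l _.
by rewrite Monoid.iteropE -/(GRing.natmul _ _); elim: count => //= k ->; rewrite mulrS.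
Qed.

(** A module with the finiteness properties of the category, stated without
    reference to bases. *)
Record tame := Tame {
  tame_weight : forall w, weight_sum w;
  tame_fin : forall l, fin_dim (wt l);
  tame_cone : exists s : seq hst, forall l,
    (exists2 w, wt l w & w <> 0) -> exists2 l0, l0 \in s & inS l0 l;
  tame_int : forall l i, exists N : nat, forall r, (N <= r)%N ->
    wt (l + Defs.root rl i *+ r) `<=` [set 0] /\
    wt (l - Defs.root rl i *+ r) `<=` [set 0]
}.

(** A joint generalized eigenvector, with a uniform exponent. *)
Definition lwt (x : lweight R rl) : set M := [set w | wt x.1 w /\
  exists p : nat, forall e i m,
    iter p (fun v => act (phi_ rl q e i m) v - x.2 e i m *: v) w = 0].

End OneRep.

Definition rep_morphism (M N : rep rl q) (p : {linear M -> N}) :=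
  (forall u w, p (act u w) = act u (p w)) /\ (forall v, exists w, p w = v).

Section Quotient.
Variables (M : rep rl q).

Record subm := Subm { subm_set :> set M; subm_prop : submodule subm_set }.

Variable W : subm.

Definition subm_pred : {pred M} := fun x => `[< subm_set W x >].

Fact subm_zmod_closed : GRing.zmod_closed subm_pred.
Proof.
have [sW _] := subm_prop W.
split; first by apply/asboolP; case: sW.
by move=> x y /asboolP Wx /asboolP Wy; apply/asboolP; apply: subspace_sub.
Qed.
HB.instance Definition _ := GRing.isZmodClosed.Build M subm_pred subm_zmod_closed.

Local Open Scope quotient_scope.
Definition quo := Quotient.quot subm_pred.
HB.instance Definition _ := GRing.Zmodule.on quo.
Definition quo_pi (x : M) : quo := \pi_(Quotient.quot subm_pred) x.

Lemma quo_pi_eq x y : quo_pi x = quo_pi y <-> subm_set W (x - y).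
Proof.
split=> [/eqP|Wxy]; first by rewrite /quo_pi -Quotient.idealrBE => /asboolP.
by apply/eqP; rewrite /quo_pi -Quotient.idealrBE; apply/asboolP.
Qed.

Lemma quo_reprK (u : quo) : quo_pi (repr u) = u.
Proof. exact: reprK. Qed.

Lemma quo_piD x y : quo_pi (x + y) = quo_pi x + quo_pi y.
Proof. by rewrite /quo_pi raddfD. Qed.

Definition quo_map (f : M -> M) (u : quo) : quo := quo_pi (f (repr u)).

Lemma quo_mapE (f : M -> M) x : linear f -> (forall w, subm_set W w -> subm_set W (f w)) ->
  quo_map f (quo_pi x) = quo_pi (f x).
Proof.
move=> lf Wf; apply/quo_pi_eq.
have -> : f (repr (quo_pi x)) - f x = f (repr (quo_pi x) - x).
  by rewrite -scaleN1r addrC -lf scaleN1r addrC.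
by apply/Wf/quo_pi_eq/quo_reprK.
Qed.

Lemma quo_mapZ a x : quo_map ( *:%R a) (quo_pi x) = quo_pi (a *: x).
Proof.
apply: quo_mapE => [b y z|w]; first by rewrite scalerDr !scalerA mulrC.
by apply: subspace_scale; case: (subm_prop W).
Qed.

Lemma quo_map_act u x : quo_map (fun w : M => act u w) (quo_pi x) = quo_pi (act u x).
Proof.
by apply: quo_mapE => [|w]; [exact: (act_linear u) | apply: (subm_prop W).2].
Qed.

Fact quo_scaleA a b (u : quo) :
  quo_map ( *:%R a) (quo_map ( *:%R b) u) = quo_map ( *:%R (a * b)) u.
Proof. by rewrite -(quo_reprK u) !quo_mapZ scalerA. Qed.
Fact quo_scale1 (u : quo) : quo_map ( *:%R 1) u = u.
Proof. by rewrite -[u in LHS]quo_reprK quo_mapZ scale1r quo_reprK. Qed.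
Fact quo_scaleDr : right_distributive (fun a => quo_map ( *:%R a)) +%R.
Proof.
move=> a u v; rewrite -(quo_reprK u) -(quo_reprK v).
by rewrite -quo_piD !quo_mapZ -quo_piD scalerDr.
Qed.
Fact quo_scaleDl u : {morph (fun a => quo_map ( *:%R a) u) : a b / a + b}.
Proof.
move=> a b; rewrite -(quo_reprK u).
by rewrite !quo_mapZ -quo_piD scalerDl.
Qed.
HB.instance Definition _ := GRing.Zmodule_isLmodule.Build C quo
  quo_scaleA quo_scale1 quo_scaleDr quo_scaleDl.

Lemma quo_piZ a x : quo_pi (a *: x) = a *: quo_pi x.
Proof. by rewrite -quo_mapZ. Qed.

Fact quo_act_linear u : linear (quo_map (fun w : M => act u w)).
Proof.
move=> a x y; rewrite -(quo_reprK x) -(quo_reprK y) -quo_piZ -quo_piD !quo_map_act.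
by rewrite linearP quo_piD quo_piZ.
Qed.

Definition quo_rep : rep rl q.
Proof.
refine (@Rep R n c rl q quo (fun u => quo_map (fun w : M => act u w))
  quo_act_linear _ _ _ _).
- by move=> u v w; rewrite -(quo_reprK w) !quo_map_act actD quo_piD.
- by move=> u v w; rewrite -(quo_reprK w) !quo_map_act actM.
- by move=> w; rewrite -(quo_reprK w) !quo_map_act act1.
- by move=> a u w; rewrite -(quo_reprK w) !quo_map_act actZ quo_piZ.
Defined.

Fact quo_pi_linear : linear quo_pi.
Proof. by move=> a x y; rewrite quo_piD quo_piZ. Qed.

HB.instance Definition _ := GRing.isLinear.Build C M quo *:%R quo_pi quo_pi_linear.

Lemma quotient_exists : exists (N : rep rl q) (p : {linear M -> N}),
  rep_morphism p /\ forall w, p w = 0 <-> subm_set W w.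
Proof.
exists quo_rep, (quo_pi : {linear M -> quo}); split.
  by split=> [u w|v]; [exact: esym (quo_map_act u w) | exists (repr v); exact: quo_reprK].
have q0 : quo_pi 0 = 0 by rewrite -(scale0r 0) quo_piZ scale0r.
by move=> w; rewrite -[X in _ = X]q0; apply: iff_trans (quo_pi_eq _ _) _; rewrite subr0.
Qed.

End Quotient.

End Weights.
Arguments hdeg {n} y.

(** * Evaluation of the Drinfeld-Cartan generators on eigenvectors *)

(** The coefficients of the exponential of a scalar power series without
    constant term. *)
Definition expc (K : fieldType) (a : nat -> K) (m : nat) : K :=
  \sum_(l < m.+1) l`!%:R^-1 * ((\sum_(1 <= k < m.+1) (a k)%:P * 'X^k) ^+ l)`_m.

Section FreeAlgebra.
Variables (R : realType) (n : nat) (c : cartan_datum n) (rl : realization c)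
          (q : qparam R[i]).
Local Notation C := R[i].
Local Notation H := (car rl).
Local Notation q1 := (qpow q 1).
Local Notation F := (free_alg R rl).

Lemma free_alg_ind (P : F -> Prop) :
  P 1 -> (forall x y, P x -> P y -> P (x + y)) ->
  (forall a x, P x -> P (a *: x)) -> (forall g x, P x -> P (fgen R g * x)) ->
  forall x, P x.
Proof.
move=> P1 PD PZ PM x.
have P0 : P 0 by rewrite -(scale0r 1); apply: PZ.
have Pm (s : seq (gen rl)) : P << FMonom s >>.
  elim: s => [|g s IH].
    by have -> : FMonom [::] = mone :> fmonom (gen rl) by apply: val_inj; rewrite /= fm1.
  have -> : FMonom (g :: s) = mmul (fmu g) (FMonom s).
    by apply: val_inj; rewrite /= fmM fmU.
  have := PM g _ IH; rewrite /fgen; congr P.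
  by rewrite [LHS]fgmulUU mulr1.
rewrite (monalgE (x : {malg C[{fmonom gen rl}]})).
apply: (big_ind P) => // k _.
have -> : << (x : {malg C[{fmonom gen rl}]})@_k *g k >> =
    (x : {malg C[{fmonom gen rl}]})@_k *: (<< k >> : F).
  by rewrite -[RHS]mul_malgC [RHS]fgmulUU mulr1 mul1m.
by apply: PZ; case: k.
Qed.

(** [P x a]: the element [x] of the free algebra evaluates to the scalar [a].
    The exponential series inherits evaluations from its argument. *)
Lemma exp_coef_ind (P : F -> C -> Prop) (a : nat -> F) (b : nat -> C) m :
  P 0 0 -> P 1 1 ->
  (forall x y s t, P x s -> P y t -> P (x + y) (s + t)) ->
  (forall x y s t, P x s -> P y t -> P (x * y) (s * t)) ->
  (forall d x s, P x s -> P (d *: x) (d * s)) ->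
  (forall k, (0 < k)%N -> P (a k) (b k)) -> P (exp_coef a m) (expc b m).
Proof.
move=> P0 P1 PD PM PZ Pab.
pose PP (p : {poly F}) (r : {poly C}) := forall k, P p`_k r`_k.
have PPM p p' r r' : PP p r -> PP p' r' -> PP (p * p') (r * r').
  move=> Pp Pp' k; rewrite !coefM.
  by apply: (big_rec2 P) => // j x y _ Pxy; apply: PD => //; apply: PM.
have PPX p r l : PP p r -> PP (p ^+ l) (r ^+ l).
  move=> Pp; elim: l => [|l IH]; last by rewrite !exprS; apply: PPM.
  by move=> k; rewrite !expr0 !coef1; case: (k == 0%N).
rewrite /exp_coef /expc; apply: (big_rec2 P) => // l x y _ Pxy.
apply: (PD) => //; apply: PZ; apply: PPX => {l x y Pxy} k.
rewrite !coef_sum big_nat_cond [X in P _ X]big_nat_cond.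
apply: (big_rec2 P) => // l x y /andP[/andP[l0 _] _] Pxy; apply: PD => //.
rewrite !coefCM !coefXn; apply: PM; first exact: Pab.
by case: (k == l).
Qed.

(** [pi f] acts as [a] on [w]. *)
Variable M : rep rl q.
Definition piact (f : F) (w : M) : M := act (presented_pi (@uq_rel R n c rl q) f) w.

Lemma piactD x y w : piact (x + y) w = piact x w + piact y w.
Proof. by rewrite /piact -actD; congr (act _ _); exact: raddfD. Qed.

Lemma piactZ a x w : piact (a *: x) w = a *: piact x w.
Proof. exact: etrans (congr1 (fun u => act u w) (Uq_piZ q a x)) (actZ _ _ _). Qed.

Lemma piactM x y w : piact (x * y) w = piact x (piact y w).
Proof. exact: etrans (congr1 (fun u => act u w) (Uq_piM q x y)) (actM _ _ _). Qed.

Lemma piact1 w : piact 1 w = w.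
Proof. by rewrite /piact -[RHS](act1 w); congr (act _ _); exact: rmorph1. Qed.

Lemma piact0 w : piact 0 w = 0.
Proof. by rewrite -(scale0r 1) piactZ scale0r. Qed.

Lemma piactZr a x w : piact x (a *: w) = a *: piact x w.
Proof. by rewrite /piact linearZ. Qed.

Lemma piact_k h w : piact (fk R h) w = Kop M h w.
Proof. by rewrite Kop.unlock. Qed.

Lemma piact_h y w : piact (fh R rl y.1 y.2) w = Hop M y w.
Proof. by rewrite Hop.unlock. Qed.

Lemma piact_x e i r w : piact (fx R rl e i r) w = Xop M e i r w.
Proof. by rewrite Xop.unlock. Qed.

Lemma piact_phi e i m w : piact (fphi rl q e i m) w = act (phi_ rl q e i m) w.
Proof. by []. Qed.

Lemma piact_psi i r w : Psiop M i r w =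
  (qi c q i - (qi c q i)^-1)^-1 *:
    (piact (fphiz rl q false i r) w - piact (fphiz rl q true i r) w).
Proof.
rewrite Psiop.unlock; apply: etrans (actZ _ _ _) _; congr (_ *: _).
exact: (act_subr (@actD _ _ _ _ _ M)).
Qed.

Lemma fphi_ind (P : F -> C -> Prop) (k : H -> C) (chi : 'I_n * {m : int | m != 0} -> C) :
  P 0 0 -> P 1 1 ->
  (forall x y s t, P x s -> P y t -> P (x + y) (s + t)) ->
  (forall x y s t, P x s -> P y t -> P (x * y) (s * t)) ->
  (forall d x s, P x s -> P (d *: x) (d * s)) ->
  (forall h, P (fk R h) (k h)) -> (forall y, P (fh R rl y.1 y.2) (chi y)) ->
  forall e i m, P (fphi rl q e i m)
    (k ((qsign e * (cr c i)%:R) *: coroot rl i) *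
     expc (fun j => qsign e * (q1 - q1^-1) *
        (if insub (qsign e * j%:Z) is Some m' then chi (i, m') else 0)) m).
Proof.
move=> P0 P1 PD PM PZ Pk Pchi e i m; apply: (PM) => //.
apply: exp_coef_ind => // j j0; apply: PZ.
by rewrite /fhz; case: insubP => // m' _ _; apply: (Pchi (i, m')).
Qed.

(** The action of the Drinfeld-Cartan generators on a vector of weight [l] on
    which the [h_{i,m}] act through [chi]. *)
Definition lchar (l : hstar H) (chi : 'I_n * {m : int | m != 0} -> C)
    (e : bool) (i : 'I_n) (m : nat) : C :=
  qpow q (l ((qsign e * (cr c i)%:R) *: coroot rl i)) *
  expc (fun j => qsign e * (q1 - q1^-1) *
     (if insub (qsign e * j%:Z) is Some m' then chi (i, m') else 0)) m.

Lemma phi_eigen l chi u : wt l u -> (forall y, Hop M y u = chi y *: u) ->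
  forall e i m, act (phi_ rl q e i m) u = lchar l chi e i m *: u.
Proof.
move=> Hl Hchi e i m; rewrite -piact_phi.
apply: (@fphi_ind (fun f a => piact f u = a *: u) (fun h => qpow q (l h)) chi).
- by rewrite piact0 scale0r.
- by rewrite piact1 scale1r.
- by move=> x y s t xs yt; rewrite piactD xs yt scalerDl.
- move=> x y s t xs yt; rewrite piactM yt.
  by rewrite piactZr xs scalerA mulrC.
- by move=> d x s xs; rewrite piactZ xs scalerA.
- by move=> h; rewrite piact_k; apply: Hl.
- by move=> y; rewrite piact_h; apply: Hchi.
Qed.

Lemma fphi_closed (P : F -> Prop) :
  P 0 -> P 1 -> (forall x y, P x -> P y -> P (x + y)) ->
  (forall x y, P x -> P y -> P (x * y)) -> (forall d x, P x -> P (d *: x)) ->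
  (forall h, P (fk R h)) -> (forall y, P (fh R rl y.1 y.2)) ->
  forall e i m, P (fphi rl q e i m).
Proof.
move=> P0 P1 PD PM PZ Pk Ph e i m.
apply: (@fphi_ind (fun f _ => P f) (fun=> 0) (fun=> 0)) => //.
- by move=> x y _ _; apply: PD.
- by move=> x y _ _; apply: PM.
- by move=> d x _; apply: PZ.
Qed.

Lemma Hop_phi y e i m w : Hop M y (act (phi_ rl q e i m) w) =
  act (phi_ rl q e i m) (Hop M y w).
Proof.
rewrite -!piact_phi; move: w.
apply: (@fphi_closed (fun f => forall w, Hop M y (piact f w) = piact f (Hop M y w))).
- by move=> w; rewrite !piact0 linear0.
- by move=> w; rewrite !piact1.
- by move=> x x' Hx Hx' w; rewrite !piactD linearD Hx Hx'.
- by move=> x x' Hx Hx' w; rewrite !piactM Hx Hx'.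
- by move=> d x Hx w; rewrite !piactZ linearZ /= Hx.
- by move=> h w; rewrite !piact_k Kop_H.
- by move=> z w; rewrite !piact_h HopC.
Qed.

Lemma phi_stable (W : set M) : subspace W -> (forall h w, W w -> W (Kop M h w)) ->
  (forall y w, W w -> W (Hop M y w)) ->
  forall e i m w, W w -> W (act (phi_ rl q e i m) w).
Proof.
move=> sW WK WH e i m; rewrite -/(piact _ _).
apply: (@fphi_closed (fun f => forall w, W w -> W (piact f w))).
- by move=> w _; rewrite piact0; case: sW.
- by move=> w; rewrite piact1.
- by move=> x x' Hx Hx' w Ww; rewrite piactD; apply: subspace_add; auto.
- by move=> x x' Hx Hx' w Ww; rewrite piactM; auto.
- by move=> d x Hx w Ww; rewrite piactZ; apply: subspace_scale; auto.
- by move=> h w; rewrite piact_k; apply: WK.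
- by move=> z w; rewrite piact_h; apply: WH.
Qed.

Lemma psi_stable (W : set M) : subspace W -> (forall h w, W w -> W (Kop M h w)) ->
  (forall y w, W w -> W (Hop M y w)) ->
  forall i r w, W w -> W (Psiop M i r w).
Proof.
move=> sW WK WH i r w Ww; rewrite piact_psi; apply: subspace_scale => //.
have st e r' : W (piact (fphiz rl q e i r') w).
  rewrite /fphiz; case: ifP => _; last by rewrite piact0; case: sW.
  exact: phi_stable.
exact: subspace_sub.
Qed.

(** A subspace stable under the generators is a submodule. *)
Lemma submodule_generators (W : set M) : subspace W ->
  (forall h w, W w -> W (Kop M h w)) -> (forall y w, W w -> W (Hop M y w)) ->
  (forall e i r w, W w -> W (Xop M e i r w)) -> submodule W.
Proof.
move=> sW WK WH WX; split=> // u w.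
rewrite -(presented_reprK u) -/(piact _ _); move: (generic_quotient.repr u) w.
apply: free_alg_ind.
- by move=> w; rewrite piact1.
- by move=> x x' Hx Hx' w Ww; rewrite piactD; apply: subspace_add; auto.
- by move=> d x Hx w Ww; rewrite piactZ; apply: subspace_scale; auto.
- move=> g x Hx w Ww; rewrite piactM; move/Hx: Ww {Hx}; move: (piact x w) => v Wv.
  case: g => [[[[e i] r]|h]|[i m]].
  + by have := WX e i r _ Wv; rewrite -piact_x.
  + by have := WK h _ Wv; rewrite -piact_k.
  + by have := WH (i, m) _ Wv; rewrite -piact_h.
Qed.

End FreeAlgebra.

(** * Highest weight vectors in subquotients *)

Section Category.
Variables (R : realType) (n : nat) (c : cartan_datum n) (rl : realization c)
          (q : qparam R[i]).
Local Notation C := R[i].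
Local Notation H := (car rl).
Local Notation U := (Uq rl q).
Local Notation hst := (hstar H).
Implicit Types (M N : rep rl q).

Lemma weight_projection M (W : set M) (s : seq hst) (f : hst -> M) l v :
  submodule W -> uniq s -> (forall l, wt l (f l)) -> wt l v ->
  W (\sum_(l <- s) f l - v) -> W ((if l \in s then f l else 0) - v).
Proof.
move=> sW us Hf Hv; case: ifP => [ls|/negbT nls] Wsum.
  have -> : f l - v = f l - (if l == l then v else 0) by rewrite eqxx.
  pose g l' := f l' - (if l' == l then v else 0).
  apply: (@weight_components _ _ _ _ _ M W s g) (ls) => // [l' _|].
    rewrite /g; apply: (subspace_sub (subspace_wt M l')) => //.
    by case: eqP => [->//|_]; case: (subspace_wt M l').
  rewrite sumrB; suff -> : \sum_(l' <- s) (if l' == l then v else 0) = v by [].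
  by rewrite (bigD1_seq l) //= eqxx big1 ?addr0 // => l' /negPf->.
pose g l' := if l' == l then - v else f l'.
have -> : 0 - v = g l by rewrite /g eqxx sub0r.
apply: (@weight_components _ _ _ _ _ M W (l :: s) g) => //.
- by rewrite /= nls.
- move=> l' _; rewrite /g; case: eqP => // ->.
  exact: (subspace_opp (subspace_wt M l)).
- rewrite big_cons {1}/g eqxx addrC.
  rewrite (eq_big_seq f) // => l' l's; rewrite /g.
  by case: eqP => // e; rewrite e (negPf nls) in l's.
- exact: mem_head.
Qed.

Section Morphism.
Variables (M N : rep rl q) (p : {linear M -> N}).
Hypothesis pM : rep_morphism p.

Lemma morphism_K h w : p (Kop M h w) = Kop N h (p w).
Proof. by rewrite Kop.unlock; case: pM => ->. Qed.

Lemma morphism_H y w : p (Hop M y w) = Hop N y (p w).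
Proof. by rewrite Hop.unlock; case: pM => ->. Qed.

Lemma morphism_X e i r w : p (Xop M e i r w) = Xop N e i r (p w).
Proof. by rewrite Xop.unlock; case: pM => ->. Qed.

Lemma morphism_wt l w : wt l w -> wt l (p w).
Proof. by move=> Hw h; rewrite -morphism_K Hw linearZ. Qed.

Lemma morphism_weight_sum w : weight_sum w -> weight_sum (p w).
Proof.
move=> [s [f [Hf ->]]]; exists s, (p \o f).
by split=> [l|]; [apply/morphism_wt/Hf | rewrite linear_sum].
Qed.

Lemma lift_wt l v : (forall w : M, weight_sum w) -> wt l v ->
  exists2 w, wt l w & p w = v.
Proof.
move=> ws Hv; have [w pw] := pM.2 v.
have [s [f [us Hf we]]] := weight_sum_uniq (ws w).
have Hpf l' : wt l' ((p \o f) l') by apply/morphism_wt/Hf.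
have e0 : [set 0] (\sum_(l <- s) (p \o f) l - v).
  by rewrite -pw we linear_sum subrr.
have := weight_projection (submodule0 N) us Hpf Hv e0.
move/eqP; rewrite subr_eq0 => /eqP; case: ifP => _ <-; first by exists (f l).
by exists 0; [case: (subspace_wt M l) | rewrite linear0].
Qed.

Lemma tame_quotient : tame M -> tame N.
Proof.
move=> [ws fd [s cone] int]; split.
- by move=> v; have [w <-] := pM.2 v; apply/morphism_weight_sum/ws.
- move=> l; have [d [b Hb]] := fd l; exists d, (p \o b) => v Hv.
  have [w /Hb[a ->] <-] := lift_wt ws Hv; exists a.
  by rewrite linear_sum; apply: eq_bigr => i _; rewrite linearZ.
- exists s => l [v Hv v0]; apply: cone.
  have [w Hw pw] := lift_wt ws Hv; exists w => // w0.
  by apply: v0; rewrite -pw w0 linear0.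
- move=> l i; have [B HB] := int l i; exists B => r /HB[h1 h2].
  by split=> v /(lift_wt ws)[w Hw <-]; [move/h1: Hw | move/h2: Hw] => /= ->;
    rewrite linear0.
Qed.

Lemma morphism_lwt x w : lwt x w -> lwt x (p w).
Proof.
move=> [Hw [k Hk]]; split; first exact: morphism_wt.
exists k => e i m; rewrite -[RHS](linear0 p) -(Hk e i m).
elim: k {Hk} => //= k ->.
by rewrite (linearB p) -pM.1 [in RHS]linearZ.
Qed.

End Morphism.

(** The weights of the simple roots differ by one under some linear function;
    it measures the height of a weight below the finitely many tops. *)
Lemma height_exists : exists ht : hst -> rat,
  (forall l m, ht (l + m) = ht l + ht m) /\ forall i, ht (Defs.root rl i) = 1.
Proof.
pose X := codom_tuple (Defs.root rl).
have fX : free X by exact: root_free.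
exists (fun v => \sum_k coord X k v); split.
  by move=> l m; rewrite -big_split; apply: eq_bigr => k _; rewrite linearD.
move=> i.
have -> : Defs.root rl i = X`_(enum_rank i) by rewrite nth_codom enum_rankK.
rewrite (bigD1 (enum_rank i)) //= coord_free // eqxx big1 ?addr0 // => k ki.
rewrite coord_free //; case: eqP => // e; case/negP: ki.
by rewrite e.
Qed.

(** A nonzero submodule has a weight none of whose translates by a simple root
    is a weight. *)
Lemma top_weight M (W : set M) : tame M -> submodule W -> (exists2 w, W w & w <> 0) ->
  exists l, (exists2 w, W w /\ wt l w & w <> 0) /\
    forall i w, W w -> wt (l + Defs.root rl i) w -> w = 0.
Proof.
move=> [ws fd [s cone] int] sW [w0 Ww0 nw0].
have [ht [htD ht1]] := height_exists.
pose good l := exists2 w, W w /\ wt l w & w <> 0.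
have [l0 gl0] : exists l, good l.
  have [t [f [ut Hf w0e]]] := weight_sum_uniq (ws w0).
  have Wf := @weight_components _ _ _ _ _ M W t f sW ut (fun l _ => Hf l).
  apply: contrapT => ng; apply: nw0; rewrite w0e big_seq big1 // => l lt.
  apply: contrapT => nfl; apply: ng; exists l, (f l) => //; split => //.
  by apply: Wf lt; rewrite -w0e.
have htS l : good l -> exists2 l1, l1 \in s & 0 <= ht l1 - ht l.
  move=> [w [Ww Hw] nw]; have [|l1 l1s [m lm]] := cone l; first by exists w.
  exists l1 => //.
  have ht0 : ht 0 = 0 by apply: (@addrI _ (ht 0)); rewrite -htD !addr0.
  have htsum : ht (l1 - l) = ht l1 - ht l.
    by apply: (addIr (ht l)); rewrite -htD !subrK.
  rewrite -htsum lm (big_morph ht htD ht0); apply: sumr_ge0 => i _.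
  have -> : ht (Defs.root rl i *+ m i) = (m i)%:R.
    by elim: (m i) => // k IH; rewrite mulrS htD IH ht1 -natr1 addrC.
  exact: ler0n.
have [B HB] : exists B : nat, forall l1, l1 \in s -> ht l1 - ht l0 < B%:R.
  exists (\sum_(l1 <- s) Num.bound (ht l1 - ht l0))%N => l1 l1s.
  apply: le_lt_trans (ler_norm _) _; apply: lt_le_trans (archi_boundP (normr_ge0 _)) _.
  rewrite ler_nat (big_rem l1) //=.
  suff -> : Num.bound `|ht l1 - ht l0| = Num.bound (ht l1 - ht l0) by exact: leq_addr.
  by rewrite /Num.bound normr_id.
suff main b l : good l -> (forall l1, l1 \in s -> ht l1 - ht l < b%:R) ->
    exists l', good l' /\ forall i, ~ good (l' + Defs.root rl i).
  have [l' [gl' ngl']] := main B l0 gl0 HB.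
  exists l'; split => // i w Ww Hw; apply: contrapT => nw.
  by apply: (ngl' i); exists w.
elim: b l => [|b IH] l gl Hl.
  have [l1 l1s] := htS _ gl; rewrite leNgt => /negP[]; exact: Hl.
have [[i gi]|ng] := pselect (exists i, good (l + Defs.root rl i)).
  apply: (IH _ gi) => l1 /Hl ltb.
  by rewrite htD ht1 opprD addrA ltrBlDr natr1.
by exists l; split => // i gi; apply: ng; exists i.
Qed.

Lemma highest_weight_vector M (W : set M) : tame M -> submodule W ->
  (exists2 w, W w & w <> 0) ->
  exists l u chi, [/\ W u, u <> 0, wt l u, forall i r, Xop M false i r u = 0
    & forall y, Hop M y u = chi y *: u].
Proof.
move=> tM sW Wn0; have [l [[w [Ww Hw] nw] top]] := top_weight tM sW Wn0.
have sE : subspace (W `&` wt l).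
  by apply: subspaceI; [case: sW | exact: subspace_wt].
have fE : fin_dim (W `&` wt l).
  by apply: fin_dimS (tame_fin tM l) => v [].
have stE : stable (Hop M) (W `&` wt l).
  move=> y v [Wv Hv]; split; last exact: wt_H.
  by rewrite Hop.unlock; case: sW => _; apply.
have [|u [chi [[Wu Hu] u0 Hchi]]] := joint_eigenvector (@HopC _ _ _ _ _ M) sE fE stE.
  by exists w.
exists l, u, chi; split => // i r.
apply: (top i); last exact: wt_Xp.
by rewrite Xop.unlock; case: sW => _; apply.
Qed.

End Category.

(** * The l-weights of a module generated by a highest weight space *)

Section Cyclic.
Variables (R : realType) (n : nat) (c : cartan_datum n) (rl : realization c)
          (q : qparam R[i]).
Local Notation C := R[i].
Local Notation H := (car rl).
Local Notation q1 := (qpow q 1).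
Local Notation hst := (hstar H).
Local Notation Y := ('I_n * {m : int | m != 0})%type.
Variable M : rep rl q.

Lemma qpow1_int (l : int) : q1 ^ l = qpow q l%:~R.
Proof.
case: l => k; first by rewrite -exprnP -pmulrn -qpow_nat.
by rewrite NegzE -exprnN mulrNz qpowN -pmulrn -qpow_nat.
Qed.

Lemma qpow1_int_inj (k l : int) : q1 ^ k = q1 ^ l -> k = l.
Proof. by rewrite !qpow1_int => /qpow_inj/intr_inj. Qed.

Lemma qint_neq0 (l : int) : l != 0 -> qint q1 l != 0.
Proof.
have ne (k : int) : k != 0 -> q1 ^ k - q1 ^ (- k) != 0.
  rewrite subr_eq0; apply: contra_neq => /qpow1_int_inj/eqP.
  by rewrite -subr_eq0 opprK -mulr2n mulrn_eq0 => /eqP.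
by move=> /ne l0; rewrite mulf_neq0 // invr_neq0 // (ne 1).
Qed.

Definition y_plus (i : 'I_n) : Y := (i, exist _ (1 : int) isT).
Definition y_minus (i : 'I_n) : Y := (i, exist _ (-1 : int) isT).

Lemma h_coef_neq0 e i (m : {m : int | m != 0}) : h_coef c q e i (i, m) != 0.
Proof.
apply: mulf_neq0; first by rewrite mulf_neq0 ?signr_eq0 ?invr_neq0 ?intr_eq0 ?(svalP m).
apply: qint_neq0; rewrite /= mulf_neq0 ?(svalP m) //.
by rewrite /bmat cmat_diag mulf_neq0 // -lt0n cr_gt0.
Qed.

(** The characters reached from [chi] by lowering operators: one factor
    A_{i,1/z}^{-1} for each pair [(i, z)] in [v]. *)
Definition shiftv (chi : Y -> C) (v : seq ('I_n * C)) : Y -> C :=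
  foldr (fun x chi => shift_char hdeg (h_coef c q true x.1) chi x.2) chi v.

Definition lowered (l : hst) (v : seq ('I_n * C)) : hst :=
  l - \sum_(x <- v) Defs.root rl x.1.

Definition nonzero_points (v : seq ('I_n * C)) := all (fun x => x.2 != 0) v.

Section Generated.
Variables (l0 : hst) (s0 : seq (Y -> C)) (E0 : set M).
Hypothesis finM : forall l, fin_dim (wt (M := M) l).
Hypothesis sE0 : subspace E0.
Hypothesis E0wt : E0 `<=` wt l0.
Hypothesis E0gker : E0 `<=` gker (Hop M) s0.
Hypothesis E0H : stable (Hop M) E0.
Hypothesis E0X : forall i r v, E0 v -> Xop M false i r v = 0.

Lemma Xm_annihilator l i : exists2 p, ~~ root p 0 &
  forall r v, wt l v -> current (Xop M true i) p r v = 0.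
Proof.
apply: (@current_annihilator _ _ _ (Hop M) (Xop M true i) hdeg (h_coef c q true i)
  (fun y r v => Hop_X true i y r v) (wt (M := M) l) (wt (M := M) (l - Defs.root rl i))
  (y_plus i) (y_minus i)) => //; try exact: h_coef_neq0.
- exact: subspace_wt.
- exact: wt_H.
- by move=> r' v; apply: wt_Xm.
Qed.

Definition reached l chi := exists v chi0,
  [/\ nonzero_points v, chi0 \in s0, l = lowered l0 v & chi = shiftv chi0 v].

Definition reached_at l (w : M) := wt l w /\
  exists2 s, gker (Hop M) s w & forall chi, chi \in s -> reached l chi.

Lemma reached_at_sum (I : Type) (r : seq I) (P : pred I) (F : I -> M) l :
  (forall i, P i -> reached_at l (F i)) -> reached_at l (\sum_(i <- r | P i) F i).
Proof.
move=> HF; apply: big_ind => //.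
  by split; [case: (subspace_wt M l) | exists [::]].
move=> x y [Hx [s sx Hs]] [Hy [t ty Ht]]; split.
  exact: (subspace_add (subspace_wt M l)).
exists (s ++ t); last by move=> chi; rewrite mem_cat => /orP[/Hs|/Ht].
apply: (subspace_add (subspace_gker _ _)).
  exact: gker_catl.
by apply: gker_catr => //; exact: HopC.
Qed.

Lemma reached_at_scale l a w : reached_at l w -> reached_at l (a *: w).
Proof.
move=> [Hw [s sw Hs]]; split; first exact: (subspace_scale _ (subspace_wt M l)).
by exists s => //; apply: (subspace_scale _ (subspace_gker _ _)).
Qed.

Lemma reached_at_X i r l w : reached_at l w ->
  reached_at (l - Defs.root rl i) (Xop M true i r w).
Proof.
move=> [Hw [s sw Hs]]; split; first exact: wt_Xm.
have [p p0 ann] := Xm_annihilator l i.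
have [rs prs] := closed_field_poly_normal p.
have pn0 : p != 0 by apply: contraNneq p0 => ->; rewrite root0.
have rs0 : all (predC1 0) rs.
  apply/allP => z zrs /=; apply: contraNneq p0 => z0.
  rewrite prs rootZ ?lead_coef_eq0 // root_prod_XsubC -z0.
  exact: zrs.
exists [seq shift_char hdeg (h_coef c q true i) chi z | chi <- s, z <- rs].
  have -> : Xop M true i r w = current (Xop M true i) 1 r w by rewrite /current conv1.
  apply: (@gker_current _ _ _ (Hop M) (@HopC _ _ _ _ _ M) (Xop M true i) hdeg
    (h_coef c q true i) (fun y r v => Hop_X true i y r v) (wt l)) => //; [exact: subspace_wt | exact: wt_H |].
  move=> r' v Hv; rewrite mul1r.
  apply: (scalerI (a := lead_coef p)); first by rewrite lead_coef_eq0.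
  by rewrite -currentZp -prs ann // scaler0.
move=> chi /allpairsP[[chi1 z] /= [/Hs[v [chi0 [v0 chi0s -> ->]]] zrs ->]].
exists ((i, z) :: v), chi0; split => //=; first by rewrite v0 andbT; apply: (allP rs0).
by rewrite /lowered big_cons opprD addrAC addrA.
Qed.

(** Linear combinations of lowering operators applied to [E0]. *)
Inductive lower_span : set M :=
| lower_base v : E0 v -> lower_span v
| lower_X i r v : lower_span v -> lower_span (Xop M true i r v)
| lower_lin a v w : lower_span v -> lower_span w -> lower_span (a *: v + w).

Lemma subspace_lower_span : subspace lower_span.
Proof. by split; [apply: lower_base; case: sE0 | exact: lower_lin]. Qed.

Lemma lower_span_K h w : lower_span w -> lower_span (Kop M h w).
Proof.
elim=> [v Ev|i r v _ IH|a v v' _ IH _ IH'].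
- apply: lower_base; rewrite (E0wt Ev).
  exact: subspace_scale.
- by rewrite Kop_X; apply: (subspace_scale _ subspace_lower_span); apply: lower_X.
- by rewrite linearP; apply: lower_lin.
Qed.

Lemma lower_span_H y w : lower_span w -> lower_span (Hop M y w).
Proof.
elim=> [v Ev|i r v sv IH|a v v' _ IH _ IH'].
- by apply: lower_base; apply: E0H.
- rewrite Hop_X; apply: (subspace_add subspace_lower_span); first exact: lower_X.
  by apply: (subspace_scale _ subspace_lower_span); apply: lower_X.
- by rewrite linearP; apply: lower_lin.
Qed.

Lemma submodule_lower_span : submodule lower_span.
Proof.
apply: submodule_generators; [exact: subspace_lower_span | exact: lower_span_K |
  exact: lower_span_H |].
case=> i r w sw; first exact: lower_X.
elim: sw => [v Ev|j s v sv IH|a v v' _ IH _ IH'].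
- by rewrite E0X //; case: subspace_lower_span.
- rewrite Xop_X; apply: (subspace_add subspace_lower_span); first exact: lower_X.
  apply: (subspace_scale _ subspace_lower_span).
  apply: psi_stable => //; [exact: subspace_lower_span | exact: lower_span_K |].
  exact: lower_span_H.
- by rewrite linearP; apply: lower_lin.
Qed.

Lemma lower_span_reached w : lower_span w ->
  exists2 t : seq (hst * M), (forall x, x \in t -> reached_at x.1 x.2) &
    w = \sum_(x <- t) x.2.
Proof.
elim=> [v Ev|i r v _ [t Ht ->]|a v v' _ [t Ht ->] _ [t' Ht' ->]].
- exists [:: (l0, v)]; last by rewrite big_seq1.
  move=> x; rewrite inE => /eqP-> /=; split; first exact: E0wt.
  exists s0; first exact: E0gker.
  move=> chi chis; exists [::], chi; split => //.
  by rewrite /lowered big_nil subr0.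
- exists [seq (x.1 - Defs.root rl i, Xop M true i r x.2) | x <- t].
    by move=> _ /mapP[x /Ht Hx ->]; apply: reached_at_X.
  by rewrite big_map linear_sum.
- exists ([seq (x.1, a *: x.2) | x <- t] ++ t').
    move=> x; rewrite mem_cat => /orP[/mapP[y /Ht Hy ->]|/Ht'//].
    exact: reached_at_scale.
  by rewrite big_cat big_map scaler_sumr.
Qed.

Lemma lower_span_weight l w : lower_span w -> wt l w -> reached_at l w.
Proof.
move=> /lower_span_reached[t Ht we] Hw.
pose f l' := \sum_(x <- t | (x.1 == l') && (x \in t)) x.2.
have fr l' : reached_at l' (f l').
  by apply: reached_at_sum => x /andP[/eqP<- /Ht].
pose s := undup [seq x.1 | x <- t].
have e : w = \sum_(l <- s) f l.
  rewrite we (exchange_big_dep (fun x => x \in t)) /=; last by move=> ? ? _ /andP[].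
  rewrite big_seq; apply: eq_bigr => x xt; rewrite xt.
  rewrite big_mkcond (bigD1_seq x.1) ?undup_uniq ?mem_undup ?map_f //= eqxx.
  by rewrite big1 ?addr0 // => l'; rewrite eq_sym => /negPf->.
have e0 : [set 0] (\sum_(l <- s) f l - w) by rewrite -e subrr.
have := weight_projection (submodule0 M) (undup_uniq _) (fun l' => (fr l').1) Hw e0.
move/eqP; rewrite subr_eq0 => /eqP <-; case: ifP => _; first exact: fr.
by split; [case: (subspace_wt M l) | exists [::]].
Qed.

(** The l-weights of the submodule generated by [E0]: those of [E0] lowered. *)
Lemma generated_lweight (x : lweight R rl) w : lower_span w -> lwt x w -> w <> 0 ->
  exists2 chi, reached x.1 chi & x.2 = lchar q x.1 chi.
Proof.
move=> sw [Hw [p Hp]] nw; have [_ [s gw Hs]] := lower_span_weight sw Hw.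
pose E := [set v | [/\ wt x.1 v, gker (Hop M) s v & forall e i m,
  iter p (fun v => act (phi_ rl q e i m) v - x.2 e i m *: v) v = 0]].
pose D e i m (v : M) := act (phi_ rl q e i m) v - x.2 e i m *: v.
have Dlin e i m a v v' : D e i m (a *: v + v') = a *: D e i m v + D e i m v'.
  rewrite /D linearP scalerDr scalerBr !scalerA (mulrC (x.2 e i m)) opprD.
  by rewrite addrACA.
have iterlin e i m k a v v' :
    iter k (D e i m) (a *: v + v') = a *: iter k (D e i m) v + iter k (D e i m) v'.
  by elim: k => //= k ->; rewrite Dlin.
have iter0 e i m k : iter k (D e i m) 0 = 0.
  by elim: k => //= k ->; rewrite /D linear0 scaler0 subr0.
have sE : subspace E.
  split; first by split => [||e i m]; [case: (subspace_wt M x.1) |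
    case: (subspace_gker (Hop M) s) | exact: iter0].
  move=> a v v' [Hv gv Ev] [Hv' gv' Ev']; split.
  - by case: (subspace_wt M x.1) => _; apply.
  - by case: (subspace_gker (Hop M) s) => _; apply.
  - by move=> e i m; rewrite -/(D e i m) iterlin Ev Ev' scaler0 addr0.
have fE : fin_dim E by apply: fin_dimS (finM x.1) => v [].
have stE : stable (Hop M) E.
  move=> y v [Hv gv Ev]; split; first exact: wt_H.
    by apply: stable_gker => //; exact: HopC.
  move=> e i m; rewrite -/(D e i m).
  have DH k : iter k (D e i m) (Hop M y v) = Hop M y (iter k (D e i m) v).
    elim: k => //= k ->; rewrite /D -Hop_phi.
    by rewrite [in RHS]linearB; congr (_ - _); rewrite linearZ.
  by rewrite DH Ev linear0.
have [|u [chi [[Hu gu Eu] u0 Hchi]]] :=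
  joint_eigenvector (@HopC _ _ _ _ _ M) sE fE stE; first by exists w.
exists chi; first exact/Hs/(gker_eigen u0 Hchi gu).
apply/funext => e; apply/funext => i; apply/funext => m.
have := Eu e i m; rewrite -/(D e i m).
have -> : iter p (D e i m) u = (lchar q x.1 chi e i m - x.2 e i m) ^+ p *: u.
  elim: p {Hp E sE fE stE Eu} => [|k]; first by rewrite scale1r.
  rewrite iterS => ->; rewrite -[_ *: u]addr0 Dlin /D linear0 scaler0 subr0 addr0.
  by rewrite (phi_eigen Hu Hchi) -scalerBl scalerA -exprSr.
move/eqP; rewrite scaler_eq0 => /orP[|/eqP//].
by rewrite expf_eq0 subr_eq0 => /andP[_ /eqP].
Qed.

End Generated.
End Cyclic.

(** * Exponentials of scalar power series *)

Section Exponential.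
Variable K : numFieldType.
Implicit Types (a b f : nat -> K) (p r : {poly K}).

(** Equality modulo the [N]-th power of the variable. *)
Definition eqtrunc N p r := forall k, (k < N)%N -> p`_k = r`_k.

Lemma eqtruncM N p p' r r' : eqtrunc N p r -> eqtrunc N p' r' ->
  eqtrunc N (p * p') (r * r').
Proof.
move=> e e' k kN; rewrite !coefM; apply: eq_bigr => j _.
by rewrite e ?e' //; [apply: leq_ltn_trans (leq_subr _ _) kN |
  apply: leq_ltn_trans kN; rewrite -ltnS].
Qed.

Lemma eqtruncX N p r l : eqtrunc N p r -> eqtrunc N (p ^+ l) (r ^+ l).
Proof.
move=> e; elim: l => [|l IH]; first by move=> k _; rewrite !expr0.
by rewrite !exprS; apply: eqtruncM.
Qed.

Definition argser a N : {poly K} := \sum_(1 <= k < N.+1) (a k)%:P * 'X^k.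

Lemma argserE a N : argser a N = 'X * \poly_(k < N) a k.+1.
Proof.
rewrite /argser big_add1 big_mkord poly_def mulr_sumr; apply: eq_bigr => k _.
by rewrite exprS mul_polyC scalerAr.
Qed.

Lemma coef_argser a N k : (argser a N)`_k = if (0 < k <= N)%N then a k else 0.
Proof. by rewrite argserE coefXM coef_poly; case: k. Qed.

Lemma argser_exp0 a N l m : (m < l)%N -> (argser a N ^+ l)`_m = 0.
Proof. by move=> ml; rewrite argserE exprMn coefXnM ml. Qed.

Lemma expcE a m N : (m <= N)%N ->
  expc a m = (\sum_(l < N.+1) l`!%:R^-1 *: argser a N ^+ l)`_m.
Proof.
move=> mN; rewrite coef_sum /expc (big_ord_widen N.+1 (fun l => l`!%:R^-1 *
   ((\sum_(1 <= k < m.+1) (a k)%:P * 'X^k) ^+ l)`_m)) // big_mkcond.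
apply: eq_bigr => l _; rewrite coefZ ltnS; case: leqP => lm.
  congr (_ * _); apply: (@eqtruncX m.+1) => // k km; rewrite !coef_argser.
  have km' : (k <= m)%N := km; by rewrite km' (leq_trans km' mN).
by rewrite argser_exp0 ?mulr0.
Qed.

Lemma expc0 a : expc a 0 = 1.
Proof. by rewrite /expc big_ord1 expr0 coef1 fact0 invr1 mulr1. Qed.

(** Coefficients of [E' = A' E]. *)
Lemma expc_rec a m : m.+1%:R * expc a m.+1 =
  \sum_(k < m.+1) k.+1%:R * a k.+1 * expc a (m - k).
Proof.
pose A := argser a m.+1.
pose E := \sum_(l < m.+2) l`!%:R^-1 *: A ^+ l.
have EE k : (k <= m.+1)%N -> expc a k = E`_k by move=> km; rewrite (expcE _ km).
have dE : E^`() = A^`() * (E - (m.+1)`!%:R^-1 *: A ^+ m.+1).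
  rewrite /E raddf_sum big_ord_recl /= expr0 linearZ /= derivC scaler0 add0r.
  rewrite [in RHS]big_ord_recr /= addrK mulr_sumr; apply: eq_bigr => l _.
  rewrite /= /bump /= add1n linearZ /= deriv_exp /= -scalerAr -scaler_nat scalerA.
  by congr (_ *: _); rewrite factS natrM invfM mulrAC mulVf ?mul1r ?pnatr_eq0.
have -> : m.+1%:R * expc a m.+1 = E^`()`_m by rewrite coef_deriv -EE // mulr_natl.
have A0 : (A^`() * A ^+ m.+1)`_m = 0.
  by rewrite coefMr big1 // => k _; rewrite argser_exp0 ?mulr0.
rewrite dE mulrBr coefB -scalerAr coefZ A0 mulr0 subr0 coefM.
apply: eq_bigr => k _; rewrite EE; last by rewrite (leq_trans (leq_subr _ _)).
by rewrite coef_deriv coef_argser ltn_ord mulr_natl.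
Qed.

Lemma expc_unique a f : f 0%N = 1 ->
  (forall m, m.+1%:R * f m.+1 = \sum_(k < m.+1) k.+1%:R * a k.+1 * f (m - k)%N) ->
  f =1 expc a.
Proof.
move=> f0 frec m; elim/ltn_ind: m => -[|m] IH; first by rewrite f0 expc0.
apply: (@mulfI _ m.+1%:R); first by rewrite pnatr_eq0.
rewrite frec expc_rec; apply: eq_bigr => k _; rewrite IH //.
by rewrite ltnS leq_subr.
Qed.

Lemma eq_expc a b : (forall k, (0 < k)%N -> a k = b k) -> expc a =1 expc b.
Proof.
move=> ab; apply: expc_unique => [|m]; first by rewrite expc0.
by rewrite expc_rec; apply: eq_bigr => k _; rewrite ab.
Qed.

Lemma expc_add a b m :
  \sum_(j < m.+1) expc a j * expc b (m - j) = expc (fun k => a k + b k) m.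
Proof.
pose P d k := (\poly_(j < d) expc k j : {poly K}).
apply: (@expc_unique _ (fun m => \sum_(j < m.+1) expc a j * expc b (m - j))).
  by rewrite big_ord1 !expc0 mulr1.
move=> {}m.
pose EA : {poly K} := \poly_(j < m.+2) expc a j.
pose EB : {poly K} := \poly_(j < m.+2) expc b j.
have prodE k : (k <= m.+1)%N -> \sum_(j < k.+1) expc a j * expc b (k - j) = (EA * EB)`_k.
  move=> km; rewrite coefM; apply: eq_bigr => j _; rewrite !coef_poly.
  have jk : (j <= k)%N by rewrite -ltnS.
  by rewrite !ltnS (leq_trans jk km) (leq_trans (leq_subr j k) km).
have dser d : eqtrunc m.+1 (\poly_(j < m.+2) expc d j)^`()
    ((argser d m.+1)^`() * \poly_(j < m.+2) expc d j).
  move=> k km; rewrite coef_deriv coef_poly ltnS km -mulr_natl expc_rec coefM.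
  apply: eq_bigr => j _; rewrite coef_deriv coef_argser coef_poly.
  have jk : (j <= k)%N by rewrite -ltnS.
  rewrite /= (leq_ltn_trans jk km) ltnS (leq_trans (leq_subr j k)) ?mulr_natl //.
  exact: ltnW.
rewrite prodE // mulr_natl -coef_deriv derivM coefD.
rewrite (eqtruncM (dser a) (fun k _ => erefl _)) //.
rewrite (eqtruncM (p := EA) (fun k _ => erefl _) (dser b)) //.
rewrite mulrCA -coefD -mulrA -mulrDl coefM; apply: eq_bigr => k _.
rewrite coefD !coef_deriv !coef_argser ltn_ord prodE; last first.
  by rewrite (leq_trans (leq_subr _ _)).
by rewrite -mulrnDl mulr_natl.
Qed.

(** The exponential of a geometric logarithm. *)
Lemma expc_geom (s : K) m : expc (fun k => s ^+ k / k%:R) m = s ^+ m.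
Proof.
symmetry; apply: expc_unique => {m} [//|m].
rewrite (eq_bigr (fun=> s ^+ m.+1)); first by rewrite sumr_const card_ord mulr_natl.
move=> k _; rewrite mulrCA divff ?pnatr_eq0 // mulr1 -exprD addSn subnKC //.
by rewrite -ltnS.
Qed.

(** Adding the logarithm of [(1 - t z) / (1 - s z)] to the argument multiplies
    the exponential by this rational function. *)
Lemma expc_shift a b (s t : K) :
  (forall k, (0 < k)%N -> b k = a k + (s ^+ k - t ^+ k) / k%:R) ->
  forall m, expc b m.+1 - s * expc b m = expc a m.+1 - t * expc a m.
Proof.
move=> ab.
pose G m := \sum_(j < m.+1) expc a j * s ^+ (m - j).
have G1 m : G m.+1 = expc a m.+1 + s * G m.
  rewrite /G big_ord_recr /= subnn expr0 mulr1 addrC mulr_sumr; congr (_ + _).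
  apply: eq_bigr => j _; rewrite subSn ?exprS 1?mulrCA //.
  by rewrite -ltnS.
have G2 m : G m.+1 = expc b m.+1 + t * G m.
  have GE k : G k = \sum_(j < k.+1) expc b j * t ^+ (k - j).
    rewrite /G; under eq_bigr => j _ do rewrite -expc_geom.
    under [RHS]eq_bigr => j _ do rewrite -expc_geom.
    rewrite !expc_add; apply: eq_expc => j j0; rewrite ab //.
    by rewrite mulrBl addrA subrK.
  rewrite !GE big_ord_recr /= subnn expr0 mulr1 addrC mulr_sumr; congr (_ + _).
  apply: eq_bigr => j _; rewrite subSn ?exprS 1?mulrCA //.
  by rewrite -ltnS.
have G0 : G 0%N = 1 by rewrite /G big_ord1 expc0 mulr1.
have bE m : expc b m.+1 = expc a m.+1 + (s - t) * G m.
  by apply: (addIr (t * G m)); rewrite -G2 G1; ring.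
case=> [|m]; rewrite !bE ?G0 ?expc0; first by ring.
by rewrite G1; ring.
Qed.

End Exponential.

Section CharacterShift.
Variables (R : realType) (n : nat) (c : cartan_datum n) (rl : realization c)
          (q : qparam R[i]).
Local Notation C := R[i].
Local Notation H := (car rl).
Local Notation q1 := (qpow q 1).
Local Notation hst := (hstar H).
Local Notation Y := ('I_n * {m : int | m != 0})%type.

(** The scalars by which phi^{e}_{i, r} acts, as a two-sided sequence in [r]. *)
Definition phz (l : hst) (chi : Y -> C) (e : bool) (i : 'I_n) (r : int) : C^o :=
  if 0 <= qsign e * r then lchar q l chi e i `|r|%N else 0.

Definition exp_arg (chi : Y -> C) (e : bool) (i : 'I_n) (k : nat) : C :=
  qsign e * (q1 - q1^-1) *
    (if insub (qsign e * k%:Z) is Some m' then chi (i, m') else 0).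

Lemma q1_neq0 : q1 != 0. Proof. exact: qpow_neq0. Qed.

Lemma q1B_neq0 : q1 - q1^-1 != 0.
Proof.
rewrite subr_eq0; apply/eqP => e.
have /qpow1_int_inj : q1 ^ 1%Z = q1 ^ (-1)%Z by rewrite exprN1 -exprnP expr1.
by [].
Qed.

Lemma exp_arg_shift chi e i j z k (Q := q1 ^ bmat c i j) : z != 0 -> (0 < k)%N ->
  exp_arg (shift_char hdeg (h_coef c q true j) chi z) e i k =
  exp_arg chi e i k +
    (((Q * z) ^ (- qsign e)) ^+ k - ((Q^-1 * z) ^ (- qsign e)) ^+ k) / k%:R.
Proof.
move=> z0 k0; have k0' : k%:R != 0 :> C by rewrite pnatr_eq0 -lt0n.
have Q0 : Q != 0 by rewrite expfz_neq0 ?q1_neq0.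
have Qk : q1 ^ (k%:Z * bmat c i j) = Q ^+ k.
  by rewrite mulrC -exprz_exp.
have QNk : q1 ^ (- (k%:Z * bmat c i j)) = Q ^- k.
  by rewrite -invr_expz Qk.
have d0 := q1B_neq0.
have kz : (k%:Z != 0) by rewrite -lt0n.
have Nkz : (- k%:Z != 0) by rewrite oppr_eq0.
rewrite /exp_arg; case: e.
  rewrite expr1 !mulN1r insubT /shift_char /h_coef /hdeg /= /qint !expr1 opprK expr1z.
  rewrite (mulNr k%:Z) !opprK Qk QNk expr1z.
  rewrite -!exprnP mulrNz -pmulrn !exprMn exprVn.
  move: d0 k0'; set d := q1 - _; set b := Q ^- k; move: b d k%:R (Q ^+ k) (z ^+ k).
  by move=> b d u a w d0 u0; field; rewrite d0 u0.
rewrite expr0 !mul1r insubT /shift_char /h_coef /hdeg /= /qint Qk QNk expr1.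
rewrite expr0 -!exprz_inv !expr1z !invfM invrK -pmulrn !exprMn exprVn.
rewrite -[z^-1 ^ k]/(z^-1 ^+ k).
move: d0 k0'; set d := q1 - _; set w := z^-1 ^+ k; set b := Q ^- k.
by move: b d k%:R (Q ^+ k) w => b d u a w d0 u0; field; rewrite d0 u0.
Qed.

Lemma weight_factor (l : hst) (e : bool) i j :
  qpow q ((l - Defs.root rl j) ((qsign e * (cr c i)%:R) *: coroot rl i)) =
  qpow q (l ((qsign e * (cr c i)%:R) *: coroot rl i)) *
    (q1 ^ bmat c i j) ^ (- qsign e).
Proof.
rewrite add_lfunE opp_lfunE qpowD exprz_exp qpow1_int; congr (_ * qpow q _).
rewrite linearZ /= root_coroot /bmat -[_ *: _]/(_ * _) !intrM mulrNz -pmulrn.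
by case: e; rewrite ?expr1 ?expr0 /=; ring.
Qed.

(** The rational function [q^B (X - q^{-B} z) / (X - q^B z)] by which the
    scalars change is, in the variable [X], that of A_{j,1/z}^{-1}; it is the
    same at zero and at infinity. *)
Lemma phz_shift l chi e i j z r (Q := q1 ^ bmat c i j) : z != 0 ->
  conv ('X - (Q * z)%:P)
    (phz (l - Defs.root rl j) (shift_char hdeg (h_coef c q true j) chi z) e i) r =
  Q *: conv ('X - (Q^-1 * z)%:P) (phz l chi e i) r.
Proof.
move=> z0; have Q0 : Q != 0 by rewrite expfz_neq0 ?q1_neq0.
rewrite !conv_XsubC /phz /lchar.
set chi' := shift_char _ _ _ _.
have E : forall m, expc (exp_arg chi' e i) m.+1 -
      (Q * z) ^ (- qsign e) * expc (exp_arg chi' e i) m =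
    expc (exp_arg chi e i) m.+1 - (Q^-1 * z) ^ (- qsign e) * expc (exp_arg chi e i) m.
  by apply: expc_shift => k k0; rewrite exp_arg_shift.
have f0 := expc0 (exp_arg chi e i); have f0' := expc0 (exp_arg chi' e i).
rewrite -!/(exp_arg _ _ _) weight_factor -/Q.
move: E f0 f0'; set f' := expc _; set f := expc _; set kap := qpow q _.
move: f f' kap => f f' kap E f0 f0'.
have scE (a b : C) : a *: (b : C^o) = a * b by [].
rewrite !scE; case: e E => [|] E.
- rewrite expr1 !mulN1r opprK expr1z in E *; rewrite !expr1z in E.
  case: r => [[|[|k]]|k].
  + rewrite /= f0 f0'; have := E 0%N; rewrite f0 f0' !mulr1 => E0.
    have -> : f' 1%N = f 1%N - Q^-1 * z + Q * z by rewrite -E0 subrK.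
    by ring.
  + by rewrite /= f0 f0'; ring.
  + have -> : k.+2%:Z - 1 = k.+1 by rewrite intS addrAC subrr add0r.
    by rewrite /= !mulr0 !subr0 mulr0.
  + have -> : Negz k - 1 = Negz k.+1 by rewrite !NegzE -opprD -PoszD addn1.
    rewrite !NegzE !opprK /=.
    have -> : f' k.+2 = f k.+2 - Q^-1 * z * f k.+1 + Q * z * f' k.+1 by rewrite -E subrK.
    by ring.
- rewrite expr0 !mul1r -!exprz_inv !expr1z in E *.
  case: r => [[|k]|k].
  + by rewrite /= f0 f0'; field; rewrite Q0.
  + have -> : k.+1%:Z - 1 = k by rewrite intS addrAC subrr add0r.
    rewrite /=.
    have -> : f' k.+1 = f k.+1 - (Q^-1 * z)^-1 * f k + (Q * z)^-1 * f' k.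
      by rewrite -E subrK.
    by field; rewrite Q0 z0.
  + have -> : Negz k - 1 = Negz k.+1 by rewrite !NegzE -opprD -PoszD addn1.
    by rewrite /= !mulr0 !subr0 mulr0.
Qed.

End CharacterShift.

(** * Orders of rational functions *)

Section Orders.
Variable K : closedFieldType.
Implicit Types (p r num den : {poly K}) (b z : K) (s : seq K).

Lemma prod_XsubC_neq0 s : \prod_(z <- s) ('X - z%:P) != 0.
Proof. exact/monic_neq0/monic_prod_XsubC. Qed.

Lemma mup_prod_XsubC b s : mup b (\prod_(z <- s) ('X - z%:P)) = count_mem b s.
Proof.
elim: s => [|z s IH]; first by rewrite big_nil mupNroot // root1.
rewrite big_cons mupM ?polyXsubC_eq0 ?prod_XsubC_neq0 // IH /=.
by congr (_ + _)%N; rewrite -['X - _]expr1 mup_XsubCX; case: eqP.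
Qed.

Lemma mupZ b a p : a != 0 -> mup b (a *: p) = mup b p.
Proof. by move=> a0; rewrite -mul_polyC mupMr // rootC. Qed.

Lemma mup_factor p b : p != 0 ->
  exists2 r, ~~ root r b & p = r * ('X - b%:P) ^+ mup b p.
Proof.
move=> p0; have [m [r /implyP/(_ p0) rb pE]] := multiplicity_XsubC p b.
exists r => //; rewrite {1}pE; congr (_ * _ ^+ _).
by rewrite pE mupMr // mup_XsubCX eqxx.
Qed.

Definition delta0 (k : int) : K^o := (k == 0)%:R.

Lemma conv_delta0 p (k : nat) : conv p delta0 k%:Z = p`_k.
Proof.
rewrite (@convE _ _ (maxn (size p) k.+1)) ?leq_maxl //.
have kN : (k < maxn (size p) k.+1)%N by rewrite leq_max leqnn orbT.
rewrite (bigD1 (Ordinal kN)) //= subrr /delta0 eqxx big1 ?addr0.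
  by rewrite -[_ *: _]/(_ * _) mulr1.
move=> j; rewrite -val_eqE /= => jk; rewrite subr_eq0 eqz_nat eq_sym (negPf jk).
exact: mulr0.
Qed.

Lemma conv_delta0_inj p r : conv p delta0 =1 conv r delta0 -> p = r.
Proof. by move=> e; apply/polyP => k; rewrite -!conv_delta0 e. Qed.

Definition ordp num den b : int := (mup b num)%:Z - (mup b den)%:Z.

Lemma ordpM num num' den den' b : num != 0 -> num' != 0 -> den != 0 -> den' != 0 ->
  ordp (num * num') (den * den') b = ordp num den b + ordp num' den' b.
Proof. by move=> *; rewrite /ordp !mupM // !PoszD; lia. Qed.

Lemma ordp_eq num num' den den' b a a' :
  num != 0 -> num' != 0 -> den != 0 -> den' != 0 -> a != 0 -> a' != 0 ->
  a *: (num * den') = a' *: (num' * den) -> ordp num den b = ordp num' den' b.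
Proof.
move=> n0 n0' d0 d0' a0 a0' /(congr1 (mup b)).
by rewrite !mupZ // !mupM // /ordp; lia.
Qed.

End Orders.

Lemma mup_dilate (R : realType) (p : {poly R[i]}) a b : p != 0 -> a != 0 -> mup b (dilate p a) = mup (a * b) p.
Proof.
move=> p0 a0; have [r rb pE] := mup_factor (a * b) p0.
have rb' : ~~ root (dilate r a) b.
  by rewrite /root /dilate horner_comp hornerZ hornerX.
have dX : dilate ('X - (a * b)%:P) a = a *: ('X - b%:P).
  by rewrite /dilate comp_polyB comp_polyX comp_polyC scalerBr -!mul_polyC polyCM.
have -> : dilate p a = dilate r a * (a *: ('X - b%:P)) ^+ mup (a * b) p.
  by rewrite {1}pE -dX /dilate comp_polyM rmorphXn.
by rewrite mupMr // exprZn mupZ ?expf_neq0 // mup_XsubCX eqxx.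
Qed.

(** * Finitely many dominant monomials below a character *)

(** Extension of a sequence by zero to negative indices. *)
Definition ext (K : nzRingType) (f : nat -> K) (r : int) : K^o :=
  if 0 <= r then f `|r|%N else 0.

Lemma conv_ext (K : comNzRingType) (p : {poly K}) (f : nat -> K) (m : nat) :
  conv p (ext f) m%:Z = \sum_(k < m.+1) f k * p`_(m - k).
Proof.
rewrite (@convE _ _ (maxn (size p) m.+1)) ?leq_maxl //.
rewrite [RHS](reindex_inj rev_ord_inj) /=.
rewrite (big_ord_widen (maxn (size p) m.+1)
  (fun k => f (m.+1 - k.+1)%N * p`_(m - (m.+1 - k.+1)))) ?leq_maxr //.
rewrite [RHS]big_mkcond /=; apply: eq_bigr => k _.
rewrite /ext ltnS subr_ge0 lez_nat; case: leqP => km; last exact: mulr0.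
rewrite subSS subKn // mulrC; congr (_ * f _).
lia.
Qed.

Lemma conv_ext_neg (K : comNzRingType) (p : {poly K}) (f : nat -> K) (r : int) :
  r < 0 -> conv p (ext f) r = 0.
Proof.
move=> r0; rewrite /conv big1 // => k _; rewrite /ext ifN ?scaler0 //.
by rewrite -ltNge; lia.
Qed.

Lemma conv_delta0_neg (K : closedFieldType) (p : {poly K}) (r : int) :
  r < 0 -> conv p (@delta0 K) r = 0.
Proof.
move=> r0; rewrite /conv big1 // => k _; rewrite /delta0.
by case: eqP => [|_]; [lia | rewrite scaler0].
Qed.

Section Finiteness.
Variables (R : realType) (n : nat) (c : cartan_datum n) (rl : realization c)
          (q : qparam R[i]).
Local Notation C := R[i].
Local Notation H := (car rl).
Local Notation B := (bmat c).
Local Notation q1 := (qpow q 1).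
Local Notation hst := (hstar H).
Local Notation Y := ('I_n * {m : int | m != 0})%type.

Lemma qiE i : qi c q i = q1 ^ (cr c i)%:Z.
Proof. by rewrite qpow1_int -pmulrn. Qed.

Lemma q1z_neq0 k : q1 ^ k != 0. Proof. by rewrite expfz_neq0 ?qpow_neq0. Qed.

Lemma q1zD k l : q1 ^ (k + l) = q1 ^ k * q1 ^ l.
Proof. by rewrite expfzDr ?qpow_neq0. Qed.

Lemma phz_ext (l : hst) (chi : Y -> C) i : phz q l chi false i =1 ext (lchar q l chi false i).
Proof. by move=> r; rewrite /phz expr0 mul1r. Qed.

Definition num_low (i : 'I_n) (v : seq ('I_n * C)) : {poly C} :=
  \prod_(x <- v) ('X - (q1 ^ (- B i x.1) * x.2)%:P).
Definition den_low (i : 'I_n) (v : seq ('I_n * C)) : {poly C} :=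
  \prod_(x <- v) ('X - (q1 ^ B i x.1 * x.2)%:P).

Lemma num_low_neq0 i v : num_low i v != 0.
Proof. by rewrite /num_low -(big_map _ predT (fun z => 'X - z%:P)) prod_XsubC_neq0. Qed.
Lemma den_low_neq0 i v : den_low i v != 0.
Proof. by rewrite /den_low -(big_map _ predT (fun z => 'X - z%:P)) prod_XsubC_neq0. Qed.

Lemma phz_low (l : hst) (chi : Y -> C) e i v r : nonzero_points v ->
  conv (den_low i v) (phz q (lowered l v) (shiftv c q chi v) e i) r =
  (\prod_(x <- v) q1 ^ B i x.1) *: conv (num_low i v) (phz q l chi e i) r.
Proof.
rewrite /den_low /num_low; elim: v r => [|[j z] v IH] r /=.
  by rewrite !big_nil !conv1 scale1r /lowered big_nil subr0.
move=> /andP[z0 v0]; rewrite !big_cons /= mulrC convM.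
have -> : lowered l ((j, z) :: v) = lowered l v - Defs.root rl j.
  by rewrite /lowered big_cons opprD addrA addrAC.
have sh k : conv ('X - (q1 ^ B i j * z)%:P) (phz q (lowered l v - Defs.root rl j)
    (shift_char hdeg (h_coef c q true j) (shiftv c q chi v) z) e i) k =
  q1 ^ B i j *: conv ('X - ((q1 ^ B i j)^-1 * z)%:P)
    (phz q (lowered l v) (shiftv c q chi v) e i) k by exact: phz_shift.
rewrite (eq_conv _ _ sh) convZg -convM (mulrC (\prod_(_ <- v) _)) convM.
rewrite (eq_conv _ _ (fun k => IH k v0)) convZg -convM scalerA.
by rewrite invr_expz.
Qed.

(** Exponents of [Y_{i,1/x}] in [A_{j,1/z}]: the points [q^k z] listed by
    [A_shifts], with one common sign. *)
Definition A_shifts (j i : 'I_n) : seq int :=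
  if i == j then [:: (cr c j)%:Z; - (cr c j)%:Z]
  else [seq (cr c i)%:Z * (`|cmat c i j|%N%:Z - 1 - 2 * l%:Z) | l <- index_iota 0 `|cmat c i j|%N].

Definition A_exp (x : 'I_n * C) (i : 'I_n) (y : C) : int :=
  (if i == x.1 then 1 else -1) *
  \sum_(k <- A_shifts x.1 i) (y == q1 ^ k * x.2)%:R.

Lemma q1_eq_shift k l (b z : C) :
  (q1 ^ k * b == q1 ^ l * z) = (b == q1 ^ (l - k) * z).
Proof.
rewrite -(inj_eq (mulfI (q1z_neq0 k)) b) mulrA -q1zD.
by rewrite addrCA subrr addr0.
Qed.

Lemma A_exp_diff x i b :
  A_exp x i (q1 ^ (- (cr c i)%:Z) * b) - A_exp x i (q1 ^ (cr c i)%:Z * b) =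
  (b == q1 ^ B i x.1 * x.2)%:R - (b == q1 ^ (- B i x.1) * x.2)%:R :> int.
Proof.
case: x => j z /=; rewrite /A_exp /= -mulrBr -sumrB.
under eq_bigr => k _ do rewrite !q1_eq_shift opprK.
rewrite /A_shifts; case: (eqVneq i j) => [->|ij].
  rewrite mul1r big_cons big_seq1 addNr subrr addrA subrK /bmat cmat_diag.
  by congr ((b == q1 ^ _ * z)%:R - (b == q1 ^ _ * z)%:R); ring.
have Cle : cmat c i j = - `|cmat c i j|%N%:Z.
  by have := cmat_offdiag c ij; lia.
rewrite big_map mulN1r -sumrN.
pose F (l : nat) : int := (b == q1 ^ ((cr c i)%:Z * (`|cmat c i j|%N%:Z - 2 * l%:Z)) * z)%:R.
rewrite (eq_bigr (fun l => F l.+1 - F l)); last first.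
  move=> l _; rewrite opprB /F.
  by congr ((b == q1 ^ _ * z)%:R - (b == q1 ^ _ * z)%:R); rewrite ?intS; ring.
rewrite telescope_sumr // /F /bmat [in RHS]Cle.
by congr ((b == q1 ^ _ * z)%:R - (b == q1 ^ _ * z)%:R); ring.
Qed.

Lemma ordp_low i v b : ordp (num_low i v) (den_low i v) b =
  - \sum_(x <- v) (A_exp x i (q1 ^ (- (cr c i)%:Z) * b) - A_exp x i (q1 ^ (cr c i)%:Z * b)).
Proof.
rewrite /ordp /num_low /den_low.
rewrite -(big_map (fun x => q1 ^ (- B i x.1) * x.2) predT (fun z => 'X - z%:P)).
rewrite -(big_map (fun x => q1 ^ (B i x.1) * x.2) predT (fun z => 'X - z%:P)).
rewrite !mup_prod_XsubC !count_map.
elim: v => [|x v IH]; first by rewrite big_nil.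
rewrite big_cons opprD -IH A_exp_diff /= !PoszD opprB.
rewrite !(eq_sym b); case: (_ == b); case: (_ == b); lia.
Qed.

Section Witness.
Variables (x : lweight R rl) (Q S : 'I_n -> {poly C}).
Hypothesis wit : QPl_witness q x Q S.

Definition QS_num i : {poly C} := (qi c q i ^ ((size (Q i)).-1%:Z - (size (S i)).-1%:Z)) *:
  (dilate (Q i) (qi c q i)^-1 * dilate (S i) (qi c q i)).
Definition QS_den i : {poly C} := dilate (Q i) (qi c q i) * dilate (S i) (qi c q i)^-1.

Lemma qi_neq0 i : qi c q i != 0. Proof. exact: qpow_neq0. Qed.

Lemma dilate_horner0 (p : {poly C}) a : (dilate p a).[0] = p.[0].
Proof. by rewrite /dilate horner_comp hornerZ hornerX mulr0. Qed.

Lemma horner0_neq0 (p : {poly C}) : p.[0] = 1 -> p != 0.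
Proof. by move=> p0; apply: contra_eq_neq p0 => ->; rewrite horner0 eq_sym oner_neq0. Qed.

Lemma dilate_neq0 (p : {poly C}) a : p.[0] = 1 -> dilate p a != 0.
Proof. by move=> p0; apply: horner0_neq0; rewrite dilate_horner0. Qed.

Lemma QS_num_neq0 i : QS_num i != 0.
Proof.
have [Q0 S0 _ _] := wit i.
by rewrite scaler_eq0 negb_or expfz_neq0 ?qi_neq0 // mulf_neq0 ?dilate_neq0.
Qed.

Lemma QS_den_neq0 i : QS_den i != 0.
Proof. by have [Q0 S0 _ _] := wit i; rewrite mulf_neq0 ?dilate_neq0. Qed.

Lemma QS_den0 i : (QS_den i)`_0 = 1.
Proof.
have [Q0 S0 _ _] := wit i.
by rewrite -horner_coef0 /QS_den hornerM !dilate_horner0 Q0 S0 mulr1.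
Qed.

Definition QS_mult i (y : C) : int := (mup y (Q i))%:Z - (mup y (S i))%:Z.

Lemma ordp_QS i b : ordp (QS_num i) (QS_den i) b =
  QS_mult i (q1 ^ (- (cr c i)%:Z) * b) - QS_mult i (q1 ^ (cr c i)%:Z * b).
Proof.
have [Q0 S0 _ _] := wit i.
rewrite /ordp /QS_num mupZ ?expfz_neq0 ?qi_neq0 //.
rewrite !mupM ?dilate_neq0 // !mup_dilate ?invr_neq0 ?qi_neq0 ?horner0_neq0 //.
have gen (a b' d e : nat) : (a + b')%N%:Z - (d + e)%N%:Z = (a%:Z - e%:Z) - (d%:Z - b'%:Z).
  by lia.
by rewrite gen /QS_mult -qiE -invr_expz -qiE.
Qed.

Lemma conv_QS (f : nat -> C) i r : x.2 false i = f ->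
  conv (QS_den i) (ext f) r = conv (QS_num i) (@delta0 C) r.
Proof.
move=> xf; have [_ _ + _] := wit i; rewrite /expands_to xf => e.
case: r => m; last by rewrite conv_ext_neg // conv_delta0_neg.
by rewrite conv_ext conv_delta0 e.
Qed.

End Witness.

End Finiteness.

Lemma finite_bounded_seqs (T : eqType) (s : seq T) N :
  finite_set [set v : seq T | (size v <= N)%N /\ all (mem s) v].
Proof.
pose L := iter N (fun l => [::] :: [seq x :: v | x <- s, v <- l]) [:: [::]].
apply: (@sub_finite_set _ _ [set` L]); last exact: finite_seq.
move=> v [vN vs] /=; rewrite /L; elim: N v vN vs {L} => [|N IH] [|x v] //= vN /andP[xs vs].
by rewrite inE; apply/allpairsP; exists (x, v); split => //=; apply: IH.
Qed.

Lemma sum_seq_le (T : eqType) (s : seq T) (F : T -> int) (N : nat) :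
  (forall x, x \in s -> F x <= N%:Z) -> \sum_(x <- s) F x <= (size s * N)%N%:Z.
Proof.
elim: s => [|x s IH] sN; first by rewrite big_nil.
rewrite big_cons /= mulSn PoszD lerD ?sN ?mem_head // IH // => y ys.
by rewrite sN // inE ys orbT.
Qed.

Section Bound.
Variables (R : realType) (n : nat) (c : cartan_datum n) (rl : realization c)
          (q : qparam R[i]).
Local Notation C := R[i].
Local Notation H := (car rl).
Local Notation B := (bmat c).
Local Notation q1 := (qpow q 1).
Local Notation hst := (hstar H).
Local Notation Y := ('I_n * {m : int | m != 0})%type.

Lemma q1z_injl k l (s : C) : s != 0 -> q1 ^ k * s = q1 ^ l * s -> k = l.
Proof. by move=> s0 /(mulIf s0)/qpow1_int_inj. Qed.

(** A finitely supported function on the nonzero points is determined by its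
    differences along a string of points, as strings are infinite. *)
Lemma string_difference_inj (D : C -> int) (r : nat) (T : seq C) : (0 < r)%N ->
  (forall b, b != 0 -> D (q1 ^ (- r%:Z) * b) = D (q1 ^ r%:Z * b)) ->
  (forall x, x != 0 -> D x != 0 -> x \in T) ->
  forall x, x != 0 -> D x = 0.
Proof.
move=> r0 Dper DT x x0; apply/eqP; apply: contraT => Dx.
pose y (k : nat) := q1 ^ (2 * r%:Z * k%:Z) * x.
have y0 k : y k != 0 by rewrite mulf_neq0 ?q1z_neq0.
have Dy k : D (y k) = D x.
  elim: k => [|k <-]; first by rewrite /y mulr0 expr0z mul1r.
  have -> : y k.+1 = q1 ^ r%:Z * (q1 ^ r%:Z * y k).
    by rewrite /y !mulrA -!q1zD; congr (q1 ^ _ * _); rewrite intS; ring.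
  rewrite -Dper ?mulf_neq0 ?q1z_neq0 //; congr D.
  by rewrite mulrA -q1zD addNr expr0z mul1r.
have yT : {subset [seq y k | k <- iota 0 (size T).+1] <= T}.
  by move=> _ /mapP[k _ ->]; apply: DT; rewrite ?Dy.
have yu : uniq [seq y k | k <- iota 0 (size T).+1].
  rewrite map_inj_uniq ?iota_uniq // => k l /(q1z_injl x0)/eqP.
  by rewrite (inj_eq (mulfI _)) ?mulf_neq0 // ?eqz_nat => [/eqP//|]; lia.
by have := uniq_leq_size yu yT; rewrite size_map size_iota ltnn.
Qed.

(** Weights growing exponentially away from a point [s] along its string. *)
Definition theta : nat := (2 + \sum_i \sum_j `|cmat c i j|)%N.

Definition gauge (s x : C) : int :=
  if pselect (exists k : int, x = q1 ^ k * s) is left ex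
  then (theta ^ `|sval (cid ex)|)%N%:Z else 0.

Lemma gauge_string s k : s != 0 -> gauge s (q1 ^ k * s) = (theta ^ `|k|)%N%:Z.
Proof.
move=> s0; rewrite /gauge; case: pselect => [ex|[]]; last by exists k.
by case: (cid ex) => l /= /(q1z_injl s0) <-.
Qed.

Lemma gauge_out s x : ~ (exists k : int, x = q1 ^ k * s) -> gauge s x = 0.
Proof. by rewrite /gauge; case: pselect. Qed.

Lemma gauge_ge0 s x : 0 <= gauge s x.
Proof. by rewrite /gauge; case: pselect. Qed.

Lemma gauge_self s : s != 0 -> gauge s s = 1.
Proof. by move=> s0; have := gauge_string 0 s0; rewrite expr0z mul1r. Qed.

Definition pairing (X : seq C) (u : 'I_n -> C -> int) (s : C) : int :=
  \sum_i \sum_(x <- X) u i x * gauge s x.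

Lemma pairingD X u u' s :
  pairing X (fun i x => u i x + u' i x) s = pairing X u s + pairing X u' s.
Proof.
rewrite /pairing -big_split; apply: eq_bigr => i _; rewrite -big_split.
by apply: eq_bigr => x _; rewrite mulrDl.
Qed.

Lemma pairing_sum X (I : Type) (r : seq I) (u : I -> 'I_n -> C -> int) s :
  pairing X (fun i x => \sum_(a <- r) u a i x) s = \sum_(a <- r) pairing X (u a) s.
Proof.
rewrite /pairing [RHS]exchange_big; apply: eq_bigr => i _; rewrite [RHS]exchange_big.
by apply: eq_bigr => x _; rewrite mulr_suml.
Qed.

Lemma eq_pairing X u u' s : (forall i x, x \in X -> u i x = u' i x) ->
  pairing X u s = pairing X u' s.
Proof.
by move=> uu; apply: eq_bigr => i _; apply: eq_big_seq => x xX; rewrite uu.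
Qed.

Lemma pairing_support X X' u s : uniq X -> uniq X' -> {subset X' <= X} ->
  (forall i x, x \in X -> x \notin X' -> u i x = 0) ->
  pairing X u s = pairing X' u s.
Proof.
move=> uX uX' sub u0; apply: eq_bigr => i _.
rewrite big_seq (bigID (mem X')) /= [X in _ + X]big1 ?addr0; last first.
  by move=> x /andP[xX xX']; rewrite u0 ?mul0r.
rewrite -big_seq_cond -big_filter; apply: perm_big; apply: uniq_perm => //.
  exact: filter_uniq.
by move=> x; rewrite mem_filter; case xX' : (x \in X'); rewrite //= sub.
Qed.

Definition A_points (x : 'I_n * C) : seq C :=
  flatten [seq [seq q1 ^ k * x.2 | k <- A_shifts c x.1 i] | i <- enum 'I_n].

Lemma A_points_mem x i k : k \in A_shifts c x.1 i -> q1 ^ k * x.2 \in A_points x.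
Proof.
move=> kA; apply/flatten_mapP; exists i; first by rewrite mem_enum.
exact: map_f.
Qed.

Lemma A_exp_support x i y : A_exp c q x i y != 0 -> y \in A_points x.
Proof.
apply: contraR => yA; rewrite /A_exp big_seq big1 ?mulr0 // => k kA.
by case: eqP => // ye; case/negP: yA; rewrite ye; apply: A_points_mem kA.
Qed.

Lemma pairing_A X x s : uniq X -> {subset A_points x <= X} ->
  pairing X (A_exp c q x) s = \sum_i (if i == x.1 then 1 else -1) *
    \sum_(k <- A_shifts c x.1 i) gauge s (q1 ^ k * x.2).
Proof.
move=> uX sub; apply: eq_bigr => i _; rewrite /A_exp.
under eq_bigr => y _ do rewrite -mulrA mulr_suml.
rewrite -mulr_sumr exchange_big; congr (_ * _).
apply: eq_big_seq => k kA /=.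
rewrite (bigD1_seq (q1 ^ k * x.2)) //=; last exact/sub/(A_points_mem kA).
rewrite eqxx mul1r.
by rewrite big1 ?addr0 // => y /negPf->; rewrite mul0r.
Qed.

Hypothesis HC : forall i j : 'I_n, cmat c i j < -1 -> cr c i = 1%N /\ cmat c j i = -1.

(** The hypothesis on the Cartan matrix: in [A_{j,a}] the factors [Y_i] with
    [i != j] lie strictly between the two factors [Y_j]. *)
Lemma A_shifts_bound j i k : i != j -> k \in A_shifts c j i -> (`|k| < cr c j)%N.
Proof.
move=> ij; rewrite /A_shifts (negPf ij) => /mapP[l]; rewrite mem_index_iota /= => lp ->.
have Cle := cmat_offdiag c ij.
suff rlt : (cr c i * (`|cmat c i j| - 1) < cr c j)%N.
  apply: leq_ltn_trans rlt; rewrite abszM leq_mul //; lia.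
case: (ltP (cmat c i j) (-1)) => [C1|C1].
  have [r1 Cji] := HC C1; have := cmat_sym c i j.
  rewrite r1 Cji; lia.
have -> : (`|cmat c i j| - 1 = 0)%N by lia.
by rewrite muln0 cr_gt0.
Qed.

Lemma sum_A_sizes j : (\sum_(i | i != j) size (A_shifts c j i) < theta)%N.
Proof.
rewrite /theta add2n ltnS ltnW // ltnS exchange_big /= [X in (_ <= X)%N](bigD1 j) //=.
apply: leq_trans (leq_addr _ _); rewrite big_mkcond; apply: leq_sum => i _.
by case: ifP => // ij; rewrite /A_shifts (negPf ij) size_map size_iota subn0.
Qed.

(** The pairing of [A_{j,1/z}] with the gauge is dominated by its two factors
    [Y_j], which lie farthest out. *)
Lemma pairing_A_ge X x s : s != 0 -> uniq X -> {subset A_points x <= X} ->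
  gauge s x.2 <= pairing X (A_exp c q x) s.
Proof.
move=> s0 uX sub; rewrite pairing_A //; case: x sub => j z /= _.
have [[k0 ->]|nz] := pselect (exists k : int, z = q1 ^ k * s); last first.
  rewrite gauge_out // big1 // => i _; rewrite big1 ?mulr0 // => k _.
  rewrite gauge_out // => -[l e]; apply: nz; exists (l - k).
  by rewrite addrC q1zD -mulrA -e mulrA -q1zD addNr expr0z mul1r.
have gE k : gauge s (q1 ^ k * (q1 ^ k0 * s)) = (theta ^ `|(k + k0)%R|)%N%:Z.
  by rewrite mulrA -q1zD gauge_string.
rewrite gauge_string // (bigD1 j) //= eqxx mul1r {1}/A_shifts eqxx big_cons big_seq1 !gE.
pose T := (theta ^ (`|k0| + (cr c j).-1))%N.
have th1 : (0 < theta)%N by [].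
have big_part : (theta * T)%N%:Z <= (theta ^ `|((cr c j)%:Z + k0)%R|)%N%:Z +
    (theta ^ `|(- (cr c j)%:Z + k0)%R|)%N%:Z.
  have rp := cr_gt0 c j.
  rewrite /T -expnS -PoszD lez_nat.
  have [k0p|k0n] := leP 0 k0.
    by apply: leq_trans (leq_addr _ _); rewrite leq_pexp2l //; lia.
  by apply: leq_trans (leq_addl _ _); rewrite leq_pexp2l //; lia.
have small_part : \sum_(i | i != j) \sum_(k <- A_shifts c j i)
    gauge s (q1 ^ k * (q1 ^ k0 * s)) <= ((theta - 1) * T)%N%:Z.
  apply: (@le_trans _ _ (\sum_(i | i != j) (size (A_shifts c j i) * T)%N%:Z)).
    apply: ler_sum => i ij; apply: sum_seq_le => k kA.
    rewrite gE lez_nat leq_pexp2l //.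
    have := A_shifts_bound ij kA; lia.
  rewrite -(big_morph Posz PoszD (erefl 0%:Z)) lez_nat -big_distrl /= leq_mul2r.
  by apply/orP; right; rewrite subn1 -ltnS prednK // sum_A_sizes.
have -> : \sum_(i | i != j) (if i == j then 1 else -1) *
    \sum_(k <- A_shifts c j i) gauge s (q1 ^ k * (q1 ^ k0 * s)) =
    - \sum_(i | i != j) \sum_(k <- A_shifts c j i) gauge s (q1 ^ k * (q1 ^ k0 * s)).
  by rewrite -sumrN; apply: eq_bigr => i /negPf->; rewrite mulN1r.
have TE : (theta ^ `|k0|)%N%:Z <= T%:Z.
  by rewrite lez_nat leq_pexp2l // leq_addr.
have split : (theta * T)%N%:Z = ((theta - 1) * T)%N%:Z + T%:Z.
  by rewrite -PoszD -mulSnr subn1 prednK.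
lia.
Qed.

End Bound.

Section DominantFinite.
Variables (R : realType) (n : nat) (c : cartan_datum n) (rl : realization c)
          (q : qparam R[i]).
Local Notation C := R[i].
Local Notation H := (car rl).
Local Notation B := (bmat c).
Local Notation q1 := (qpow q 1).
Local Notation hst := (hstar H).
Local Notation Y := ('I_n * {m : int | m != 0})%type.

Definition mults_agree (m : monomial R rl) (Q S : 'I_n -> {poly C}) :=
  forall i (a : Cstar R), mon_u m i a =
    (mup (sval a)^-1 (Q i))%:Z - (mup (sval a)^-1 (S i))%:Z.

(** [m] is the monomial of the l-weight [l, chi] lowered by [v]. *)
Definition lowered_monomial (l : hst) (chi : Y -> C) (m : monomial R rl)
    (v : seq ('I_n * C)) : Prop :=
  exists (x : lweight R rl) Q S,
    [/\ QPl_witness q x Q S /\ mults_agree m Q S, mon_omega m = nu x.1, nonzero_points v,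
        x.1 = lowered l v & x.2 = lchar q x.1 (shiftv c q chi v)].

Section FixedCharacter.
Variables (l : hst) (chi : Y -> C).
Local Notation reach := (lowered_monomial l chi).

(** Up to scalars, numerator and denominator of [m] times those of the lowering
    factors give the same rational function for all lowered monomials. *)
Lemma series_low (x : lweight R rl) Q S v i :
  QPl_witness q x Q S -> nonzero_points v -> x.1 = lowered l v ->
  x.2 = lchar q x.1 (shiftv c q chi v) ->
  exists2 a : C, a != 0 & forall p r,
    conv (p * (QS_num c q Q S i * den_low c q i v)) (@delta0 C) r =
    a *: conv (p * (QS_den c q Q S i * num_low c q i v)) (phz q l chi false i) r.
Proof.
move=> wit v0 x1 x2.
exists (\prod_(y <- v) q1 ^ B i y.1).
  by rewrite prodf_seq_neq0; apply/allP => y _ /=; rewrite q1z_neq0.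
move=> p r.
have e1 : x.2 false i = lchar q (lowered l v) (shiftv c q chi v) false i.
  by rewrite x2 x1.
rewrite (mulrC (QS_num _ _ _ _ _)) mulrA convM.
rewrite -(eq_conv _ _ (fun k => conv_QS wit k e1)) -convM -mulrA.
rewrite (mulrC (den_low _ _ _ _)) mulrA convM.
rewrite -(eq_conv _ _ (fun k => eq_conv (den_low c q i v) k
  (phz_ext q (lowered l v) (shiftv c q chi v) i))).
rewrite (eq_conv _ _ (fun k => phz_low q l chi false i k v0)) convZg.
by rewrite -convM -mulrA.
Qed.

Lemma ordp_lowered (x x' : lweight R rl) Q S Q' S' v v' i b :
  QPl_witness q x Q S -> nonzero_points v -> x.1 = lowered l v ->
  x.2 = lchar q x.1 (shiftv c q chi v) ->
  QPl_witness q x' Q' S' -> nonzero_points v' -> x'.1 = lowered l v' ->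
  x'.2 = lchar q x'.1 (shiftv c q chi v') ->
  ordp (QS_num c q Q S i) (QS_den c q Q S i) b -
    ordp (num_low c q i v) (den_low c q i v) b =
  ordp (QS_num c q Q' S' i) (QS_den c q Q' S' i) b -
    ordp (num_low c q i v') (den_low c q i v') b.
Proof.
move=> wit v0 x1 x2 wit' v0' x1' x2'.
have [a a0 E] := series_low i wit v0 x1 x2.
have [a' a0' E'] := series_low i wit' v0' x1' x2'.
have nN := QS_num_neq0 wit i; have nD := QS_den_neq0 wit i.
have nN' := QS_num_neq0 wit' i; have nD' := QS_den_neq0 wit' i.
move: E E' nN nD nN' nD'.
move: (QS_num _ _ _ _ _) (QS_den _ _ _ _ _) => N D.
move: (QS_num _ _ _ _ _) (QS_den _ _ _ _ _) => N' D' E E' nN nD nN' nD'.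
have nl := num_low_neq0 c q i; have dl := den_low_neq0 c q i.
have e : a' *: ((N * den_low c q i v) * (D' * num_low c q i v')) =
    a *: ((N' * den_low c q i v') * (D * num_low c q i v)).
  apply: conv_delta0_inj => r.
  rewrite !convZp mulrC E [in RHS]mulrC E' !scalerA mulrC.
  by congr (_ *: conv _ _ _); rewrite mulrC.
have := ordp_eq b (mulf_neq0 nN (dl v)) (mulf_neq0 nN' (dl v')) (mulf_neq0 nD (nl v))
  (mulf_neq0 nD' (nl v')) a0' a0 e.
rewrite !ordpM //.
have gen w : ordp (den_low c q i w) (num_low c q i w) b =
    - ordp (num_low c q i w) (den_low c q i w) b by rewrite /ordp opprB.
by rewrite !gen.
Qed.

(** The exponents of [m] raised back to the top. *)
Definition top_mult (Q S : 'I_n -> {poly C}) (v : seq ('I_n * C)) i y : int :=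
  QS_mult Q S i y + \sum_(x <- v) A_exp c q x i y.

Lemma mup_support (p : {poly C}) : p != 0 -> exists s : seq C, forall y,
  mup y p != 0%N -> y \in s.
Proof.
move=> p0; have [s ps] := closed_field_poly_normal p; exists s => y.
apply: contraR => ys; rewrite mupNroot // ps rootZ ?lead_coef_eq0 //.
by rewrite root_prod_XsubC.
Qed.

Lemma top_mult_support (x : lweight R rl) Q S v : QPl_witness q x Q S ->
  exists T : seq C, forall i y, top_mult Q S v i y != 0 -> y \in T.
Proof.
move=> wit.
have nQ i : Q i != 0 by have [Q0 _ _ _] := wit i; apply: horner0_neq0.
have nS i : S i != 0 by have [_ S0 _ _] := wit i; apply: horner0_neq0.
have /(_ _)/cid supp i := mup_support (nQ i).
have /(_ _)/cid supp' i := mup_support (nS i).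
exists (flatten [seq sval (supp i) ++ sval (supp' i) | i <- enum 'I_n] ++
        flatten [seq A_points c q x | x <- v]) => i y.
apply: contraR; rewrite mem_cat negb_or => /andP[yQ yA].
have {yQ} : y \notin sval (supp i) ++ sval (supp' i).
  apply: contra yQ => yQ; apply/flatten_mapP; exists i => //.
  by rewrite mem_enum.
rewrite mem_cat negb_or => /andP[yQ yS].
rewrite /top_mult /QS_mult.
have -> : mup y (Q i) = 0%N.
  by apply/eqP; apply: contraR yQ => /(svalP (supp i)).
have -> : mup y (S i) = 0%N.
  by apply/eqP; apply: contraR yS => /(svalP (supp' i)).
rewrite big_seq big1 // => z zv; apply/eqP; apply: contraR yA => /A_exp_support yA.
by apply/flatten_mapP; exists z.
Qed.

Lemma top_mult_eq (x x' : lweight R rl) Q S Q' S' v v' :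
  QPl_witness q x Q S -> nonzero_points v -> x.1 = lowered l v ->
  x.2 = lchar q x.1 (shiftv c q chi v) ->
  QPl_witness q x' Q' S' -> nonzero_points v' -> x'.1 = lowered l v' ->
  x'.2 = lchar q x'.1 (shiftv c q chi v') ->
  forall i y, y != 0 -> top_mult Q S v i y = top_mult Q' S' v' i y.
Proof.
move=> wit v0 x1 x2 wit' v0' x1' x2' i y y0.
have [T TP] := top_mult_support v wit; have [T' TP'] := top_mult_support v' wit'.
apply/eqP; rewrite -subr_eq0; apply/eqP; move: y y0.
apply: (@string_difference_inj _ q (fun y => top_mult Q S v i y - top_mult Q' S' v' i y)
   (cr c i) (T ++ T') (cr_gt0 c i)) => [b b0|y y0].
  have := ordp_lowered i b wit v0 x1 x2 wit' v0' x1' x2'.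
  rewrite (ordp_QS wit) (ordp_QS wit') !ordp_low !sumrB /top_mult.
  move: (\sum_(x <- v) _) (\sum_(x <- v) _) (\sum_(x <- v') _) (\sum_(x <- v') _).
  move: (QS_mult _ _ _ _) (QS_mult _ _ _ _) (QS_mult _ _ _ _) (QS_mult _ _ _ _).
  by move=> *; lia.
rewrite mem_cat; apply: contraR; rewrite negb_or => /andP[yT yT'].
have -> : top_mult Q S v i y = 0 by apply/eqP; apply: contraR yT => /TP.
have -> : top_mult Q' S' v' i y = 0 by apply/eqP; apply: contraR yT' => /TP'.
by [].
Qed.

Lemma lowered_monomial_inj m m' v : reach m v -> reach m' v -> m = m'.
Proof.
move=> [x [Q [S [[wit mu] mo v0 x1 x2]]]] [x' [Q' [S' [[wit' mu'] mo' v0' x1' x2']]]].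
have E := top_mult_eq wit v0 x1 x2 wit' v0' x1' x2'.
apply: val_inj; case: m mu mo => -[u w] /= um mu mo; case: m' mu' mo' => -[u' w'] /= um' mu' mo'.
congr (_, _); last by move: mo mo'; rewrite /mon_omega /= => -> ->; rewrite x1 x1'.
apply/fsfunP => -[i a].
have := mu i a; have := mu' i a; rewrite /mon_u /= => -> ->.
have a0 : (sval a)^-1 != 0 by rewrite invr_neq0 ?(svalP a).
have := E i _ a0; rewrite /top_mult /QS_mult.
by move/addIr.
Qed.

Hypothesis HC : forall i j : 'I_n, cmat c i j < -1 -> cr c i = 1%N /\ cmat c j i = -1.

Lemma lowered_monomial_bound : exists N (Z : seq ('I_n * C)), forall m v,
  dominant m -> reach m v -> (size v <= N)%N /\ all (mem Z) v.
Proof.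
have [[m1 [v1 [x1 [Q1 [S1 [[wit1 mu1] mo1 v10 x11 x12]]]]]]|none] :=
  pselect (exists m v, reach m v); last first.
  by exists 0%N, [::] => m v _ r; case: none; exists m, v.
have [T0 T0P] := top_mult_support v1 wit1.
pose T := undup [seq y <- T0 | y != 0].
have Tnz y : y \in T -> y != 0 by rewrite mem_undup mem_filter => /andP[].
pose U := top_mult Q1 S1 v1.
pose G s : int := pairing c q T U s.
pose N : nat := (\sum_(s <- T) `|G s|)%N.
have GN s : s \in T -> G s <= N%:Z.
  move=> sT; apply: (@le_trans _ _ `|G s|%N%:Z); first by lia.
  by rewrite lez_nat /N (big_rem s) //= leq_addr.
(* The gauge around any point bounds the number of factors lowered there. *)
have key m v s : dominant m -> reach m v -> s != 0 ->
    \sum_(x <- v) gauge c q s x.2 <= G s.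
  move=> dm [x [Q [S [[wit mu] mo v0 xl xc]]]] s0.
  have E := top_mult_eq wit v0 xl xc wit1 v10 x11 x12.
  pose X := undup (T ++ flatten [seq [seq y <- A_points c q z | y != 0] | z <- v]).
  have Xnz y : y \in X -> y != 0.
    rewrite mem_undup mem_cat => /orP[/Tnz//|/flatten_mapP[z _]].
    by rewrite mem_filter => /andP[].
  have -> : G s = pairing c q X U s.
    apply/esym/pairing_support; rewrite ?undup_uniq //.
      by move=> y yT; rewrite mem_undup mem_cat yT.
    move=> i y yX yT; apply/eqP; apply: contraR yT => /T0P yT.
    by rewrite mem_undup mem_filter (Xnz _ yX).
  rewrite (eq_pairing _ _ (u' := fun i y => QS_mult Q S i y + \sum_(z <- v) A_exp c q z i y)); last first.
    by move=> i y /Xnz y0; rewrite /U -E.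
  rewrite pairingD pairing_sum ler_wpDl //.
    apply: sumr_ge0 => i _; rewrite big_seq; apply: sumr_ge0 => y /Xnz y0.
    apply: mulr_ge0; last exact: gauge_ge0.
    have a0 : y^-1 != 0 by rewrite invr_neq0.
    by have := dm i (exist _ y^-1 a0); rewrite mu /= invrK.
  rewrite big_seq [X in _ <= X]big_seq; apply: ler_sum => z zv.
  have z0 : z.2 != 0 by apply: (allP v0).
  apply: pairing_A_ge => //; first exact: undup_uniq.
  move=> y yz; rewrite mem_undup mem_cat; apply/orP; right.
  apply/flatten_mapP; exists z => //; rewrite mem_filter yz andbT.
  move/flatten_mapP: yz => [i _ /mapP[k _ ->]].
  by rewrite mulf_neq0 ?q1z_neq0.
(* Every lowered point is on the string of a point where [U] is nonzero. *)
have string m v x : dominant m -> reach m v -> x \in v ->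
    exists2 s, s \in T & exists2 k : int, x.2 = q1 ^ k * s & (`|k| <= N)%N.
  move=> dm r xv.
  have x0 : x.2 != 0 by case: r => [? [? [? [_ _ v0 _ _]]]]; apply: (allP v0).
  have [s sT [k xs]] : exists2 s, s \in T & exists k : int, s = q1 ^ k * x.2.
    apply: contrapT => none; have := key m v x.2 dm r x0.
    rewrite (_ : G x.2 = 0) => [|].
      rewrite (big_rem x) //= gauge_self //.
      have : 0 <= \sum_(y <- rem x v) gauge c q x.2 y.2.
        by apply: sumr_ge0 => y _; apply: gauge_ge0.
      by move: (\sum_(y <- _) _) => t; lia.
    rewrite /G /pairing big1 // => i _; rewrite big_seq big1 // => y yT.
    rewrite gauge_out ?mulr0 // => -[k yk]; apply: none; exists y => //.
    by exists k.
  have xs' : x.2 = q1 ^ (- k) * s by rewrite xs mulrA -q1zD addNr expr0z mul1r.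
  exists s => //; exists (- k) => //.
  have := key m v s dm r (Tnz s sT); rewrite (big_rem x) //= {1}xs' gauge_string ?Tnz //.
  have : 0 <= \sum_(y <- rem x v) gauge c q s y.2.
    by apply: sumr_ge0 => y _; apply: gauge_ge0.
  have := GN s sT.
  have : (`|(- k)%R| < theta c ^ `|(- k)%R|)%N by apply: ltn_expl.
  by move: (theta c ^ _)%N (\sum_(y <- _) _) (G s) => *; lia.
exists (\sum_(s <- T) N)%N, (flatten [seq [seq (i, q1 ^ k * s) | s <- T,
    k <- [seq j%:Z - N%:Z | j <- iota 0 (2 * N).+1]] | i <- enum 'I_n]) => m v dm r.
have v0 : all (fun x => x.2 != 0) v by case: r => [? [? [? [_ _ v0 _ _]]]].
split; last first.
  apply/allP => -[i z] xv; have [s sT [k zk kN]] := string m v _ dm r xv.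
  apply/flatten_mapP; exists i; first by rewrite mem_enum.
  apply/allpairsPdep; exists s, k; split => //; last by rewrite -zk.
  apply/mapP; exists `|(k + N%:Z)%R|%N; last by lia.
  by rewrite mem_iota; lia.
have : \sum_(x <- v) (1 : int) <= \sum_(s <- T) N%:Z.
  apply: (@le_trans _ _ (\sum_(x <- v) \sum_(s <- T) gauge c q s x.2)); last first.
    rewrite exchange_big /= big_seq [X in _ <= X]big_seq; apply: ler_sum => s sT.
    exact: le_trans (key m v s dm r (Tnz s sT)) (GN s sT).
  rewrite big_seq [X in _ <= X]big_seq; apply: ler_sum => x xv.
  have [s sT [k xk _]] := string m v x dm r xv.
  rewrite (big_rem s) //= xk gauge_string ?Tnz //.
  have : 0 <= \sum_(y <- rem s T) gauge c q y (q1 ^ k * s).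
    by apply: sumr_ge0 => y _; apply: gauge_ge0.
  have : (0 < theta c ^ `|k|)%N by rewrite expn_gt0.
  by move: (theta c ^ _)%N (\sum_(y <- _) _) => *; lia.
have -> : \sum_(x <- v) (1 : int) = (size v)%:Z.
  by rewrite -sum1_size (big_morph Posz PoszD (erefl 0%:Z)).
by rewrite -(big_morph Posz PoszD (erefl 0%:Z)) lez_nat.
Qed.

Lemma lowered_monomials_finite :
  finite_set [set m | dominant m /\ exists v, reach m v].
Proof.
have [N [Z NZ]] := lowered_monomial_bound.
have [[m0 _]|none] := pselect (exists m, dominant m /\ exists v, reach m v); last first.
  rewrite (_ : [set m | _] = set0); first exact: finite_set0.
  by apply/seteqP; split => // m hm; case: none; exists m.
pose f v := xget m0 [set m | reach m v].
apply: sub_finite_set (finite_image f (finite_bounded_seqs Z N)).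
move=> m [dm [v r]]; exists v; first exact: NZ dm r.
rewrite /f; case: xgetP => [m' _ r'|/(_ m)//].
exact: lowered_monomial_inj r' r.
Qed.

End FixedCharacter.
End DominantFinite.

(** * Lowering a vector at a pole *)

(** Localized at one point of the spectral line, the raising and lowering
    currents behave like fermions: [X k] and [E k] are their Taylor modes, and
    [Psi] anticommutes with [X] up to modes of higher order. A pole of order
    [e] therefore allows exactly the product of the first [e] modes. *)
Section Fermions.
Variables (K : fieldType) (V : lmodType K).
Variables (X E Psi : nat -> {linear V -> V}) (G : set V) (M : nat) (b Q : K).
Hypothesis bQ : b * (Q - 1) != 0.
Hypothesis EX : forall a k w, E a (X k w) = X k (E a w) + Psi (a + k)%N w.
Hypothesis PsiX : forall a k w,
  Q *: Psi a (X k.+1 w + b *: X k w) - (Psi a.+1 (X k w) + b *: Psi a (X k w)) =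
  (X k.+1 (Psi a w) + b *: X k (Psi a w)) - Q *: X k (Psi a.+1 w + b *: Psi a w).
Hypothesis GX : forall k w, G w -> G (X k w).
Hypothesis X_high : forall k w, (M <= k)%N -> G w -> X k w = 0.
Hypothesis Psi_high : forall a w, (M <= a)%N -> G w -> Psi a w = 0.
Variables (u : V) (rho : nat -> K) (e : nat).
Hypothesis Gu : G u.
Hypothesis u0 : u <> 0.
Hypothesis Eu : forall a, E a u = 0.
Hypothesis Psiu : forall a, Psi a u = rho a *: u.
Hypothesis rho_high : forall a, (e <= a)%N -> rho a = 0.
Hypothesis rho_top : rho e.-1 != 0.

Definition fword (s : seq nat) : V := foldr (fun k w => X k w) u s.

Lemma fword_G s : G (fword s).
Proof. by elim: s => //= k s; apply: GX. Qed.

Lemma PsiX_solve a k w : (b * (Q - 1)) *: Psi a (X k w) =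
  - (b * (Q - 1)) *: X k (Psi a w) + (X k.+1 (Psi a w) - Q *: X k (Psi a.+1 w)) -
  (Q *: Psi a (X k.+1 w) - Psi a.+1 (X k w)).
Proof.
have h := PsiX a k w.
rewrite (linearD (Psi a)) (linearD (X k)) (linearZ_LR (Psi a)) (linearZ_LR (X k)) in h.
rewrite !scalerDr !scalerA !opprD !(addrACA _ (_ *: _)) -!scalerBl in h.
have e1 : Q * b - b = b * (Q - 1) by ring.
have e2 : b - Q * b = - (b * (Q - 1)) by ring.
move: h; rewrite e1 e2.
move: (Q *: Psi a _ - _) (Psi a (X k w)) (X k.+1 _ - _) (X k (Psi a w)) => A B D F h.
by rewrite [- _ *: F + D]addrC -h addrAC subrr add0r.
Qed.

Lemma in_solved Z a k w : subspace Z -> Z (X k (Psi a w)) -> Z (X k.+1 (Psi a w)) ->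
  Z (X k (Psi a.+1 w)) -> Z (Psi a (X k.+1 w)) -> Z (Psi a.+1 (X k w)) ->
  Z (Psi a (X k w)).
Proof.
move=> sZ z1 z2 z3 z4 z5; have := PsiX_solve a k w.
move/(congr1 (fun v => (b * (Q - 1))^-1 *: v)); rewrite scalerA mulVf // scale1r => ->.
apply: subspace_scale => //; apply: subspace_sub => //; last first.
  by apply: subspace_sub => //; apply: subspace_scale.
apply: subspace_add => //; first exact: subspace_scale.
by apply: subspace_sub => //; apply: subspace_scale.
Qed.

Lemma Psi_word_high s a : (e <= a)%N -> Psi a (fword s) = 0.
Proof.
elim: s a => [|k s IH] a ea /=; first by rewrite Psiu rho_high ?scale0r.
have [N] : exists N, (2 * M <= a + k + N)%N by exists (2 * M)%N; rewrite leq_addl.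
elim: N a k ea => [|N IHN] a k ea aN.
  have [Ma|aM] := leqP M a; first by rewrite Psi_high //; apply/GX/fword_G.
  by rewrite X_high ?linear0 //; [lia | apply: fword_G].
have ea' : (e <= a.+1)%N by apply: leqW.
apply: (in_solved (Z := [set 0])) => /=; rewrite ?IH ?linear0 //.
- exact: subspace0.
- by apply: IHN => //; lia.
- by apply: IHN => //; lia.
Qed.

Lemma E_word_high s j : all (fun k => (e <= j + k)%N) s -> E j (fword s) = 0.
Proof.
elim: s => [|k s IH] /=; first by rewrite Eu.
by case/andP=> ek es; rewrite EX IH // linear0 add0r Psi_word_high.
Qed.

(** [t] dominates [s] entrywise and differs from it. *)
Definition above (s t : seq nat) := all2 leq s t && (s != t).

Lemma all2_leq_refl s : all2 leq s s.
Proof. by elim: s => //= k s ->; rewrite leqnn. Qed.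

Lemma above_cons k s t : above s t -> above (k :: s) (k :: t).
Proof.
by case/andP=> st ne; rewrite /above /= leqnn st /= eqseq_cons eqxx.
Qed.

Lemma above_succ k s t : all2 leq s t -> above (k :: s) (k.+1 :: t).
Proof.
move=> st; rewrite /above /= leqnSn st /=.
by rewrite eqseq_cons negb_and neq_ltn leqnn.
Qed.

Lemma above_succ_head k s t : above (k.+1 :: s) t -> above (k :: s) t.
Proof.
case: t => // l t; rewrite /above /= => /andP[/andP[kl st] _].
rewrite (ltnW kl) st /= eqseq_cons negb_and neq_ltn.
by rewrite (leq_trans (ltnSn k)) ?kl.
Qed.

(** The top mode of [Psi] acts on words by a sign, up to higher words. *)
Lemma Psi_word_top s (Z : set V) : subspace Z ->
  (forall t, above s t -> Z (fword t)) ->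
  Z (Psi e.-1 (fword s) - ((-1) ^+ size s * rho e.-1) *: fword s).
Proof.
elim: s Z => [|k s IH] Z sZ HZ /=.
  by rewrite Psiu mul1r subrr; case: sZ.
have e0 : (0 < e)%N.
  by rewrite lt0n; apply: contraNneq rho_top => e0; rewrite e0 /= rho_high // e0.
have lin (l : nat) : subspace [set w | Z (X l w)].
  case: sZ => Z0 ZL; split=> /=; first by rewrite linear0.
  by move=> a v w Zv Zw; rewrite linearP; apply: ZL.
set sg := (-1) ^+ size s * rho e.-1.
have nsg : (-1) ^+ (size s).+1 * rho e.-1 = - sg by rewrite exprS mulN1r mulNr.
have [N] : exists N, (M <= k + N)%N by exists M; rewrite leq_addl.
elim: N k Z sZ HZ lin => [|N IHN] k Z sZ HZ lin kN.
  rewrite addn0 in kN; have -> := X_high kN (fword_G s).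
  by rewrite linear0 scaler0 subr0; case: sZ.
rewrite nsg scaleNr opprK.
have h1 : Z (X k (Psi e.-1 (fword s) - sg *: fword s)).
  by apply: (IH _ (lin k)) => t st; apply: HZ (k :: t) _; apply: above_cons.
have Zk1 t : all2 leq s t -> Z (X k.+1 (fword t)).
  by move=> st; apply: HZ (k.+1 :: t) _; apply: above_succ.
have h2 : Z (X k.+1 (Psi e.-1 (fword s))).
  have -> : X k.+1 (Psi e.-1 (fword s)) =
      X k.+1 (Psi e.-1 (fword s) - sg *: fword s) + sg *: X k.+1 (fword s).
    by rewrite -(linearZ_LR (X k.+1)) -(linearD (X k.+1)) subrK.
  apply: subspace_add => //.
    by apply: (IH _ (lin k.+1)) => t /andP[st _]; apply: Zk1.
  by apply: subspace_scale => //; apply/Zk1/all2_leq_refl.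
have h3 : Z (Psi e.-1 (X k.+1 (fword s))).
  have := IHN k.+1 Z sZ _ lin; rewrite addSnnS => /(_ _ kN) h.
  rewrite -(subrK (((-1) ^+ (size s).+1 * rho e.-1) *: X k.+1 (fword s)) (Psi _ _)).
  apply: subspace_add => //.
    by apply: h => t /above_succ_head; apply: HZ.
  by apply: subspace_scale => //; apply/Zk1/all2_leq_refl.
have ee : (e <= e.-1.+1)%N by rewrite prednK.
have P0 := Psi_word_high s ee; have P1 := Psi_word_high (k :: s) ee.
have := PsiX_solve e.-1 k (fword s); rewrite P0 linear0 scaler0 subr0.
rewrite [X in _ - (_ - X)](P1 : Psi _ (X k (fword s)) = 0) subr0.
move/(congr1 (fun v => (b * (Q - 1))^-1 *: v)).
rewrite scalerA mulVf // scale1r => ->; set beta := b * (Q - 1).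
have -> : beta^-1 *: (- beta *: X k (Psi e.-1 (fword s)) +
      X k.+1 (Psi e.-1 (fword s)) - Q *: Psi e.-1 (X k.+1 (fword s))) +
      sg *: X k (fword s) =
    - X k (Psi e.-1 (fword s) - sg *: fword s) +
    beta^-1 *: (X k.+1 (Psi e.-1 (fword s)) - Q *: Psi e.-1 (X k.+1 (fword s))).
  rewrite (linearB (X k)) (linearZ_LR (X k)) -addrA scalerDr scalerA mulrN mulVf //.
  by rewrite scaleN1r opprB addrAC; congr (_ + _); rewrite addrC.
apply: subspace_add => //; first exact: subspace_opp.
by apply: subspace_scale => //; apply: subspace_sub => //; apply: subspace_scale.
Qed.

Fixpoint raise_all (j : nat) (w : V) : V :=
  if j is j'.+1 then raise_all j' (E j' w) else w.

Lemma raise_all_linear j : linear (raise_all j).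
Proof. by elim: j => // j IH a v w /=; rewrite linearP IH. Qed.

Lemma raise_all0 j : raise_all j 0 = 0.
Proof. by elim: j => //= j IH; rewrite linear0. Qed.

Lemma raise_word j : (j <= e)%N ->
  (exists2 kappa, kappa != 0 & raise_all j (fword (iota (e - j) j)) = kappa *: u) /\
  forall t, above (iota (e - j) j) t -> raise_all j (fword t) = 0.
Proof.
elim: j => [|j IH] je.
  by split; [exists 1; rewrite ?oner_neq0 //= scale1r | case].
have [[kappa k0 kE] zero] := IH (ltnW je).
have iotaS : iota (e - j.+1) j.+1 = (e - j.+1)%N :: iota (e - j) j by rewrite /= subnSK.
have high t : all2 leq (iota (e - j) j) t -> all (fun k => (e <= j + k)%N) t.
  have : all (fun k => (e <= j + k)%N) (iota (e - j) j).
    by apply/allP => k; rewrite mem_iota; lia.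
  elim: (iota _ _) t => [|k s IHs] [|l t] //= /andP[ek es] /andP[kl st].
  by rewrite (leq_trans ek) ?leq_add2l //= IHs.
have sZ : subspace [set w | raise_all j w = 0].
  split=> [|a v w v0 w0] /=; first exact: raise_all0.
  rewrite raise_all_linear v0 w0.
  by rewrite scaler0 addr0.
have step k t : all2 leq (iota (e - j) j) t ->
    raise_all j.+1 (fword (k :: t)) = raise_all j (Psi (j + k) (fword t)).
  by move=> /high ht; rewrite /= EX E_word_high // linear0 add0r.
have trans s t t' : all2 leq s t -> above t t' -> above s t'.
  move=> st /andP[tt' ne]; apply/andP; split.
    elim: s t t' st tt' {ne} => [|x s IHs] [|y t] [|z t'] //= /andP[xy st] /andP[yz tt'].
    by rewrite (leq_trans xy yz) (IHs t t').
  apply: contra ne => /eqP e'; move: st tt'; rewrite e'.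
  elim: t t' {e'} => [|y t IHt] [|z t'] //= /andP[zy st] /andP[yz tt'].
  by rewrite eqseq_cons eqn_leq zy yz /= IHt.
have top t : all2 leq (iota (e - j) j) t ->
    raise_all j (Psi e.-1 (fword t)) =
    ((-1) ^+ size t * rho e.-1) *: raise_all j (fword t).
  move=> ht; have := Psi_word_top sZ (fun t' tt' => zero t' (trans _ _ _ ht tt')).
  rewrite /= addrC -scaleNr raise_all_linear scaleNr addrC => /eqP.
  by rewrite subr_eq0 => /eqP.
have je1 : (j + (e - j.+1) = e.-1)%N by lia.
rewrite iotaS; split.
  exists ((-1) ^+ size (iota (e - j) j) * rho e.-1 * kappa).
    by rewrite !mulf_neq0 ?signr_eq0.
  by rewrite step ?all2_leq_refl // je1 top ?all2_leq_refl // kE scalerA.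
case=> // k t /andP[/= /andP[kl st] ne].
rewrite -[LHS]/(raise_all j.+1 (fword (k :: t))) step //.
have [ke|ke] := eqVneq k (e - j.+1)%N; last first.
  by rewrite Psi_word_high; [case: sZ | lia].
rewrite ke je1 top //; move: ne; rewrite ke eqseq_cons eqxx /= => ne.
by rewrite zero ?scaler0 // /above st.
Qed.

Lemma fword_top_neq0 : fword (iota 0 e) <> 0.
Proof.
have [[kappa k0]] := raise_word (leqnn e); rewrite subnn => kE _ w0.
move: kE; rewrite w0 raise_all0 => /esym/eqP.
rewrite scaler_eq0 (negPf k0) => /eqP; exact: u0.
Qed.

End Fermions.

Lemma relation_cancel (K : fieldType) (V : lmodType K) (a : K) (U1 U2 U3 U4 P P' : V) :
  2%:R != 0 :> K -> U1 - a *: U2 = a *: U3 - U4 ->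
  (U1 + P) - a *: (U2 + P') = a *: (U3 + P') - (U4 + P) -> P = a *: P'.
Proof.
move=> two0 e; rewrite !scalerDr !opprD !(addrACA _ P) (addrACA (a *: U3)) e => /addrI.
move/eqP; rewrite subr_eq addrAC eq_sym subr_eq eq_sym -!mulr2n -!scaler_nat => /eqP.
exact: scalerI.
Qed.

Lemma convBg (K : comNzRingType) (V : lmodType K) (p : {poly K}) (g g' : int -> V) r :
  conv p (fun k => g k - g' k) r = conv p g r - conv p g' r.
Proof.
rewrite convDg; congr (_ + _); rewrite -scaleN1r -convZg.
by apply: eq_conv => k; rewrite scaleN1r.
Qed.

Section Currents.
Variables (K : closedFieldType) (V : lmodType K).
Variables (Xp Xm Ps : int -> {linear V -> V}) (Q : K).
Hypothesis two0 : 2%:R != 0 :> K.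
Hypothesis Q0 : Q != 0.
Hypothesis XpXm : forall r s w, Xp r (Xm s w) = Xm s (Xp r w) + Ps (r + s) w.
Hypothesis XmXm : forall r s w,
  Xm (r + 1) (Xm s w) - Q^-1 *: Xm r (Xm (s + 1) w) =
  Q^-1 *: Xm s (Xm (r + 1) w) - Xm (s + 1) (Xm r w).

(** The commutator of the quadratic relation with a raising operator. *)
Lemma Ps_Xm a s w : Q *: Ps (a + 1) (Xm s w) + Q *: Xm (s + 1) (Ps a w) =
  Ps a (Xm (s + 1) w) + Xm s (Ps (a + 1) w).
Proof.
have XXX p r t : Xp p (Xm r (Xm t w)) =
    Xm r (Xm t (Xp p w)) + (Ps (p + r) (Xm t w) + Xm r (Ps (p + t) w)).
  by rewrite XpXm XpXm linearD -addrA; congr (_ + _); rewrite addrC.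
have := congr1 (Xp (a - s)) (XmXm s s w).
rewrite !(linearB (Xp _)) !(linearZ_LR (Xp _)) !XXX.
have -> : a - s + (s + 1) = a + 1 by rewrite addrA subrK.
rewrite subrK.
move/(relation_cancel two0 (XmXm s s (Xp (a - s) w))) => e.
by rewrite -scalerDr e scalerA mulfV // scale1r.
Qed.

Lemma Xp_Xm_currents f h r s w : current Xp f r (current Xm h s w) =
  current Xm h s (current Xp f r w) + current Ps (f * h) (r + s) w.
Proof.
have step k : Xp k (current Xm h s w) =
    current Xm h s (Xp k w) + conv h (fun j => Ps j w) (s + k).
  rewrite /current conv_linear -conv_shift -convDg; apply: eq_conv => j /=.
  by rewrite XpXm [(k + j)%R]addrC.
rewrite {1}/current (eq_conv _ _ step) convDg; congr (_ + _).
  exact: esym (conv_linear (current Xm h s) f (fun k => Xp k w) r).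
by rewrite /current convM -conv_shift; apply: eq_conv => k; rewrite addrC.
Qed.

Lemma Ps_Xm_currents f h r s w :
  Q *: current Ps f r (current Xm h (s - 1) w) - current Ps f (r - 1) (current Xm h s w) =
  current Xm h (s - 1) (current Ps f r w) - Q *: current Xm h s (current Ps f (r - 1) w).
Proof.
have swap (g : int -> int -> V) p p' t t' :
    conv p (fun k => conv p' (g k) t') t = conv p' (fun j => conv p (g^~ j) t) t'.
  rewrite /conv; under eq_bigr => k _ do rewrite scaler_sumr.
  rewrite exchange_big /=; apply: eq_bigr => j _; rewrite scaler_sumr.
  by apply: eq_bigr => k _; rewrite !scalerA mulrC.
have PsXm t t' : current Ps f (r + t) (current Xm h (s + t') w) =
    conv f (fun k => conv h (fun j => Ps (k + t) (Xm (j + t') w)) s) r.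
  rewrite /current -conv_shift; apply: eq_conv => k.
  by rewrite conv_linear -conv_shift.
have XmPs t t' : current Xm h (s + t') (current Ps f (r + t) w) =
    conv f (fun k => conv h (fun j => Xm (j + t') (Ps (k + t) w)) s) r.
  rewrite swap /current -(conv_shift h _ s t'); apply: eq_conv => k.
  by rewrite conv_linear -conv_shift.
have := PsXm 0 (-1); have := PsXm (-1) 0; have := XmPs 0 (-1); have := XmPs (-1) 0.
rewrite !addr0 => -> -> -> ->; rewrite -!convZg -!convBg.
apply: eq_conv => k; rewrite -!convZg -!convBg.
apply: eq_conv => j.
rewrite !addr0; have := Ps_Xm (k - 1) (j - 1) w; rewrite !subrK => h'.
apply/eqP; rewrite subr_eq addrAC eq_sym subr_eq eq_sym h'.
by rewrite addrC.
Qed.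
Variable G : set V.
Hypothesis GXp : forall f r w, G w -> G (current Xp f r w).
Hypothesis GXm : forall f r w, G w -> G (current Xm f r w).
Variable P : {poly K}.
Hypothesis PXm : forall r w, G w -> current Xm P r w = 0.

Lemma current_mull (X : int -> {linear V -> V}) f h r w :
  (forall k, current X h k w = 0) -> current X (f * h) r w = 0.
Proof.
by move=> h0; rewrite /current convM -[RHS](conv_0g V f r); apply: eq_conv.
Qed.

Lemma Ps_annihilated f r w : G w -> current Ps (f * P) r w = 0.
Proof.
move=> Gw; have := Xp_Xm_currents f P r 0 w.
by rewrite !PXm ?linear0 // ?add0r ?addr0; [move/esym | apply: GXp].
Qed.

(** Lowering at a pole: if the scalars [gam] of [Ps] on a vector [u] killed by
    [g] times the raising current have a pole of order [e] at [b], then [e]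
    lowering operators, whose currents are cut down to be supported at [b],
    can be applied to [u] with a nonzero result. *)
Lemma pole_word p M b g u (gam : int -> K^o) e (L := 'X - b%:P) :
  P = p * L ^+ M -> b != 0 -> Q != 1 -> G u -> u <> 0 ->
  (forall r, current Xp g r u = 0) -> (forall r, Ps r u = gam r *: u) ->
  (0 < e)%N -> (forall r, conv (g * p * L ^+ e) gam r = 0) ->
  conv (g * p * L ^+ e.-1) gam 0 != 0 ->
  exists2 w, w <> 0 & forall D : nat -> set V, D 0%N u ->
    (forall j k v, D j v -> D j.+1 (current Xm (p * L ^+ k) 0 v)) -> D e w.
Proof.
move=> PE b0 Q1 Gu u0 gu Psu e0 high top.
pose X k : {linear V -> V} := current Xm (p * L ^+ k) 0.
pose E a : {linear V -> V} := current Xp (g * L ^+ a) 0.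
pose Psi a : {linear V -> V} := current Ps (g * p * L ^+ a) 0.
pose rho a : K := conv (g * p * L ^+ a) gam 0.
have minus1 (Y : int -> {linear V -> V}) f k v :
    current Y (f * L ^+ k.+1) 0 v + b *: current Y (f * L ^+ k) 0 v =
    current Y (f * L ^+ k) (0 - 1) v.
  rewrite -[in LHS]currentZp /current -convDp -convMX; congr (conv _ _ _).
  by rewrite /L exprSr -mul_polyC; ring.
have PsP a v : (M <= a)%N -> G v -> Psi a v = 0.
  move=> Ma Gv; rewrite /Psi -(subnK Ma) exprD.
  have -> : g * p * (L ^+ (a - M) * L ^+ M) = g * L ^+ (a - M) * P by rewrite PE; ring.
  exact: Ps_annihilated.
exists (fword X u (iota 0 e)).
  apply: (@fword_top_neq0 _ _ X E Psi G M b Q _ _ _ _ _ _ u rho e) => //.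
  - by rewrite mulf_neq0 // subr_eq0.
  - move=> a k w; rewrite /E /X /Psi /= Xp_Xm_currents addr0; congr (_ + _).
    by congr (current _ _ _ _); rewrite exprD; ring.
  - by move=> a k w; rewrite /E /X /Psi /= !minus1 Ps_Xm_currents.
  - by move=> k w; apply: GXm.
  - move=> k w Mk Gw; rewrite /X -(subnK Mk) exprD mulrCA -PE.
    by apply: current_mull => r; apply: PXm.
  - by move=> a; rewrite /E /= mulrC; apply: current_mull.
  - move=> a; rewrite /Psi /rho /= /current (eq_conv _ _ Psu).
    by rewrite /conv scaler_suml; apply: eq_bigr => j _; rewrite scalerA.
  - move=> a ea; rewrite /rho -(subnK ea) exprD mulrCA convM.
    by rewrite (eq_conv _ _ high) conv_0g.
move=> D D0 DS; have : forall s, D (size s) (fword X u s).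
  by elim=> //= k s; apply: DS.
by move/(_ (iota 0 e)); rewrite size_iota.
Qed.
End Currents.

(** * Expansions of a rational function at zero and at infinity *)

Section Expansions.
Variable K : closedFieldType.
Implicit Types (f p P N : {poly K}) (g : int -> K^o).

Lemma conv_inj_low p g (m : int) : p`_0 != 0 -> (forall r, r < m -> g r = 0) ->
  (forall r, conv p g r = 0) -> forall r, g r = 0.
Proof.
move=> p0 g0 pg r.
have [k] : exists k : nat, r < m + k%:Z by exists `|r - m|.+1%N; lia.
elim: k r => [|k IH] r rk; first by apply: g0; rewrite addr0 in rk.
have [/IH->//|rk'] := ltP r (m + k%:Z).
have := pg r; rewrite (@convE _ _ (size p).+1) // big_ord_recl subr0 /= big1 ?addr0.
  by move/eqP; rewrite scaler_eq0 (negPf p0) => /eqP.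
by move=> j _; rewrite IH ?scaler0 //= /bump /=; lia.
Qed.

Lemma conv_inj_high p g (m : int) : p != 0 -> (forall r, m < r -> g r = 0) ->
  (forall r, conv p g r = 0) -> forall r, g r = 0.
Proof.
move=> p0 g0 pg r.
have [k] : exists k : nat, m < r + k%:Z by exists `|r - m|.+1%N; lia.
elim: k r => [|k IH] r rk; first by apply: g0; rewrite addr0 in rk.
have [/IH->//|rk'] := ltP m (r + k%:Z).
have sp : (0 < size p)%N by rewrite size_poly_gt0.
have := pg (r + (size p).-1%:Z); rewrite (@convE _ _ (size p).-1.+1); last by rewrite prednK.
rewrite big_ord_recr /= addrK big1 ?add0r.
  by move/eqP; rewrite scaler_eq0 -/(lead_coef p) lead_coef_eq0 (negPf p0) => /eqP.
by move=> j _; rewrite IH ?scaler0 //=; have := ltn_ord j; lia.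
Qed.

Lemma conv_low p g : (forall r, r < 0 -> g r = 0) -> forall r, r < 0 -> conv p g r = 0.
Proof.
move=> g0 r r0; rewrite /conv big1 // => k _; rewrite g0 ?scaler0 //.
by apply: le_lt_trans r0; rewrite gerBl.
Qed.

Lemma conv_high p g : (forall r, 0 < r -> g r = 0) ->
  forall r, (size p)%:Z <= r -> conv p g r = 0.
Proof.
move=> g0 r r0; rewrite /conv big1 // => k _; rewrite g0 ?scaler0 //.
by rewrite subr_gt0; apply: lt_le_trans r0; rewrite ltz_nat.
Qed.

Section TwoExpansions.
Variables (fp fm : int -> K^o).
Hypothesis fp0 : forall r, r < 0 -> fp r = 0.
Hypothesis fm0 : forall r, 0 < r -> fm r = 0.

(** A polynomial equalizing an expansion at zero and one at infinity turns
    both into a polynomial. *)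
Lemma common_numerator f : conv f fp =1 conv f fm ->
  exists2 N, conv f fp =1 conv N (@delta0 K) & (size N <= size f)%N.
Proof.
move=> e; exists (\poly_(k < size f) conv f fp k%:Z); last exact: size_poly.
case=> k; last by rewrite (@conv_low f fp fp0) // conv_low // => r r0; rewrite /delta0 lt_eqF.
rewrite conv_delta0 coef_poly; case: ltnP => // fk.
by rewrite e (@conv_high f fm fm0).
Qed.

Lemma pole_order_le P N f b : N != 0 -> f != 0 ->
  conv P fp =1 conv N (@delta0 K) -> conv f fp =1 conv f fm ->
  (mup b P <= mup b f + mup b N)%N.
Proof.
move=> N0 f0 PN /common_numerator[N' fN' _].
have e : P * N' = f * N.
  apply: conv_delta0_inj => r; rewrite !convM -(eq_conv _ _ fN') -(eq_conv _ _ PN).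
  by rewrite -!convM mulrC.
have : P * N' != 0 by rewrite e mulf_neq0.
rewrite mulf_eq0 negb_or => /andP[P0 N'0].
by rewrite -mupM // -e mupM // leq_addr.
Qed.

End TwoExpansions.
End Expansions.

Section Chain.
Variables (R : realType) (n : nat) (c : cartan_datum n) (rl : realization c)
          (q : qparam R[i]).
Local Notation C := R[i].
Local Notation H := (car rl).
Local Notation B := (bmat c).
Local Notation q1 := (qpow q 1).
Local Notation hst := (hstar H).
Local Notation Y := ('I_n * {m : int | m != 0})%type.
Variable M : rep rl q.
Hypothesis tM : tame M.
Variables (i : 'I_n) (l0 : hst) (chi0 : Y -> C).

Definition psi_scalar (l : hst) (chi : Y -> C) (r : int) : C^o :=
  (qi c q i - (qi c q i)^-1)^-1 * (phz q l chi false i r - phz q l chi true i r).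

Lemma qi_sub_neq0 : qi c q i - (qi c q i)^-1 != 0.
Proof.
rewrite subr_eq0 qiE invr_expz; apply/eqP => /qpow1_int_inj.
by have := cr_gt0 c i; lia.
Qed.

Lemma bmat_diag_neq0 : B i i != 0.
Proof. by rewrite /bmat cmat_diag mulf_neq0 // eqz_nat -lt0n cr_gt0. Qed.

Lemma Psi_eigen l chi (u : M) r : wt l u -> (forall y, Hop M y u = chi y *: u) ->
  Psiop M i r u = psi_scalar l chi r *: u.
Proof.
move=> Hu Hchi; apply: etrans (piact_psi i r u) _.
have e b : piact (fphiz rl q b i r) u = phz q l chi b i r *: u.
  rewrite /fphiz /phz; case: ifP => _; last by rewrite piact0 scale0r.
  by rewrite piact_phi (phi_eigen Hu Hchi).
apply: etrans (congr2 (fun v w : M => _ *: (v - w)) (e false) (e true)) _.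
by rewrite /psi_scalar -scalerBl scalerA.
Qed.

Lemma wt_current e p r l (v : M) : wt l v ->
  wt (l + qsign e *: Defs.root rl i) (current (Xop M e i) p r v).
Proof.
move=> Hv; rewrite /current /conv; apply: subspace_sum; first exact: subspace_wt.
by move=> k _; apply: (subspace_scale _ (subspace_wt M _)); apply: wt_X.
Qed.

(** The string of weight spaces in direction [i]. *)
Definition string : set M :=
  [set w | exists k : int, wt (l0 + Defs.root rl i *~ k) w].

Lemma string_current e p r w : string w -> string (current (Xop M e i) p r w).
Proof.
move=> [k Hw]; exists (k + (-1) ^+ e); rewrite mulrzDr addrA.
have -> : Defs.root rl i *~ (-1) ^+ e = qsign e *: Defs.root rl i.
  by case: e {p r}; rewrite ?expr0 ?expr1 ?mulrN1z ?scaleN1r ?scale1r ?mulr1z.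
exact: wt_current.
Qed.

Lemma string_annihilator : exists2 P, ~~ root P 0 &
  forall r w, string w -> current (Xop M true i) P r w = 0.
Proof.
have [N HN] := tame_int tM l0 i.
suff [P P0 HP] : exists2 P, ~~ root P 0 & forall k : int, (`|k| < N)%N ->
    forall r w, wt (l0 + Defs.root rl i *~ k) w -> current (Xop M true i) P r w = 0.
  exists P => // r w [k Hw]; have [kN|kN] := ltnP `|k| N; first exact: (HP k).
  have [Hp Hm] := HN _ kN; suff -> : w = 0 by rewrite linear0.
  case: (intP k) kN Hp Hm Hw => [|m|m] kN Hp Hm Hw; [apply: Hp|apply: Hp|apply: Hm].
  - by rewrite mulr0n; move: Hw; rewrite mulr0z.
  - exact: Hw.
  - by move: Hw; rewrite abszN mulrNz.
elim: N {HN} => [|N [P P0 HP]]; first by exists 1; rewrite ?root1.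
have [p1 p10 H1] := Xm_annihilator (tame_fin tM) (l0 + Defs.root rl i *~ N%:Z) i.
have [p2 p20 H2] := Xm_annihilator (tame_fin tM) (l0 + Defs.root rl i *~ (- N%:Z)) i.
exists (P * p1 * p2); first by rewrite !rootM !negb_or P0 p10.
move=> k kN r w Hw; have [kN'|kN'] := ltnP `|k| N.
  rewrite -mulrA mulrC; apply: current_mull => r'; exact: (HP k).
have [kE|kE] : k = N%:Z \/ k = - N%:Z by lia.
  by rewrite mulrAC; apply: current_mull => r'; apply: H1; rewrite -kE.
by apply: current_mull => r'; apply: H2; rewrite -kE.
Qed.

Definition in_line (s : seq C) := [seq (i, z) | z <- s].
Local Notation lam s := (lowered l0 (in_line s)).
Local Notation ch s := (shiftv c q chi0 (in_line s)).

Lemma lowered_line s : lam s = l0 - Defs.root rl i *+ size s.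
Proof.
rewrite /lowered big_map; congr (_ - _); elim: s => [|z s IH]; first by rewrite big_nil.
by rewrite big_cons IH /= mulrS.
Qed.

Lemma string_line s w : wt (lam s) w -> string w.
Proof. by move=> Hw; exists (- (size s)%:Z); rewrite mulrNz -lowered_line. Qed.

(** An eigenvector obtained by lowering at the points of [s]; the raising
    current becomes zero on it after cutting down at these points only. *)
Record lowered_eigenvector (s : seq C) (g : {poly C}) (u : M) : Prop := LoweredEigenvector {
  le_neq0 : u <> 0;
  le_wt : wt (lam s) u;
  le_eigen : forall y, Hop M y u = ch s y *: u;
  le_raise : forall r, current (Xop M false i) g r u = 0;
  le_g : g != 0;
  le_roots : forall b, root g b -> b \in s;
  le_points : all (predC1 0) s
}.

Variables (P N : {poly C}).
Hypothesis P0 : P != 0.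
Hypothesis N0 : N != 0.
Hypothesis PN : conv P (phz q l0 chi0 false i) =1 conv N (@delta0 C).

Definition line_order (s : seq C) (b : C) : int :=
  ordp N P b + ordp (num_low c q i (in_line s)) (den_low c q i (in_line s)) b.

Lemma line_pole_le s f b : all (predC1 0) s -> f != 0 ->
  (forall r, conv f (psi_scalar (lam s) (ch s)) r = 0) ->
  - line_order s b <= (mup b f)%:Z.
Proof.
move=> s0 f0 fg; set vs := in_line s.
have vs0 : nonzero_points vs.
  by rewrite /nonzero_points all_map; apply: sub_all s0 => z.
pose a := \prod_(x <- vs) q1 ^ B i x.1.
have a0 : a != 0.
  by rewrite prodf_seq_neq0; apply/allP => x _; rewrite expfz_neq0 ?qpow_neq0.
have num0 := num_low_neq0 c q i vs; have den0 := den_low_neq0 c q i vs.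
have PN' : conv (P * den_low c q i vs) (phz q (lam s) (ch s) false i) =1
    conv (a *: (N * num_low c q i vs)) (@delta0 C).
  move=> r; rewrite convM (eq_conv _ _ (fun k => phz_low q l0 chi0 false i k vs0)).
  rewrite convZg convZp -convM [P * _]mulrC [N * _]mulrC !convM; congr (_ *: _).
  exact: eq_conv.
have fp0 (r : int) : r < 0 -> phz q (lam s) (ch s) false i r = 0.
  by move=> r0; rewrite /phz expr0 mul1r leNgt r0.
have fm0 (r : int) : 0 < r -> phz q (lam s) (ch s) true i r = 0.
  by move=> r0; rewrite /phz expr1 mulN1r oppr_ge0 leNgt r0.
have N'0 : a *: (N * num_low c q i vs) != 0.
  by rewrite scaler_eq0 negb_or a0 mulf_neq0.
have /(pole_order_le fp0 fm0 b N'0 f0 PN') :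
    conv f (phz q (lam s) (ch s) false i) =1 conv f (phz q (lam s) (ch s) true i).
  move=> r; have := fg r; rewrite convZg convBg => /eqP.
  by rewrite scaler_eq0 invr_eq0 (negPf qi_sub_neq0) subr_eq0 => /eqP.
rewrite mupZ // !mupM // /line_order /ordp -/vs.
move: (mup b P) (mup b N) (mup b _) (mup b _) (mup b f) => A1 A2 A3 A4 A5.
by clear; lia.
Qed.

Lemma line_eigen_gker s u : (forall y, Hop M y u = ch s y *: u) -> gker (Hop M) [:: ch s] u.
Proof. by move=> Hu y /=; rewrite Hu subrr. Qed.

Lemma lower_step s g u b : lowered_eigenvector s g u -> b != 0 -> b \notin s ->
  line_order s b < 0 -> exists e g' u',
  - line_order s b <= e%:Z /\ lowered_eigenvector (nseq e b ++ s) g' u'.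
Proof.
move=> [u0 Hu Hchi gu g0 groots s0] b0 bs ord0.
have [PX PX0 PXX] := string_annihilator.
have PXn0 : PX != 0 by apply: contraNneq PX0 => ->; rewrite root0.
have [p pb PXE] := mup_factor b PXn0.
set L := 'X - b%:P in PXE; set m := mup b PX in PXE.
have p0 : p != 0 by apply: contraNneq pb => ->; rewrite root0.
have L0 : L != 0 by rewrite polyXsubC_eq0.
pose gam := psi_scalar (lam s) (ch s).
have Psu r : Psiop M i r u = gam r *: u by apply: Psi_eigen.
have XpXm r t w : Xop M false i r (Xop M true i t w) =
    Xop M true i t (Xop M false i r w) + Psiop M i (r + t) w.
  by rewrite Xop_X eqxx scale1r.
have strX f r w : string w -> string (current (Xop M false i) f r w).
  exact: string_current.
have strY f r w : string w -> string (current (Xop M true i) f r w).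
  exact: string_current.
have Gu : string u := string_line Hu.
pose P_ a := `[< forall r, conv (g * p * L ^+ a) gam r = 0 >].
have exP : exists a, P_ a.
  exists m; apply/asboolP => r; rewrite -mulrA -PXE.
  have : current (Psiop M i) (g * PX) r u = 0.
    exact: (Ps_annihilated XpXm strX PXX).
  rewrite /current (eq_conv _ _ Psu) /conv.
  under eq_bigr => j _ do rewrite scalerA.
  by rewrite -scaler_suml => /eqP; rewrite scaler_eq0 (introF eqP u0) orbF => /eqP.
case: (ex_minnP exP) => e /asboolP high emin.
have f0 a : g * p * L ^+ a != 0 by rewrite !mulf_neq0 ?expf_neq0.
have le_e : - line_order s b <= e%:Z.
  have := line_pole_le b s0 (f0 e) high; rewrite !mupM ?mulf_neq0 ?expf_neq0 //.
  rewrite (mupNroot pb) (mupNroot (contraNN (@groots b) bs)).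
  by rewrite mup_XsubCX eqxx.
have e0 : (0 < e)%N.
  rewrite -ltz_nat; apply: lt_le_trans le_e; rewrite oppr_gt0; exact: ord0.
have top : conv (g * p * L ^+ e.-1) gam 0 != 0.
  apply/eqP => h0; have : P_ e.-1.
    pose h := conv (g * p * L ^+ e.-1) gam.
    have rec r : h (r - 1) = b *: h r.
      apply/eqP; rewrite -subr_eq0 -conv_XsubC -/L /h -convM.
      have -> : L * (g * p * L ^+ e.-1) = g * p * L ^+ e.
        by rewrite -[in RHS](prednK e0) exprS; ring.
      by rewrite high.
    apply/asboolP => r; rewrite -/(h r).
    elim/int_rec: r => [//|k IH|k IH].
      have := rec k.+1%:Z; rewrite intS addrAC subrr add0r IH => /esym/eqP.
      by rewrite scaler_eq0 (negPf b0) => /eqP.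
    have <- : h (- k%:Z - 1) = 0 by rewrite rec IH scaler0.
    by congr h; rewrite -opprD intS addrC.
  by move=> /emin; rewrite leqNgt ltn_predL e0.
have Q1 : qpow q (B i i)%:~R != 1.
  by rewrite -qpow1_int -(expr0z q1) (inj_eq (@qpow1_int_inj R q)) bmat_diag_neq0.
have two0 : 2%:R != 0 :> C by rewrite pnatr_eq0.
have [w w0 Dw] := pole_word two0 (qpow_neq0 q _) XpXm (@Xop_xx _ _ _ _ _ M i)
  strX strY PXX PXE b0 Q1 Gu u0 gu Psu e0 high top.
pose g' := g * L ^+ m.
pose sj j := nseq j b ++ s.
pose D j := [set v : M | [/\ wt (lam (sj j)) v,
  exists2 S, gker (Hop M) S v & forall chi, chi \in S -> chi = ch (sj j)
  & forall r, current (Xop M false i) g' r v = 0]].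
have [||Hw [S Sw HS] gw] := Dw D.
- split=> //; first by exists [:: ch s]; [exact: line_eigen_gker | move=> chi; rewrite inE => /eqP].
  by move=> r; rewrite /g' mulrC; apply: current_mull.
- move=> j k v [Hv [S Sv HS] gv]; split.
  + have -> : lam (sj j.+1) = lam (sj j) + qsign true *: Defs.root rl i.
      by rewrite !lowered_line /= expr1 scaleN1r mulrSr opprD addrA.
    exact: wt_current.
  + exists [seq shift_char hdeg (h_coef c q true i) chi z | chi <- S, z <- nseq m b].
      apply: (@gker_current _ _ _ (Hop M) (@HopC _ _ _ _ _ M) (Xop M true i) hdeg
        (h_coef c q true i) (fun y r v => Hop_X true i y r v) (wt (lam (sj j)))) => //.
      - exact: subspace_wt.
      - exact: wt_H.
      - by apply/allP => z /nseqP[-> _].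
      move=> r' v' Hv'; rewrite big_nseq iter_mulr_1 mulrAC -PXE mulrC.
      by apply: current_mull => r''; apply/PXX/(string_line Hv').
    by move=> chi /allpairsP[[chi1 z] /= [/HS-> /nseqP[-> _] ->]].
  + move=> r; rewrite (Xp_Xm_currents XpXm) gv linear0 add0r.
    have -> : g' * (p * L ^+ k) = g * L ^+ k * PX by rewrite /g' PXE -!mulrA; congr (_ * _); rewrite mulrCA [RHS]mulrCA [L ^+ k * _]mulrC.
    rewrite addr0.
    have Gv : string v by apply: string_line Hv.
    exact: (Ps_annihilated XpXm strX PXX (g * L ^+ k) r Gv).
pose E2 := [set v : M | [/\ wt (lam (sj e)) v, gker (Hop M) S v
  & forall r, current (Xop M false i) g' r v = 0]].
have wE2 : exists2 w, E2 w & w <> 0 by exists w.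
have [|||u' [chi' [[Hu' Su' gu'] nu' Hchi']]] := @joint_eigenvector _ _ _ (Hop M)
  (@HopC _ _ _ _ _ M) E2 _ _ _ wE2.
- split=> [|a v v' [Hv Sv gv] [Hv' Sv' gv']].
    split; [exact: (subspace_wt _ _).1|exact: (subspace_gker _ _).1|].
    by move=> r; rewrite linear0.
  split; first exact: (subspace_wt _ _).2.
    exact: (subspace_gker _ _).2.
  by move=> r; rewrite (currentP (Xop M false i) g' r) gv gv' scaler0 addr0.
- by apply: fin_dimS (tame_fin tM (lam (sj e))) => v [].
- move=> y v [Hv Sv gv]; split; first exact: wt_H.
    exact: (stable_gker (@HopC _ _ _ _ _ M)).
  move=> r; have := op_current (fun y r v => Hop_X false i y r v) y g' r v.
  by rewrite !gv linear0 scaler0 addr0 => <-.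
exists e, g', u'; split => //; split => //.
- by rewrite -(HS _ (gker_eigen nu' Hchi' Su')).
- by rewrite mulf_neq0 ?expf_neq0.
- move=> z; rewrite mem_cat /g' rootM => /orP[/groots->|]; first by rewrite orbT.
  rewrite mem_nseq e0; case: (m) => [|k]; first by rewrite expr0 (negPf (root1 _)).
  by rewrite root_exp_XsubC => /eqP->; rewrite eqxx.
- by rewrite all_cat s0 andbT; apply/allP => z /nseqP[-> _].
Qed.

Lemma line_orderE s b : line_order s b = ordp N P b +
  ((count_mem b [seq q1 ^ (- B i i) * z | z <- s])%:Z -
   (count_mem b [seq q1 ^ B i i * z | z <- s])%:Z).
Proof.
rewrite /line_order /num_low /den_low /in_line !big_map /=; congr (_ + _).
rewrite /ordp -(big_map (fun z => q1 ^ (- B i i) * z) predT (fun z => 'X - z%:P)).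
rewrite -(big_map (fun z => q1 ^ B i i * z) predT (fun z => 'X - z%:P)).
by rewrite !mup_prod_XsubC.
Qed.

Variable u0 : M.
Hypothesis u0_neq0 : u0 <> 0.
Hypothesis u0_wt : wt l0 u0.
Hypothesis u0_eigen : forall y, Hop M y u0 = chi0 y *: u0.
Hypothesis u0_raise : forall r, Xop M false i r u0 = 0.

(** Otherwise one could lower forever along [b], [q^{B_ii} b], ...: each pole
    left uncompensated moves to the next point of the line. *)
Lemma line_orders_ge0 b : b != 0 ->
  exists k, 0 <= \sum_(j < k.+1) ordp N P (q1 ^ (B i i * j%:Z) * b).
Proof.
move=> b0; apply: contrapT => neg.
pose pt (j : nat) := q1 ^ (B i i * j%:Z) * b.
have pt_inj j k : pt j = pt k -> j = k.
  move=> /(mulIf b0)/qpow1_int_inj/(mulfI bmat_diag_neq0); by case.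
have ptS j : q1 ^ B i i * pt j = pt j.+1.
  by rewrite /pt mulrA -q1zD intS mulrDr mulr1.
have sumlt k : \sum_(j < k.+1) ordp N P (pt j) < 0.
  by rewrite ltNge; apply/negP => h; apply: neg; exists k.
have [K HK] := tame_int tM l0 i.
suff [s [g [u [hs ks _ _]]]] : exists s g u, [/\ lowered_eigenvector s g u,
    (K <= size s)%N, (forall z, z \in s -> exists2 j, (j < K)%N & z = pt j) &
    - \sum_(j < K) ordp N P (pt j) <= (count_mem (pt K) [seq q1 ^ B i i * z | z <- s])%:Z].
  apply: (le_neq0 hs); have [_] := HK _ ks; apply.
  by have := le_wt hs; rewrite lowered_line.
elim: K {HK} => [|K [s [g [u [hs ks sp cs]]]]].
  exists [::], 1, u0; split => //=; last by rewrite big_ord0.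
  split => //=.
  - by rewrite /lowered big_nil subr0.
  - by move=> r; rewrite /current conv1 u0_raise.
  - exact: oner_neq0.
  - by move=> z; rewrite (negPf (root1 _)).
have Ks : pt K \notin s.
  by apply/negP => /sp[j jK /pt_inj jE]; rewrite jE ltnn in jK.
have c0 : count_mem (pt K) [seq q1 ^ (- B i i) * z | z <- s] = 0%N.
  apply/count_memPn; apply/negP => /mapP[z /sp[j jK ->]].
  move/(congr1 ( *%R (q1 ^ B i i))); rewrite ptS mulrA -q1zD subrr expr0z mul1r.
  by move/pt_inj => jE; rewrite -jE ltnNge leqnSn in jK.
have ord0 : line_order s (pt K) <= \sum_(j < K.+1) ordp N P (pt j).
  rewrite line_orderE c0 big_ord_recr /= sub0r [X in X <= _]addrC lerD2r lerNl.
  exact: cs.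
have b'0 : pt K != 0 by rewrite mulf_neq0 // expfz_neq0 // qpow_neq0.
have [e [g' [u' [le_e hs']]]] := lower_step hs b'0 Ks (le_lt_trans ord0 (sumlt K)).
have e0 : (0 < e)%N.
  rewrite -ltz_nat; apply: lt_le_trans le_e; rewrite oppr_gt0.
  exact: le_lt_trans ord0 (sumlt K).
exists (nseq e (pt K) ++ s), g', u'; split => //.
- by rewrite size_cat size_nseq -addn1 addnC leq_add.
- move=> z; rewrite mem_cat => /orP[/nseqP[-> _]|/sp[j jK ->]]; first by exists K.
  by exists j => //; apply: leqW.
- rewrite map_cat count_cat map_nseq ptS count_nseq /= eqxx mul1n PoszD.
  apply: (@le_trans _ _ e%:Z); last by rewrite lerDl.
  by apply: le_trans le_e; rewrite lerN2; exact: ord0.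
Qed.
End Chain.

(** * Drinfeld polynomials *)

Section Pairing.
Variables (K : fieldType) (Q : K).
Hypothesis Q0 : Q != 0.
Hypothesis Qinj : forall j k, Q ^+ j = Q ^+ k -> j = k.

Definition count_diff (A B : seq K) (x : K) : int :=
  (count_mem x A)%:Z - (count_mem x B)%:Z.

(** Partial sums of [count A - count B] along each geometric progression reach
    a nonnegative value: the elements of [B] can then be matched with elements
    of [A] further along their progressions. The closest pair is matched
    first, which cannot destroy the hypothesis. *)
Lemma string_pairing (A B : seq K) : size A = size B -> all (predC1 0) B ->
  (forall x, x != 0 -> exists k, 0 <= \sum_(j < k.+1) count_diff A B (Q ^+ j * x)) ->
  exists T : seq (K * nat), perm_eq B [seq t.1 | t <- T] /\
    perm_eq A [seq Q ^+ t.2 * t.1 | t <- T].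
Proof.
elim: {B}(size B) {-2}B (erefl (size B)) A => [|m IH] B sB A sA B0 HAB.
  by exists [::]; rewrite (size0nil sB) (size0nil (etrans sA sB)).
pose near j := has (fun b => Q ^+ j * b \in A) B.
have exn : exists j, near j.
  case: B sB B0 @near HAB {sA} => // b B _ /andP[b0 _] near HAB.
  have [k] := HAB b b0; apply: contra_leP => nn.
  rewrite big_ord_recl; apply: (@le_lt_trans _ _ (count_diff A (b :: B) b)).
    rewrite expr0 mul1r gerDl; apply: sumr_le0 => j _; rewrite /count_diff.
    have bA : Q ^+ lift ord0 j * b \notin A.
      by apply/negP => h; apply: nn; exists (lift ord0 j); rewrite /near /= h.
    by rewrite (count_memPn bA) sub0r oppr_le0.
  have bA : b \notin A.
    by apply/negP => h; apply: nn; exists 0%N; rewrite /near /= expr0 mul1r h.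
  by rewrite /count_diff (count_memPn bA) /= eqxx sub0r oppr_lt0 ltz_nat.
case: (ex_minnP exn) => j /hasP[b bB aA] jmin; set a := Q ^+ j * b in aA.
have b0 : b != 0 := allP B0 b bB.
have pA := perm_to_rem aA; have pB := perm_to_rem bB.
have cd x : count_diff A B x =
    count_diff (rem a A) (rem b B) x + ((a == x)%:Z - (b == x)%:Z).
  rewrite /count_diff (permP pA) (permP pB) /=.
  by rewrite !PoszD opprD addrACA addrC.
have [||||T [TB TA]] := IH (rem b B) _ (rem a A).
- by rewrite size_rem // sB.
- by rewrite !size_rem // sA.
- by apply/allP => x /mem_rem/(allP B0).
- move=> x x0.
  have [[t tj xa]|nt] := pselect (exists2 t, (t < j)%N & Q ^+ t * x = a).
    exists 0%N; rewrite big_ord1 expr0 mul1r.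
    have xB : x \notin B.
      apply/negP => xB; have : near t by apply/hasP; exists x; rewrite // xa.
      by move/jmin; rewrite leqNgt tj.
    rewrite /count_diff (count_memPn (contra (@mem_rem _ _ _ _) xB)).
    by rewrite subr0.
  have [k Hk] := HAB x x0; exists k; apply: le_trans Hk _.
  under eq_bigr => s _ do rewrite cd.
  rewrite big_split /= gerDl sumrB subr_le0.
  have [[s sa]|na] := pselect (exists s : 'I_k.+1, Q ^+ s * x = a); last first.
    rewrite big1 ?sumr_ge0 // => s _; case: eqP => // e.
    by case: na; exists s.
  have js : (j <= s)%N.
    by rewrite leqNgt; apply/negP => sj; apply: nt; exists (s : nat).
  have sk : (s - j < k.+1)%N by apply: leq_ltn_trans (leq_subr _ _) (ltn_ord s).
  rewrite (bigD1 s) //= sa eqxx big1 ?addr0; last first.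
    move=> s' ne; case: eqP => // e; case/eqP: ne; apply/val_inj/Qinj.
    by apply: (mulIf x0); rewrite sa -e.
  rewrite (bigD1 (Ordinal sk)) //=.
  have -> : Q ^+ (s - j) * x = b.
    by apply: (mulfI (expf_neq0 j Q0)); rewrite mulrA -exprD subnKC.
  by rewrite eqxx lerDl sumr_ge0.
exists ((b, j) :: T); split; first by rewrite (perm_trans pB) //= perm_cons.
by rewrite (perm_trans pA) //= perm_cons.
Qed.
End Pairing.

Section Drinfeld.
Variable K : closedFieldType.
Implicit Types (p P N : {poly K}) (s : seq K).

(** Linear factors normalized at the origin. *)
Definition unit_factor (y : K) : {poly K} := 1 - y^-1 *: 'X.

Lemma unit_factorE y : y != 0 -> unit_factor y = (- y^-1) *: ('X - y%:P).
Proof.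
move=> y0; rewrite /unit_factor scalerBr !scaleNr opprK -[y^-1 *: y%:P]mul_polyC.
by rewrite -polyCM mulVf // polyC1 addrC.
Qed.

Lemma dilate_unit_factor a y : a != 0 -> y != 0 ->
  unit_factor y \Po (a *: 'X) = unit_factor (a^-1 * y).
Proof.
move=> a0 y0; rewrite /unit_factor comp_polyB comp_polyZ comp_polyX comp_polyC.
by rewrite scalerA invfM invrK mulrC.
Qed.

Lemma prod_unit_factorE s : all (predC1 0) s ->
  \prod_(y <- s) unit_factor y = (\prod_(y <- s) (- y^-1)) *: \prod_(y <- s) ('X - y%:P).
Proof.
elim: s => [|y s IH] /=; first by rewrite !big_nil scale1r.
case/andP=> y0 s0; rewrite !big_cons IH // unit_factorE //.
by rewrite -scalerAl -scalerAr scalerA.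
Qed.

Lemma prod_unit_factor0 s : (\prod_(y <- s) unit_factor y).[0] = 1.
Proof.
rewrite horner_prod big1 // => y _.
by rewrite /unit_factor hornerD hornerN hornerZ hornerX hornerC mulr0 subr0.
Qed.

Lemma prod_unit_lead_neq0 s : all (predC1 0) s -> \prod_(y <- s) (- y^-1) != 0.
Proof.
move=> s0; rewrite prodf_seq_neq0; apply/allP => y ys.
by rewrite oppr_eq0 invr_eq0; apply: (allP s0 y ys).
Qed.

Lemma unit_factorization p : ~~ root p 0 -> exists2 s, all (predC1 0) s &
  p = p.[0] *: \prod_(y <- s) unit_factor y.
Proof.
move=> p0; have [s pE] := closed_field_poly_normal p.
have lp0 : lead_coef p != 0 by rewrite lead_coef_eq0; apply: contraNneq p0 => ->; rewrite root0.
have s0 : all (predC1 0) s.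
  apply/allP => y ys /=; apply: contraNneq p0 => y0.
  by rewrite pE rootZ // root_prod_XsubC -y0.
have c0 := prod_unit_lead_neq0 s0.
pose a := lead_coef p / \prod_(y <- s) (- y^-1).
have pE' : p = a *: \prod_(y <- s) unit_factor y.
  by rewrite prod_unit_factorE // scalerA divfK.
exists s => //; have -> : p.[0] = a by rewrite pE' hornerZ prod_unit_factor0 mulr1.
exact: pE'.
Qed.

Lemma size_prod_unit_factor s : all (predC1 0) s ->
  size (\prod_(y <- s) unit_factor y) = (size s).+1.
Proof.
move=> s0; rewrite prod_unit_factorE // size_scale ?size_prod_XsubC //.
exact: prod_unit_lead_neq0.
Qed.

Lemma mup_prod_unit_factor s b : all (predC1 0) s ->
  mup b (\prod_(y <- s) unit_factor y) = count_mem b s.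
Proof.
move=> s0; rewrite prod_unit_factorE // mupZ ?mup_prod_XsubC //.
exact: prod_unit_lead_neq0.
Qed.

Variable r : K.
Hypothesis r0 : r != 0.
Hypothesis rinj : forall j k : nat, r ^+ j = r ^+ k -> j = k.

Definition string_roots (T : seq (K * nat)) : seq K :=
  flatten [seq [seq r ^+ (2 * k).+1 * t.1 | k <- iota 0 t.2] | t <- T].

Lemma string_roots_neq0 T : all (fun t => t.1 != 0) T -> all (predC1 0) (string_roots T).
Proof.
move=> T0; apply/allP => y /flattenP[_ /mapP[t tT ->] /mapP[s _ ->]] /=.
by rewrite mulf_neq0 ?expf_neq0 ?(allP T0 t tT).
Qed.

(** The two dilations of the polynomial differ, on each string, by its end
    points only. *)
Lemma string_telescope T : all (fun t => t.1 != 0) T ->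
  let D := \prod_(y <- string_roots T) unit_factor y in
  (D \Po (r^-1 *: 'X)) * \prod_(t <- T) unit_factor t.1 =
  (D \Po (r *: 'X)) * \prod_(t <- T) unit_factor ((r ^+ 2) ^+ t.2 * t.1).
Proof.
elim: T => [|[b j] T IH] /=; first by rewrite !big_nil -polyC1 !comp_polyC.
case/andP=> b0 T0; have := IH T0; rewrite /string_roots /= !big_cat !big_cons /=.
set D := \prod_(_ <- flatten _) _ => {}IH.
pose F k := unit_factor ((r ^+ 2) ^+ k * b).
have low : (\prod_(y <- [seq r ^+ (2 * k).+1 * b | k <- iota 0 j]) unit_factor y) \Po
    (r^-1 *: 'X) = \prod_(k < j) F k.+1.
  rewrite big_map -[j in iota 0 j]subn0 -/(index_iota 0 j) big_mkord.
  rewrite -/(comp_poly _ _) rmorph_prod /=; apply: eq_bigr => k _.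
  rewrite dilate_unit_factor ?invr_neq0 ?mulf_neq0 ?expf_neq0 // invrK /F.
  by rewrite mulrA -exprS -exprM; congr (unit_factor (r ^+ _ * b)); lia.
have high : (\prod_(y <- [seq r ^+ (2 * k).+1 * b | k <- iota 0 j]) unit_factor y) \Po
    (r *: 'X) = \prod_(k < j) F k.
  rewrite big_map -[j in iota 0 j]subn0 -/(index_iota 0 j) big_mkord.
  rewrite rmorph_prod /=; apply: eq_bigr => k _.
  rewrite dilate_unit_factor ?mulf_neq0 ?expf_neq0 // /F.
  by rewrite exprS -mulrA mulKf // -exprM.
have tel : (\prod_(k < j) F k.+1) * unit_factor b = (\prod_(k < j) F k) * F j.
  transitivity (\prod_(k < j.+1) F k); last by rewrite big_ord_recr.
  by rewrite big_ord_recl mulrC; congr (unit_factor _ * _); rewrite mul1r.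
rewrite !comp_polyM low high.
rewrite mulrACA tel -/(F j) IH.
rewrite -!mulrA; congr (_ * _); ring.
Qed.


Lemma prod_string_ends T : all (fun t => t.1 != 0) T ->
  (r ^+ size (string_roots T)) ^+ 2 * \prod_(t <- T) (- ((r ^+ 2) ^+ t.2 * t.1)^-1) =
  \prod_(t <- T) (- t.1^-1).
Proof.
elim: T => [|[b j] T IH] /=; first by rewrite !big_nil expr0 expr1n mulr1.
case/andP=> b0 T0; rewrite /string_roots /= size_cat size_map size_iota !big_cons /=.
rewrite -/(string_roots T) -IH //.
have e : (r ^+ j) ^+ 2 = (r ^+ 2) ^+ j by rewrite -!exprM mulnC.
rewrite exprD exprMn e; have rj0 : (r ^+ 2) ^+ j != 0 by rewrite !expf_neq0.
move: ((r ^+ 2) ^+ j) (\prod_(_ <- T) _) ((r ^+ size _) ^+ 2) rj0 => x y z x0.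
by field; rewrite x0 b0.
Qed.

Lemma lead_prod_unit_factor s : all (predC1 0) s ->
  lead_coef (\prod_(y <- s) unit_factor y) = \prod_(y <- s) (- y^-1).
Proof.
move=> s0; rewrite prod_unit_factorE // lead_coefZ (monicP (monic_prod_XsubC _ _ _)).
exact: mulr1.
Qed.

Theorem drinfeld_polynomial (fp fm : int -> K^o) (kap : K) P : kap != 0 ->
  (forall k, k < 0 -> fp k = 0) -> (forall k, 0 < k -> fm k = 0) ->
  fp 0 = kap -> fm 0 = kap^-1 -> ~~ root P 0 -> conv P fp =1 conv P fm ->
  (forall N, N != 0 -> conv P fp =1 conv N (@delta0 K) -> forall x, x != 0 ->
     exists k, 0 <= \sum_(j < k.+1) ordp N P ((r ^+ 2) ^+ j * x)) ->
  exists D : {poly K}, [/\ D.[0] = 1, kap ^+ 2 = (r ^+ (size D).-1) ^+ 2,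
    conv (D \Po (r *: 'X)) fp =1 conv (kap *: (D \Po (r^-1 *: 'X))) (@delta0 K)
  & conv (D \Po (r *: 'X)) fm =1 conv (kap *: (D \Po (r^-1 *: 'X))) (@delta0 K)].
Proof.
move=> kap0 fp0 fm0 fpk fmk P0 Pfm HP.
have Pn0 : P != 0 by apply: contraNneq P0 => ->; rewrite root0.
have [N PN sN] := common_numerator fp0 fm0 Pfm.
have N_0 : N`_0 = kap * P`_0.
  have := PN 0%N%:Z; rewrite conv_delta0 => <-.
  rewrite (@convE _ _ (size P).+1) // big_ord_recl subr0 fpk.
  rewrite big1 ?addr0; first exact: mulrC.
  by move=> j _; rewrite fp0 ?scaler0 // sub0r oppr_lt0.
have N00 : N.[0] != 0.
  by rewrite horner_coef0 N_0 mulf_neq0 // -horner_coef0.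
have Nn0 : N != 0 by apply: contraNneq N00 => ->; rewrite horner0.
have sP : (0 < size P)%N by rewrite size_poly_gt0.
have N_top : N`_(size P).-1 = kap^-1 * lead_coef P.
  have := PN (size P).-1%:Z; rewrite conv_delta0 => <-.
  rewrite Pfm (@convE _ _ (size P).-1.+1); last by rewrite prednK.
  rewrite big_ord_recr /= subrr fmk.
  rewrite big1 ?add0r; first exact: mulrC.
  by move=> j _; rewrite fm0 ?scaler0 // subr_gt0 ltz_nat ltn_ord.
have sNP : size N = size P.
  apply/eqP; rewrite eqn_leq sN -[X in (X <= _)%N](prednK sP) ltnNge.
  apply/negP => /leq_sizeP/(_ _ (leqnn _)); rewrite N_top => /eqP.
  by rewrite mulf_eq0 invr_eq0 lead_coef_eq0 (negPf kap0) (negPf Pn0).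
have [A A0 NA] := unit_factorization N00; have [B B0 PB] := unit_factorization P0.
have sAB : size A = size B.
  have := sNP; rewrite NA PB !size_scale // !size_prod_unit_factor //.
  by case.
have r20 : r ^+ 2 != 0 by rewrite expf_neq0.
have r2inj j k : (r ^+ 2) ^+ j = (r ^+ 2) ^+ k -> j = k.
  by rewrite -!exprM => /rinj/eqP; rewrite eqn_mul2l => /eqP.
have ordE x : count_diff A B x = ordp N P x.
  by rewrite /ordp NA PB !mupZ // !mup_prod_unit_factor.
have [T [BT AT]] : exists T : seq (K * nat), perm_eq B [seq t.1 | t <- T] /\
    perm_eq A [seq (r ^+ 2) ^+ t.2 * t.1 | t <- T].
  apply: string_pairing => // x x0; have [k Hk] := HP N Nn0 PN x x0.
  by exists k; under eq_bigr => j _ do rewrite ordE.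
have T0 : all (fun t => t.1 != 0) T.
  by rewrite -(all_map fst (predC1 0)) -(perm_all _ BT).
set rts := string_roots T; have rts0 : all (predC1 0) rts by apply: string_roots_neq0.
pose D := \prod_(y <- rts) unit_factor y.
have PD : kap *: ((D \Po (r^-1 *: 'X)) * P) = (D \Po (r *: 'X)) * N.
  rewrite PB NA -!scalerAr scalerA !horner_coef0 N_0; congr (_ *: _).
  rewrite (perm_big _ BT) (perm_big _ AT) !big_map; exact: string_telescope.
have PDN : conv P (conv (kap *: (D \Po (r^-1 *: 'X))) (@delta0 K)) =1
    conv (D \Po (r *: 'X)) (conv P fp).
  move=> k; rewrite -convM (eq_conv _ _ PN) -convM -PD; congr (conv _ _ _).
  by rewrite mulrC -scalerAl.
exists D; split; first exact: prod_unit_factor0.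
- rewrite size_prod_unit_factor //=.
  have lA := congr1 lead_coef NA; have lB := congr1 lead_coef PB.
  rewrite !lead_coefZ !lead_prod_unit_factor // in lA lB.
  have : lead_coef N = kap^-1 * lead_coef P by rewrite -N_top /lead_coef sNP.
  rewrite lA lB !horner_coef0 N_0 (perm_big _ BT) (perm_big _ AT) !big_map.
  have -> : \prod_(t <- T) (- t.1^-1) = (r ^+ size rts) ^+ 2 *
      \prod_(t <- T) (- ((r ^+ 2) ^+ t.2 * t.1)^-1) by rewrite prod_string_ends.
  have : \prod_(t <- T) (- ((r ^+ 2) ^+ t.2 * t.1)^-1) != 0.
    rewrite prodf_seq_neq0; apply/allP => t tT.
    by rewrite oppr_eq0 invr_eq0 mulf_neq0 ?expf_neq0 //; apply: (allP T0 t tT).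
  have : P`_0 != 0 by rewrite -horner_coef0.
  move: (\prod_(_ <- T) _) (P`_0) ((r ^+ _) ^+ 2) => x y z y0 x0 e.
  apply: (mulfI (mulf_neq0 y0 x0)); apply: (mulfI (invr_neq0 kap0)).
  transitivity (kap * y * x); first by field.
  by rewrite e; field.
- pose G k : K^o := conv (D \Po (r *: 'X)) fp k -
    conv (kap *: (D \Po (r^-1 *: 'X))) (@delta0 K) k.
  move=> k; apply/eqP; rewrite -subr_eq0 -/(G k); apply/eqP; move: k.
  apply: (@conv_inj_low _ P G 0); first by rewrite -horner_coef0.
    by move=> k k0; rewrite /G !conv_low ?subr0 // => j j0; rewrite /delta0 lt_eqF.
  by move=> k; rewrite convBg PDN -!convM mulrC subrr.
- pose G k : K^o := conv (D \Po (r *: 'X)) fm k -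
    conv (kap *: (D \Po (r^-1 *: 'X))) (@delta0 K) k.
  move=> k; apply/eqP; rewrite -subr_eq0 -/(G k); apply/eqP; move: k.
  apply: (@conv_inj_high _ P G (maxn (size (D \Po (r *: 'X)))
    (size (kap *: (D \Po (r^-1 *: 'X)))))) => //.
    move=> k k0; rewrite /G !conv_high ?subr0 //.
    + by move=> j j0; rewrite /delta0 gt_eqF.
    + by apply: le_trans (ltW k0); rewrite lez_nat leq_maxr.
    + by apply: le_trans (ltW k0); rewrite lez_nat leq_maxl.
  move=> k; rewrite convBg PDN (eq_conv _ _ Pfm) -!convM mulrC subrr.
  by [].
Qed.

End Drinfeld.

(** Reading an expansion at infinity backwards. *)
Lemma expands_revpE (R : realType) (f : nat -> R[i]) (g : int -> R[i]^o)
    (num den : {poly R[i]}) : size num = size den -> den != 0 ->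
  (forall k : nat, g (- k%:Z) = f k) -> (forall k, 0 < k -> g k = 0) ->
  expands_to f (revp num) (revp den) <-> conv den g =1 conv num (@delta0 R[i]).
Proof.
move=> sE den0 gf g0; pose d := (size den).-1.
have sd : size den = d.+1 by rewrite prednK // size_poly_gt0.
have revE (p : {poly R[i]}) k : size p = d.+1 -> (revp p)`_k = if (k <= d)%N then p`_(d - k) else 0.
  move=> sp; rewrite /revp coef_Poly; case: leqP => kd.
    by rewrite nth_rev ?sp ?ltnS // subSS.
  by rewrite nth_default // size_rev sp.
have numE m : (revp num)`_m = conv num (@delta0 R[i]) (d%:Z - m%:Z).
  rewrite revE ?sE //; case: leqP => md; first by rewrite subzn // conv_delta0.
  by rewrite conv_low // => [k k0|]; [rewrite /delta0 lt_eqF | rewrite subr_lt0].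
suff denE m : \sum_(k < m.+1) f k * (revp den)`_(m - k) = conv den g (d%:Z - m%:Z).
  split=> [e r|e m]; last by rewrite denE numE e.
  have [rd|rd] := leP r d%:Z.
    have -> : r = d%:Z - `|d%:Z - r|%N%:Z by rewrite gez0_abs ?subr_ge0 // opprB addrC subrK.
    by rewrite -denE -numE e.
  rewrite !conv_high //; first by move=> k k0; rewrite /delta0 gt_eqF.
    by rewrite sE sd.
  by rewrite sd.
rewrite (@convE _ _ d.+1) ?sd // [RHS](reindex_inj rev_ord_inj) /=.
rewrite [LHS](reindex_inj rev_ord_inj) /=.
pose F k := (if ((k <= d) && (k <= m))%N then den`_(d - k) * f (m - k)%N else 0).
transitivity (\sum_(k < m.+1) F k).
  apply: eq_bigr => -[k km] _ /=; have km' : (k <= m)%N := km.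
  rewrite !subSS subKn // revE // /F km' andbT.
  by case: ifP; rewrite ?mulr0 // mulrC.
transitivity (\sum_(k < d.+1) F k).
  rewrite (big_ord_widen (maxn m d).+1 F) ?ltnS ?leq_maxl //.
  rewrite [RHS](big_ord_widen (maxn m d).+1 F) ?ltnS ?leq_maxr // !(big_mkcond (fun _ => _ < _)%N).
  by apply: eq_bigr => k _; rewrite /F !ltnS; case: (k <= d)%N; case: (k <= m)%N.
apply: eq_bigr => -[k kd] _ /=; have kd' : (k <= d)%N := kd.
rewrite subSS /F kd' /=; case: leqP => km.
  have -> : d%:Z - m%:Z - (d - k)%N%:Z = - (m - k)%N%:Z by move: kd km; clear; lia.
  by rewrite gf.
by rewrite g0 ?scaler0 //; move: kd km; clear; lia.
Qed.

Section HighestWeight.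
Variables (R : realType) (n : nat) (c : cartan_datum n) (rl : realization c)
          (q : qparam R[i]).
Local Notation C := R[i].
Local Notation H := (car rl).
Local Notation B := (bmat c).
Local Notation q1 := (qpow q 1).
Local Notation hst := (hstar H).
Local Notation Y := ('I_n * {m : int | m != 0})%type.
Variable M : rep rl q.
Hypothesis tM : tame M.
Variables (l0 : hst) (chi0 : Y -> C) (u0 : M).
Hypothesis u0_neq0 : u0 <> 0.
Hypothesis u0_wt : wt l0 u0.
Hypothesis u0_eigen : forall y, Hop M y u0 = chi0 y *: u0.
Hypothesis u0_raise : forall i r, Xop M false i r u0 = 0.

Lemma lchar0 l (chi : Y -> C) e i :
  lchar q l chi e i 0 = qpow q (qsign e * ((cr c i)%:R * l (coroot rl i))).
Proof. by rewrite /lchar expc0 mulr1 linearZ /= mulrA. Qed.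

Lemma qi_exp i j : qi c q i ^+ j = qpow q ((cr c i)%:R * j%:R).
Proof. by rewrite /qi -qpow_nat mulr_natr. Qed.

(** The highest weight of an integrable module is given by Drinfeld
    polynomials. *)
Theorem highest_weight_drinfeld i : exists D : {poly C},
  [/\ D.[0] = 1, l0 (coroot rl i) = (size D).-1%:R,
    expands_to (lchar q l0 chi0 false i) (qi c q i ^+ (size D).-1 *: dilate D (qi c q i)^-1)
      (dilate D (qi c q i))
  & expands_to (lchar q l0 chi0 true i)
      (revp (qi c q i ^+ (size D).-1 *: dilate D (qi c q i)^-1))
      (revp (dilate D (qi c q i)))].
Proof.
set r := qi c q i; set lam := l0 (coroot rl i).
pose kap := qpow q ((cr c i)%:R * lam).
have r0 : r != 0 by exact: qi_neq0.
have cr0 : (cr c i)%:R != 0 :> rat by rewrite pnatr_eq0 -lt0n cr_gt0.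
have rinj j k : r ^+ j = r ^+ k -> j = k.
  rewrite !qi_exp => /qpow_inj/(mulfI cr0)/eqP; by rewrite eqr_nat => /eqP.
have [P P0 PXX] := string_annihilator tM i l0.
have XpXm s t w : Xop M false i s (Xop M true i t w) =
    Xop M true i t (Xop M false i s w) + Psiop M i (s + t) w.
  by rewrite Xop_X eqxx scale1r.
have strX f s w : string (M := M) i l0 w -> string i l0 (current (Xop M false i) f s w).
  exact: string_current.
have Gu : string i l0 u0 by exists 0; rewrite mulr0z addr0.
have Pfm : conv P (phz q l0 chi0 false i) =1 conv P (phz q l0 chi0 true i).
  move=> s; have := Ps_annihilated XpXm strX PXX 1 s Gu; rewrite mul1r.
  rewrite /current (eq_conv _ _ (fun r => Psi_eigen i r u0_wt u0_eigen)) /conv.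
  under eq_bigr => j _ do rewrite scalerA.
  rewrite -scaler_suml => /eqP; rewrite scaler_eq0 (introF eqP u0_neq0) orbF.
  rewrite -/(conv P (psi_scalar q i l0 chi0) s) convZg convBg.
  by rewrite scaler_eq0 invr_eq0 (negPf (qi_sub_neq0 c q i)) subr_eq0 => /eqP.
have Pn0 : P != 0 by apply: contraNneq P0 => ->; rewrite root0.
have phz0 e : phz q l0 chi0 e i 0 = qpow q (qsign e * ((cr c i)%:R * lam)).
  by rewrite /phz mulr0 lexx lchar0.
have HP N : N != 0 -> conv P (phz q l0 chi0 false i) =1 conv N (@delta0 C) ->
    forall x, x != 0 -> exists k, 0 <= \sum_(j < k.+1) ordp N P ((r ^+ 2) ^+ j * x).
  move=> N0 PN x x0.
  have [k] := line_orders_ge0 tM Pn0 N0 PN u0_neq0 u0_wt u0_eigen (u0_raise i) x0.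
  exists k; under eq_bigr => j _.
    have -> : (r ^+ 2) ^+ j = q1 ^ (B i i * j%:Z).
      rewrite /r qiE -exprz_exp /bmat cmat_diag -exprz_exp.
      by rewrite -!exprnP.
    over.
  by [].
have fp0 (k : int) : k < 0 -> phz q l0 chi0 false i k = 0.
  by move=> k0; rewrite /phz expr0 mul1r leNgt k0.
have fm0 (k : int) : 0 < k -> phz q l0 chi0 true i k = 0.
  by move=> k0; rewrite /phz expr1 mulN1r oppr_ge0 leNgt k0.
have kap0 : kap != 0 by exact: qpow_neq0.
have fpk : phz q l0 chi0 false i 0 = kap by rewrite phz0 expr0 mul1r.
have fmk : phz q l0 chi0 true i 0 = kap^-1 by rewrite phz0 expr1 mulN1r qpowN.
have [D [D0 kapE fpE fmE]] :=
  drinfeld_polynomial r0 rinj kap0 fp0 fm0 fpk fmk P0 Pfm HP.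
have lamE : lam = (size D).-1%:R.
  apply: (mulfI cr0); move: kapE; rewrite /kap qi_exp -!qpow_nat => /qpow_inj/eqP.
  by rewrite eqrMn2r => /eqP.
have kapD : r ^+ (size D).-1 = kap by rewrite qi_exp -lamE.
exists D; rewrite kapD; split=> //.
- move=> m; have := fpE m%:Z; rewrite conv_delta0 => <-.
  by rewrite -conv_ext; apply: eq_conv => k; rewrite phz_ext.
- have sX (a : C) : a != 0 -> size (a *: 'X : {poly C}) = 2 by move=> a0; rewrite size_scale ?size_polyX.
  apply/(expands_revpE _ _ _ fm0); last exact: fmE.
  + by rewrite size_scale // !size_comp_poly2 // sX ?invr_neq0.
  + exact: dilate_neq0.
  + move=> k; by rewrite /phz expr1 mulN1r opprK abszN /=.
Qed.
End HighestWeight.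

(** * Monomials and l-weights *)

Section Monomials.
Variables (R : realType) (n : nat) (c : cartan_datum n) (rl : realization c)
          (q : qparam R[i]).
Local Notation C := R[i].
Local Notation H := (car rl).
Local Notation hst := (hstar H).
Local Notation Y := ('I_n * {m : int | m != 0})%type.
Local Notation Cstar := (Cstar R).

Lemma nu_inj : injective (@nu _ _ rl).
Proof.
move=> l l' e; apply/eqP; rewrite -subr_eq0; apply/eqP/(@form_nondeg _ _ rl) => m.
have := form_linear (-1) l' l m; rewrite scaleN1r addrC => ->.
by rewrite mulN1r !(form_sym _ m) -!nu_form e addNr.
Qed.

Lemma monomial_exists (l : hst) (t : 'I_n -> seq Cstar) :
  (forall i, l (coroot rl i) = (size (t i))%:R) ->
  exists m : monomial R rl, mon_omega m = nu l /\
    forall i a, mon_u m i a = (count_mem a (t i))%:Z.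
Proof.
move=> Hl; pose dom := [fset y in [seq (i, a) | i <- enum 'I_n, a <- t i]]%fset.
pose f : {fsfun ('I_n * Cstar)%type -> int with 0} :=
  [fsfun y in dom => (count_mem y.2 (t y.1))%:Z | 0].
have fE i a : f (i, a) = (count_mem a (t i))%:Z.
  rewrite /f fsfunE /=; case: ifP => // /negbT nd; rewrite (count_memPn _) //.
  apply: contra nd => ai; rewrite inE /=.
  by apply/allpairsPdep; exists i, a; rewrite mem_enum.
have ax : monomial_axiom (f, nu l).
  apply/forallP => i /=; apply/eqP; rewrite nu_form form_root linearZ /= Hl.
  congr (_ * _); rewrite -big_filter (perm_big [seq (i, a) | a <- undup (t i)]) /=.
    rewrite big_map; under eq_bigr => a _ do rewrite fE.
    transitivity (\sum_(a <- t i) (1 : rat)).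
      by elim: (t i) => [|a s IH]; rewrite ?big_nil // big_cons -IH /= -natr1 addrC.
    rewrite -[LHS]big_undup_iterop_count; apply: eq_bigr => a _.
    rewrite Monoid.iteropE -pmulrn; elim: count => //= k IHk.
    by rewrite IHk mulrS.
  apply: uniq_perm; first exact: (filter_uniq _ (fset_uniq _)).
    by rewrite map_inj_uniq ?undup_uniq // => a b [].
  move=> [j a]; rewrite mem_filter mem_finsupp fE /= eqz_nat -lt0n -has_count has_pred1.
  apply/andP/mapP => [[/eqP-> ai]|[b bi [-> ->]]]; last by rewrite eqxx -mem_undup.
  by exists a; rewrite ?mem_undup.
by exists (exist _ (f, nu l) ax).
Qed.

Lemma Cstar_inverses (s : seq C) : all (predC1 0) s ->
  exists t : seq Cstar, s = [seq (sval a)^-1 | a <- t].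
Proof.
elim: s => [|z s IH] /=; first by exists [::].
case/andP=> z0 /IH[t ->]; exists (exist _ z^-1 (invr_neq0 z0) :: t).
by rewrite /= invrK.
Qed.

(** A highest l-weight of an integrable module is that of a dominant
    monomial. *)
Theorem highest_weight_monomial (M : rep rl q) (l : hst) (chi : Y -> C) (u : M) :
  tame M -> u <> 0 -> wt l u -> (forall y, Hop M y u = chi y *: u) ->
  (forall i r, Xop M false i r u = 0) ->
  exists m, [/\ dominant m, QPlplus q (l, lchar q l chi) & is_Y q (l, lchar q l chi) m].
Proof.
move=> tM u0 Hu Hchi Xu.
have /choice[D HD] := highest_weight_drinfeld tM u0 Hu Hchi Xu.
have fact i : exists t : seq Cstar,
    D i = \prod_(y <- [seq (sval a)^-1 | a <- t]) unit_factor y.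
  have [D0 _ _ _] := HD i.
  have /unit_factorization[s s0 DE] : ~~ root (D i) 0 by rewrite /root D0 oner_eq0.
  have [t st] := Cstar_inverses s0; exists t.
  by rewrite -st {1}DE D0 scale1r.
have /choice[t tE] := fact.
have t0 i : all (predC1 0) [seq (sval a)^-1 | a <- t i].
  by apply/allP => _ /mapP[a _ ->] /=; rewrite invr_eq0 (valP a).
have sz i : (size (D i)).-1 = size (t i).
  by rewrite tE size_prod_unit_factor // size_map.
have lE i : l (coroot rl i) = (size (t i))%:R.
  by have [_ -> _ _] := HD i; rewrite sz.
have wit : QPl_witness q (l, lchar q l chi) D (fun=> 1).
  move=> i; have [D0 _ e1 e2] := HD i.
  have d1 (a : C) : dilate (1 : {poly C}) a = 1 by rewrite /dilate -polyC1 comp_polyC.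
  by rewrite /= !d1 !mulr1 size_poly1 subr0 -exprnP hornerC; split.
have [m [mo mu]] := monomial_exists lE.
exists m; split; first by move=> i a; rewrite mu.
  split; last by exists D, (fun=> 1).
    split=> [i|e i] /=; last exact: lchar0.
    by exists (size (t i))%:Z; rewrite lE.
  exists l; last by exists (fun=> 0%N); rewrite subrr big1.
  by split=> i; [exists (size (t i))%:Z; rewrite lE | rewrite lE ler0n].
exists D, (fun=> 1); split => // i a; rewrite mu tE mup_prod_unit_factor //.
rewrite mupNroot ?root1 // subr0 count_map; congr Posz; apply: eq_count => b /=.
by rewrite (inj_eq invr_inj).
Qed.

Lemma eq_mup_poly (p p' : {poly C}) : p.[0] = 1 -> p'.[0] = 1 ->
  (forall b, b != 0 -> mup b p = mup b p') -> p = p'.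
Proof.
move=> p0 p'0 e.
have /unit_factorization[s s0 sE] : ~~ root p 0 by rewrite /root p0 oner_eq0.
have /unit_factorization[t t0 tE] : ~~ root p' 0 by rewrite /root p'0 oner_eq0.
rewrite sE tE p0 p'0; congr (_ *: _); apply: perm_big.
apply/allP => b _ /=; have [->|b0] := eqVneq b 0.
  have n0 (r : seq C) : all (predC1 0) r -> count_mem 0 r = 0%N.
    by move=> r0; apply/count_memPn/negP => /(allP r0); rewrite /= eqxx.
  by rewrite !n0.
have := e b b0; rewrite sE tE p0 p'0 !scale1r !mup_prod_unit_factor // => ->.
by [].
Qed.

(** The l-weight is determined by its monomial. *)
Lemma is_Y_inj (x x' : lweight R rl) m : is_Y q x m -> is_Y q x' m -> x = x'.
Proof.
move=> [Q [S [wit mo mu]]] [Q' [S' [wit' mo' mu']]].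
have e1 : x.1 = x'.1 by apply: nu_inj; rewrite -mo -mo'.
have QS i : Q i * S' i = Q' i * S i.
  have [Q0 S0 _ _] := wit i; have [Q'0 S'0 _ _] := wit' i.
  have n0 := @horner0_neq0 R.
  apply: eq_mup_poly; rewrite ?hornerM ?Q0 ?S0 ?Q'0 ?S'0 ?mulr1 // => b b0.
  rewrite !mupM ?n0 //; have := mu' i (exist _ b^-1 (invr_neq0 b0)).
  rewrite mu /= invrK; move: (mup _ _) (mup _ _) (mup _ _) (mup _ _) => A1 A2 A3 A4.
  by clear; lia.
have cross i : QS_num c q Q S i * QS_den c q Q' S' i = QS_num c q Q' S' i * QS_den c q Q S i.
  have [Q0 S0 _ _] := wit i; have [Q'0 S'0 _ _] := wit' i.
  have dM (p p' : {poly C}) a : dilate p a * dilate p' a = dilate (p * p') a.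
    by rewrite /dilate comp_polyM.
  have deg : (size (Q i)).-1%:Z - (size (S i)).-1%:Z =
      (size (Q' i)).-1%:Z - (size (S' i)).-1%:Z.
    have := congr1 (fun p : {poly C} => size p) (QS i).
    have pos (p : {poly C}) : p.[0] = 1 -> (0 < size p)%N.
      by move=> /horner0_neq0; rewrite size_poly_gt0.
    rewrite !size_mul ?horner0_neq0 //.
    move: (pos _ Q0) (pos _ S0) (pos _ Q'0) (pos _ S'0).
    move: (size _) (size _) (size _) (size _) => A1 A2 A3 A4; clear; lia.
  rewrite /QS_num /QS_den deg -!scalerAl; congr (_ *: _).
  transitivity (dilate (Q i * S' i) (qi c q i)^-1 * dilate (Q' i * S i) (qi c q i)).
    by rewrite -!dM; ring.
  transitivity (dilate (Q' i * S i) (qi c q i)^-1 * dilate (Q i * S' i) (qi c q i)).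
    by rewrite QS.
  by rewrite -!dM; ring.
have crossed (f f' : int -> C^o) i :
    conv (QS_den c q Q S i) f =1 conv (QS_num c q Q S i) (@delta0 C) ->
    conv (QS_den c q Q' S' i) f' =1 conv (QS_num c q Q' S' i) (@delta0 C) ->
    forall r, conv (QS_den c q Q S i * QS_den c q Q' S' i) (fun k => f k - f' k) r = 0.
  move=> e e' r; rewrite convBg; apply/eqP; rewrite subr_eq0; apply/eqP.
  transitivity (conv (QS_den c q Q' S' i * QS_num c q Q S i) (@delta0 C) r).
    by rewrite [QS_den c q Q S i * _]mulrC [LHS]convM [RHS]convM; exact: (eq_conv _ _ e).
  transitivity (conv (QS_den c q Q S i * QS_num c q Q' S' i) (@delta0 C) r).
    by congr (conv _ _ _); rewrite mulrC cross mulrC.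
  by rewrite [LHS]convM [RHS]convM; apply: esym; exact: (eq_conv _ _ e').
have low i m' : x.2 false i m' = x'.2 false i m'.
  pose g k : C^o := ext (x.2 false i) k - ext (x'.2 false i) k.
  suff : g m'%:Z = 0 by move/eqP; rewrite subr_eq0 /ext /= => /eqP.
  apply: (@conv_inj_low _ (QS_den c q Q S i * QS_den c q Q' S' i) g 0).
  - by rewrite coefM big_ord1 subnn (QS_den0 wit) (QS_den0 wit') mulr1 oner_neq0.
  - by move=> r r0; rewrite /g /ext leNgt r0 subrr.
  - by apply: crossed => k; [exact: (conv_QS wit) | exact: (conv_QS wit')].
have high i m' : x.2 true i m' = x'.2 true i m'.
  have size_QS (p p' : 'I_n -> {poly C}) : (p i).[0] = 1 -> (p' i).[0] = 1 ->
      size (QS_num c q p p' i) = size (QS_den c q p p' i).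
    move=> p0 p'0; have sX (a : C) : a != 0 -> size (a *: 'X : {poly C}) = 2.
      by move=> a0; rewrite size_scale ?size_polyX.
    have qi0 := qi_neq0 c q i.
    rewrite size_scale ?expfz_neq0 // !size_mul ?dilate_neq0 //.
    by rewrite !size_comp_poly2 // sX ?invr_neq0.
  pose G (f : nat -> C) (k : int) : C^o := if k <= 0 then f `|k|%N else 0.
  have GE f (k : nat) : G f (- k%:Z) = f k by rewrite /G oppr_le0 abszN.
  have G0 f (k : int) : 0 < k -> G f k = 0 by move=> k0; rewrite /G leNgt k0.
  have [Q0 S0 _ e] := wit i; have [Q'0 S'0 _ e'] := wit' i.
  have {}e := (expands_revpE (size_QS _ _ Q0 S0) (QS_den_neq0 wit i) (GE _) (G0 _)).1 e.
  have {}e' := (expands_revpE (size_QS _ _ Q'0 S'0) (QS_den_neq0 wit' i) (GE _) (G0 _)).1 e'.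
  pose g k : C^o := G (x.2 true i) k - G (x'.2 true i) k.
  suff : g (- m'%:Z) = 0 by move/eqP; rewrite subr_eq0 !GE => /eqP.
  apply: (@conv_inj_high _ (QS_den c q Q S i * QS_den c q Q' S' i) g 0).
  - by rewrite mulf_neq0 ?(QS_den_neq0 wit) ?(QS_den_neq0 wit').
  - by move=> r r0; rewrite /g !G0 ?subrr.
  - exact: crossed.
move: e1 low high; case: (x) => l psi; case: (x') => l' psi' /= -> low high.
congr (_, _); apply/funext => -[]; apply/funext => i; apply/funext => k.
  exact: high.
exact: low.
Qed.
End Monomials.

(** * Lifting generalized eigenvectors along a quotient *)

Section Lifting.
Variables (K : closedFieldType) (V : lmodType K) (Y : Type).
Variable op : Y -> {linear V -> V}.
Hypothesis opC : forall y z w, op y (op z w) = op z (op y w).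

Lemma gker_apply s1 chi s2 y w : gker op (s1 ++ chi :: s2) w ->
  gker op (s1 ++ s2) (op y w - chi y *: w).
Proof.
elim: s1 w => [|a s1 IH] w /=; first by apply.
move=> Hw z; have := IH _ (Hw z); congr (gker op _ _).
rewrite (linearB (op y)) (linearB (op z)) (linearZ_LR (op y)) (linearZ_LR (op z)) opC.
by rewrite !scalerBr !scalerA (mulrC (a z)) !opprD !opprK addrACA.
Qed.

(** On a minimal stable subspace [A] not contained in [E'], the only character
    that occurs is the one by which the operators act modulo [E']. *)
Lemma generalized_eigenvector_lift E E' chi :
  subspace E -> fin_dim E -> stable op E -> subspace E' -> ~ (E `<=` E') ->
  (forall y w, E w -> E' (op y w - chi y *: w)) ->
  exists w k, [/\ E w, ~ E' w & gker op (nseq k chi) w].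
Proof.
move=> sE fE stE sE' nE Echi.
pose P A := [/\ subspace A, A `<=` E, stable op A & ~ (A `<=` E')].
have [||A [sA AE stA nA] Amin] := @min_subspace _ _ P E fE.
- by move=> W [].
- by exists E; split.
suff [k Ak] : exists k, A `<=` gker op (nseq k chi).
  have [w [Aw nw]] : exists w, A w /\ ~ E' w.
    apply: contrapT => none; apply: nA => w Aw; apply: contrapT => nw.
    by apply: none; exists w.
  by exists w, k; split => //; [exact: AE | exact: Ak].
have [s As] := fin_dim_gker opC sA (fin_dimS AE fE) stA.
have : A `<=` gker op (nseq 0 chi ++ s) by [].
elim: s 0%N {As} => [|chi' s IH] j; first by rewrite cats0; exists j.
have [->|ne] := pselect (chi' = chi).
  move=> As; apply: (IH j.+1); move: As.
  suff -> : nseq j chi ++ chi :: s = nseq j.+1 chi ++ s by [].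
  by elim: j {IH} => //= j ->.
move=> As; apply: (IH j).
have [y ney] : exists y, chi y - chi' y != 0.
  apply: contrapT => none; apply: ne; apply/funext => y; apply/esym/eqP.
  by rewrite -subr_eq0; apply: contrapT => /negP h; apply: none; exists y.
pose f v := op y v - chi' y *: v.
have flin a v v' : f (a *: v + v') = a *: f v + f v'.
  rewrite /f linearP scalerDr scalerBr !scalerA (mulrC (chi' y)) opprD.
  by rewrite addrACA.
suff eA : [set f v | v in A] = A.
  by move=> w; rewrite -{1}eA => -[v Av <-]; apply: gker_apply; apply: As.
apply: Amin.
- split.
  + split; first by exists 0; [case: sA | rewrite /f linear0 scaler0 subrr].
    move=> a _ _ [v Av <-] [v' Av' <-]; exists (a *: v + v'); last exact: flin.
    by case: sA => _; apply.
  + by move=> _ [v Av <-]; apply/AE; exact: (stable_shift _ _ sA stA Av).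
  + move=> z _ [v Av <-]; exists (op z v); first exact: stA.
    by rewrite /f opC (linearB (op z)) (linearZ_LR (op z)).
  + move=> fE'; apply: nA => w Aw.
    have h1 : E' (f w) by apply: fE'; exists w.
    have h2 := Echi y w (AE _ Aw).
    have := subspace_sub sE' h1 h2; rewrite /f opprB addrC addrA subrK -scalerBl.
    by move/(subspace_scale (chi y - chi' y)^-1 sE'); rewrite scalerA mulVf ?scale1r.
- by move=> _ [v Av <-]; exact: (stable_shift _ _ sA stA Av).
Qed.
End Lifting.

Section Characters.
Variables (R : realType) (n : nat) (c : cartan_datum n) (rl : realization c)
          (q : qparam R[i]).
Local Notation C := R[i].
Local Notation H := (car rl).
Local Notation hst := (hstar H).
Local Notation Y := ('I_n * {m : int | m != 0})%type.
Implicit Types M N : rep rl q.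

Lemma gker_lwt M l chi k (w : M) : wt l w -> gker (Hop M) (nseq k chi) w ->
  lwt (l, lchar q l chi) w.
Proof.
move=> Hw gw; split=> //; exists k => e i m /=.
elim: k w Hw gw => [|k IH] w Hw gw; first by [].
rewrite iterSr.
pose S0 := wt (M := M) l `&` gker (Hop M) (nseq k chi).
pose S1 := wt (M := M) l `&` gker (Hop M) (nseq k.+1 chi).
have sS0 : subspace S0 by apply: subspaceI; [exact: subspace_wt | exact: subspace_gker].
suff [_ /(_ w (conj Hw gw)) [h1 h2]] : (forall v, S0 v -> S0 (piact (fphi rl q e i m) v)) /\
    forall v, S1 v -> S0 (piact (fphi rl q e i m) v - lchar q l chi e i m *: v).
  exact: IH.
apply: (@fphi_ind _ _ _ rl q (fun f a => (forall v, S0 v -> S0 (piact f v)) /\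
    forall v, S1 v -> S0 (piact f v - a *: v)) (fun h => qpow q (l h)) chi).
- by split=> v _; rewrite piact0 ?scale0r ?subr0; case: sS0.
- by split=> v Sv; rewrite piact1 // scale1r subrr; case: sS0.
- move=> x y s t [x0 x1] [y0 y1]; split=> v Sv; rewrite piactD.
    by apply: subspace_add => //; [apply: x0 | apply: y0].
  rewrite scalerDl opprD addrACA.
  by apply: subspace_add => //; [apply: x1 | apply: y1].
- move=> x y s t [x0 x1] [y0 y1]; split=> v Sv; rewrite piactM.
    by apply/x0/y0.
  have -> : piact x (piact y v) - (s * t) *: v =
      piact x (piact y v - t *: v) + t *: (piact x v - s *: v).
    have -> : piact x (piact y v - t *: v) = piact x (piact y v) - t *: piact x v.
      by rewrite /piact (linearB (act _)) (linearZ_LR (act _)).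
    by rewrite scalerBr scalerA (mulrC t) addrA subrK.
  apply: subspace_add => //; first exact/x0/y1.
  by apply: subspace_scale => //; apply: x1.
- move=> d x s [x0 x1]; split=> v Sv; rewrite piactZ.
    by apply: subspace_scale => //; apply: x0.
  by rewrite -scalerA -scalerBr; apply: subspace_scale => //; apply: x1.
- move=> h; split=> v [Hv gv]; rewrite piact_k Hv; last by rewrite subrr; case: sS0.
  by apply: subspace_scale.
- move=> y; split=> v [Hv gv]; rewrite piact_h.
    by split; [exact: wt_H | exact: (stable_gker (@HopC _ _ _ _ _ M))].
  split; last exact: (gv y).
  exact: (stable_shift _ _ (subspace_wt M l) (@wt_H _ _ _ _ _ M l) Hv).
Qed.

(** The dominant monomials carried by a set of vectors. *)
Definition dominant_at M (W : set M) : set (monomial R rl) :=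
  [set m | dominant m /\ exists x, [/\ QPlplus q x, is_Y q x m &
     exists w, [/\ W w, lwt x w & w <> 0]]].

Hypothesis HC : forall i j : 'I_n, cmat c i j < -1 -> cr c i = 1%N /\ cmat c j i = -1.

Lemma lower_span_dominant_finite M (l0 : hst) (E0 : set M) : tame M ->
  subspace E0 -> E0 `<=` wt l0 -> stable (Hop M) E0 ->
  finite_set (dominant_at (lower_span E0)).
Proof.
move=> tM sE0 E0wt E0H.
have fE0 : fin_dim E0 by apply: fin_dimS (tame_fin tM l0).
have [s0 gs0] := fin_dim_gker (@HopC _ _ _ _ _ M) sE0 fE0 E0H.
apply: (@sub_finite_set _ _ (\bigcup_(chi in [set chi | chi \in s0])
  [set m | dominant m /\ exists v, lowered_monomial q l0 chi m v])); last first.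
  apply: bigcup_finite; first exact: finite_seq.
  by move=> chi _; exact: lowered_monomials_finite.
move=> m [dm [x [_ [Q [S [wit mo mu]]] [w [sw xw nw]]]]].
have [chi [v [chi0 [v0 chi0s lE chiE]]] xE] :=
  generated_lweight (tame_fin tM) E0wt gs0 sw xw nw.
have xE2 : x.2 = lchar q x.1 (shiftv c q chi0 v) := etrans xE (congr1 (lchar q x.1) chiE).
exists chi0; first exact: chi0s.
split; first exact: dm.
exists v, x, Q, S; exact: (And5 (conj wit mu) mo v0 lE xE2).
Qed.

Lemma submodule_image M N (p : {linear M -> N}) (W : set M) : rep_morphism p ->
  submodule W -> submodule [set p w | w in W].
Proof.
move=> [pM _] [[W0 WL] Wact]; split; first split.
- by exists 0; rewrite ?linear0.
- move=> a _ _ [v Wv <-] [w Ww <-]; exists (a *: v + w); first exact: WL.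
  by rewrite linearP.
- by move=> u _ [w Ww <-]; exists (act u w); [exact: Wact | rewrite pM].
Qed.

Lemma submodule_preimage M N (p : {linear M -> N}) (W : set N) : rep_morphism p ->
  submodule W -> submodule [set w | W (p w)].
Proof.
move=> [pM _] [[W0 WL] Wact]; split; first split => /=.
- by rewrite linear0.
- by move=> a v w Wv Ww /=; rewrite linearP; apply: WL.
- by move=> u w /= Ww; rewrite pM; apply: Wact.
Qed.

Definition simple_over M (W W' : set M) : Prop :=
  [/\ W' `<=` W, W' <> W
    & forall L : set M, submodule L -> W' `<=` L -> L `<=` W -> L = W' \/ L = W].

Section Subquotient.
Variables (M : rep rl q) (W W' : set M).
Hypothesis tM : tame M.
Hypothesis mW : submodule W.
Hypothesis mW' : submodule W'.
Hypothesis W'W : W' `<=` W.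
Hypothesis neW : W' <> W.

Let quot := quotient_exists (Subm mW').

Lemma subquotient_neq0 N (p : {linear M -> N}) : (forall w, p w = 0 <-> W' w) ->
  exists2 v, [set p w | w in W] v & v <> 0.
Proof.
move=> ker; apply: contrapT => none; apply: neW; apply/seteqP; split => // w Ww.
apply/ker; apply: contrapT => nw; apply: none; exists (p w) => //; by exists w.
Qed.

Lemma subquotient_back N (p : {linear M -> N}) w : (forall w, p w = 0 <-> W' w) ->
  [set p w | w in W] (p w) -> W w.
Proof.
move=> ker [w' Ww' e]; rewrite -(subrK w' w).
apply: (subspace_add mW.1) => //; apply/W'W/ker.
by rewrite linearB e subrr.
Qed.

(** A simple subquotient is generated by its highest weight space. *)
Lemma simple_dominant_finite : simple_over W W' -> finite_set
  [set m | dominant m /\ exists x, [/\ QPlplus q x, is_Y q x m &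
     exists w, [/\ W w, ~ W' w & lwt x w]]].
Proof.
move=> [_ _ simp]; have [N [p [pM /= ker]]] := quot.
have tN := tame_quotient pM tM; pose I := [set p w | w in W].
have mI : submodule I by apply: submodule_image.
have [l [[v0 [Iv0 Hv0] nv0] top]] := top_weight tN mI (subquotient_neq0 ker).
pose E0 := wt (M := N) l `&` I.
have sE0 : subspace E0 by apply: subspaceI; [exact: subspace_wt | exact: mI.1].
have IXop e i r v : I v -> I (Xop N e i r v).
  by move=> Iv; rewrite Xop.unlock; apply: mI.2.
have E0wt : E0 `<=` wt l by move=> v [].
have E0H : stable (Hop N) E0.
  move=> y v [Hv Iv]; split; first exact: wt_H.
  by rewrite Hop.unlock; apply: mI.2.
have E0X i r v : E0 v -> Xop N false i r v = 0.
  by move=> [Hv Iv]; apply: (top i); [exact: IXop | exact: wt_Xp].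
have mL := submodule_lower_span sE0 E0wt E0H E0X.
have LI : lower_span E0 `<=` I.
  move=> v; elim=> [w [_ //]|i r w _|a w w' _ Iw _ Iw']; first exact: IXop.
  by case: mI => -[_ IL] _; apply: IL.
have mP := submodule_preimage pM mL.
have WL : [set w | lower_span E0 (p w)] = W.
  have [||e|//] := simp _ mP.
  - by move=> w /ker /= ->; case: mL => -[].
  - by move=> w /= /LI; apply: subquotient_back.
  case: nv0; have [w Ww wE] := Iv0; rewrite -wE; apply/ker; rewrite -e /= wE.
  exact: lower_base.
apply: sub_finite_set (lower_span_dominant_finite tN sE0 E0wt E0H).
move=> m [dm [x [Qx Yx [w [Ww nW'w xw]]]]]; split => //; exists x; split => //.
exists (p w); split; [by move: Ww; rewrite -WL | exact: morphism_lwt |].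
by move/ker.
Qed.

(** A dominant monomial is visible in every nonzero subquotient. *)
Lemma subquotient_dominant : exists m x v,
  [/\ dominant_at [set: M] m, is_Y q x m & [/\ wt (M := M) x.1 v, W v & ~ W' v]].
Proof.
have [N [p [pM /= ker]]] := quot.
have tN := tame_quotient pM tM; pose I := [set p w | w in W].
have mI : submodule I by apply: submodule_image.
have [l [u [chi [Iu u0 Hu Xu Hchi]]]] :=
  highest_weight_vector tN mI (subquotient_neq0 ker).
have [m [dm Qx Yx]] := highest_weight_monomial tN u0 Hu Hchi Xu.
pose E := [set w : M | [/\ wt l w, W w & forall y, p (Hop M y w - chi y *: w) = 0]].
have pH y w : p (Hop M y w) = Hop N y (p w) := morphism_H pM y w.
have stE : stable (Hop M) E.
  move=> y w [Hw Ww ew]; split; first exact: wt_H.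
    by rewrite Hop.unlock; apply: mW.2.
  move=> z; have -> : Hop M z (Hop M y w) - chi z *: Hop M y w =
      Hop M y (Hop M z w - chi z *: w).
    by rewrite (linearB (Hop M y)) (linearZ_LR (Hop M y)) HopC.
  by rewrite pH ew linear0.
have sE : subspace E.
  split=> [|a v w [Hv Wv ev] [Hw Ww ew]].
    split; [exact: (subspace_wt _ _).1 | exact: mW.1.1 |].
    by move=> y; rewrite linear0 scaler0 subr0 linear0.
  split; [exact: (subspace_wt _ _).2 | exact: mW.1.2 |] => y.
  have -> : Hop M y (a *: v + w) - chi y *: (a *: v + w) =
      a *: (Hop M y v - chi y *: v) + (Hop M y w - chi y *: w).
    by rewrite linearP scalerDr scalerBr !scalerA (mulrC a) opprD addrACA.
  by rewrite linearP ev ew scaler0 addr0.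
have fE : fin_dim E by apply: fin_dimS (tame_fin tM l) => w [].
have nE : ~ (E `<=` W').
  move=> EW'; have [w Hw pw] := lift_wt pM (tame_weight tM) Hu.
  apply: u0; rewrite -pw; apply/ker/EW'; split => //.
    by apply: (subquotient_back ker); rewrite pw.
  by move=> y; rewrite (linearB p) (linearZ_LR p) pH pw Hchi subrr.
have [w [k [[Hw Ww _] nw gw]]] := generalized_eigenvector_lift (@HopC _ _ _ _ _ M)
  sE fE stE mW'.1 nE (fun y v (Ev : E v) => let: And3 _ _ e := Ev in (ker _).1 (e y)).
exists m, (l, lchar q l chi), w; split => //; split => //.
exists (l, lchar q l chi); split => //; exists w; split => //.
  exact: gker_lwt gw.
by move=> w0; apply: nw; rewrite w0; apply: mW'.1.1.
Qed.

End Subquotient.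
End Characters.

(** * Composition series *)

Section Series.
Variables (R : realType) (n : nat) (c : cartan_datum n) (rl : realization c)
          (q : qparam R[i]).
Local Notation C := R[i].
Local Notation H := (car rl).
Local Notation hst := (hstar H).
Hypothesis HC : forall i j : 'I_n, cmat c i j < -1 -> cr c i = 1%N /\ cmat c j i = -1.
Variable M : rep rl q.
Hypothesis tM : tame M.

Definition series (W : set M) (k : nat) (Ws : nat -> set M) : Prop :=
  [/\ Ws 0%N = W, Ws k = [set 0], forall i, (i <= k)%N -> submodule (Ws i)
    & forall i, (i < k)%N -> simple_over (Ws i) (Ws i.+1)].

Lemma series_dominant_finite k Ws : series setT k Ws -> finite_set (dominant_at [set: M]).
Proof.
move=> [W0 Wk sub simp].
apply: (@sub_finite_set _ _ (\bigcup_(i in `I_k) [set m | dominant m /\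
    exists x, [/\ QPlplus q x, is_Y q x m & exists w, [/\ Ws i w, ~ Ws i.+1 w & lwt x w]]])).
  move=> m [dm [x [Qx Yx [w [_ xw nw]]]]].
  have [i ik [wi nwi]] : exists2 i, (i < k)%N & Ws i w /\ ~ Ws i.+1 w.
    apply: contrapT => none; suff : forall i, (i <= k)%N -> Ws i w.
      by move/(_ k (leqnn k)); rewrite Wk.
    elim=> [|i IH] ik; first by rewrite W0.
    apply: contrapT => nwi; apply: none; exists i => //; split => //.
    by apply: IH; apply: ltnW.
  exists i; first exact: ik.
  by split; [exact: dm | exists x; split; [exact: Qx | exact: Yx | exists w; split]].
apply: bigcup_finite; first exact: finite_II.
move=> i ik; have [sW ne _] := simp i ik.
by apply: (simple_dominant_finite HC tM (sub i (ltnW ik)) (sub i.+1 ik) sW ne); apply: simp.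
Qed.

Section Length.
Variable ls : seq hst.
Hypothesis ls_dominant : forall m x, dominant_at [set: M] m -> is_Y q x m -> x.1 \in ls.

(** The part of a submodule seen by the dominant monomials. *)
Definition dominant_length (W : set M) : nat := \sum_(l <- ls) ldim (W `&` wt l).

Lemma dominant_length_lt (W W' : set M) : submodule W -> submodule W' ->
  W' `<=` W -> W' <> W -> (dominant_length W' < dominant_length W)%N.
Proof.
move=> mW mW' sW ne.
have sub (A : set M) l : submodule A -> subspace (A `&` wt l).
  by move=> [sA _]; apply: subspaceI => //; exact: subspace_wt.
have fin (A : set M) l : fin_dim (A `&` wt l).
  by apply: fin_dimS (tame_fin tM l) => w [].
have sI l : W' `&` wt l `<=` W `&` wt l by move=> w [/sW].
have [m [x [v [dm Yx [Hv Wv nv]]]]] := subquotient_dominant tM mW mW' sW ne.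
have xls := ls_dominant dm Yx.
rewrite /dominant_length !(big_rem x.1 xls) /= -addSn leq_add //.
  apply: ldim_lt; [exact: sub | exact: sub | exact: fin | exact: sI |].
  by move=> e; apply: nv; have [] : (W' `&` wt x.1) v by rewrite e.
by apply: leq_sum => l _; apply: ldim_le; [exact: sub | exact: sub | exact: fin | exact: sI].
Qed.

Lemma series_exists_length W : submodule W -> exists k Ws, series W k Ws.
Proof.
have [e] : exists e, (dominant_length W < e)%N by exists (dominant_length W).+1.
elim: e W => // e IH W We mW.
have [->|nW0] := pselect (W = [set 0]).
  by exists 0%N, (fun=> [set 0]); split => // i _; exact: submodule0.
have s0W : [set 0] `<=` W by move=> w ->; case: mW => -[].
pose P k := `[< exists L, [/\ submodule L, L `<=` W, L <> W & dominant_length L = k] >].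
have exP : exists k, P k.
  exists (dominant_length [set 0]); apply/asboolP; exists [set 0]; split => //.
    exact: submodule0.
  by move=> e0; apply: nW0.
have ubP k : P k -> (k <= dominant_length W)%N.
  by move=> /asboolP[L [mL LW ne <-]]; apply/ltnW/dominant_length_lt.
case: (ex_maxnP exP ubP) => k /asboolP[L [mL LW ne Lk]] kmax.
have Le : (dominant_length L < e)%N.
  by apply: leq_trans (dominant_length_lt mW mL LW ne) _.
have [k' [Ws [W0 Wk sub simp]]] := IH L Le mL.
exists k'.+1, (fun j => if j is j'.+1 then Ws j' else W); split => //.
  by case.
case=> [_|i ik]; last exact: simp.
rewrite W0; split => // N mN LN NW; apply: contrapT => /not_orP[nL nN].
have := dominant_length_lt mN mL LN (fun e => nL (esym e)); rewrite Lk ltnNge.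
by move/negP; apply; apply: kmax; apply/asboolP; exists N.
Qed.
End Length.

Lemma series_exists : finite_set (dominant_at [set: M]) ->
  exists k Ws, series setT k Ws.
Proof.
move=> fin; pose g (m : monomial R rl) : hst := xget 0 [set l | mon_omega m = nu l].
have /finite_seqP[ls lsE] := finite_image g fin.
apply: (@series_exists_length ls); last first.
  by split; [split | ].
move=> m x dm Yx; have -> : x.1 = g m.
  have [Q [S [_ mo _]]] := Yx; apply/esym.
  rewrite /g; have := @xgetPex _ 0 [set l | mon_omega m = nu l] (ex_intro _ x.1 mo).
  by rewrite /= {1}mo => /nu_inj ->.
by have : [set` ls] (g m) by rewrite -lsE; exists m.
Qed.

Lemma subspace_lwt (x : lweight R rl) : subspace (lwt (M := M) x).
Proof.
pose D e i m (v : M) := act (phi_ rl q e i m) v - x.2 e i m *: v.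
have Dlin e i m a v v' : D e i m (a *: v + v') = a *: D e i m v + D e i m v'.
  rewrite /D linearP scalerDr scalerBr !scalerA (mulrC (x.2 e i m)) opprD.
  by rewrite addrACA.
have iterlin e i m k a v v' :
    iter k (D e i m) (a *: v + v') = a *: iter k (D e i m) v + iter k (D e i m) v'.
  by elim: k => //= k ->; rewrite Dlin.
have iter0 e i m k : iter k (D e i m) 0 = 0.
  have := iterlin e i m k 1 0 0; rewrite scaler0 addr0 scale1r => /eqP.
  by rewrite -subr_eq subrr eq_sym => /eqP.
split; first by split; [exact: (subspace_wt _ _).1 | exists 0%N].
move=> a v w [Hv [k kv]] [Hw [k' kw]]; split; first exact: (subspace_wt _ _).2.
have e1 e i m : iter (k + k') (D e i m) w = 0.
  by rewrite iterD (kw e i m : iter k' (D e i m) w = 0) iter0.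
have e2 e i m : iter (k + k') (D e i m) v = 0.
  by rewrite addnC iterD (kv e i m : iter k (D e i m) v = 0) iter0.
exists (k + k')%N => e i m; rewrite -/(D e i m) iterlin e1 e2.
by rewrite scaler0 addr0.
Qed.

End Series.

(** * Modules as representations *)

Section Bridge.
Variables (R : realType) (n : nat) (c : cartan_datum n) (rl : realization c)
          (q : qparam R[i]).
Local Notation C := R[i].
Local Notation H := (car rl).
Local Notation U := (Uq rl q).
Local Notation hst := (hstar H).

Lemma UqZl (a : C) (u : U) : (a *: (1 : U)) * u = a *: u.
Proof.
have e : (a *: (1 : U)) * u = a *: (1 * u) := esym (Uq_scalerAl a 1 u).
have e1 := mul1r u; apply: (etrans e) _; exact: (f_equal (fun v : U => a *: v) e1).
Qed.

Lemma UqZr (a : C) (u : U) : u * (a *: (1 : U)) = a *: u.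
Proof.
have e : u * (a *: (1 : U)) = a *: (u * 1) := esym (Uq_scalerAr a u 1).
have e1 := mulr1 u; apply: (etrans e) _; exact: (f_equal (fun v : U => a *: v) e1).
Qed.

Definition cmod (V : lmodType U) : Type := V.
HB.instance Definition _ (V : lmodType U) := GRing.Zmodule.on (cmod V).

Section OneModule.
Variable V : lmodType U.
Local Notation cs := (@cscale R n c rl q V).

Fact cscaleA a b (v : cmod V) : cs a (cs b v) = cs (a * b) v.
Proof.
have e : (a *: (1 : U)) * (b *: (1 : U)) = (a * b) *: (1 : U) by rewrite UqZl scalerA.
have e1 := scalerA (a *: (1 : U)) (b *: (1 : U)) (v : V).
exact: (etrans e1 (f_equal (fun u : U => u *: (v : V)) e)).
Qed.
Fact cscale1 (v : cmod V) : cs 1 v = v.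
Proof.
have e : (1 : C) *: (1 : U) = 1 by exact: scale1r.
exact: (etrans (f_equal (fun u : U => u *: (v : V)) e) (scale1r (v : V))).
Qed.
Fact cscaleDr : right_distributive (cs : C -> cmod V -> cmod V) +%R.
Proof. by move=> a v w; exact: (scalerDr _ (v : V) w). Qed.
Fact cscaleDl (v : cmod V) : {morph (cs : C -> cmod V -> cmod V)^~ v : a b / a + b}.
Proof.
move=> a b; have e : (a + b) *: (1 : U) = a *: (1 : U) + b *: (1 : U) by exact: scalerDl.
have e1 := scalerDl (v : V) (a *: (1 : U)) (b *: (1 : U)).
exact: (etrans (f_equal (fun u : U => u *: (v : V)) e) e1).
Qed.
HB.instance Definition _ := GRing.Zmodule_isLmodule.Build C (cmod V)
  cscaleA cscale1 cscaleDr cscaleDl.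

Lemma cscale_act a (u : U) (v : V) : u *: cs a v = cs a (u *: v).
Proof.
have e1 := scalerA u (a *: (1 : U)) v; have e2 := scalerA (a *: (1 : U)) u v.
have e := etrans (UqZr a u) (esym (UqZl a u)).
exact: (etrans e1 (etrans (f_equal (fun u : U => u *: v) e) (esym e2))).
Qed.

Lemma scale_act a (u : U) (v : V) : (a *: u) *: v = cs a (u *: v).
Proof.
have e2 := scalerA (a *: (1 : U)) u v.
exact: (etrans (f_equal (fun u : U => u *: v) (esym (UqZl a u))) (esym e2)).
Qed.

Definition rep_of : rep rl q.
Proof.
refine (@Rep R n c rl q (cmod V) (fun u v => u *: (v : V)) _ _ _ _ _).
- move=> u a v w; apply: etrans (scalerDr u (cs a v) w) _.
  exact: (congr1 (fun v : V => v + u *: (w : V)) (cscale_act a u v)).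
- by move=> u u' v; exact: (scalerDl (v : V) u u').
- by move=> u u' v; exact: esym (scalerA u u' (v : V)).
- by move=> v; exact: (scale1r (v : V)).
- by move=> a u v; exact: scale_act.
Defined.

Lemma weight_spaceE l : weight_space l = wt (M := rep_of) l.
Proof.
by apply/seteqP; split=> v Hv h; have := Hv h; rewrite Kop.unlock.
Qed.

Lemma is_submoduleE (W : set V) : is_submodule W <-> submodule (M := rep_of) W.
Proof.
split=> [[W0 WL]|[[W0 WL] Wact]].
  split; first by split => // a v w; exact: WL.
  by move=> u w Ww; have := WL u w 0 Ww W0; rewrite addr0.
split => // u v w Wv Ww.
by have := WL 1 (u *: v) w (Wact u v Wv) Ww; rewrite scale1r.
Qed.

Lemma lweight_spaceE x : lweight_space x = lwt (M := rep_of) x.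
Proof.
have it (A : pzRingType) (L : lmodType A) (u : A) p (v : L) :
    u ^+ p *: v = iter p (fun v => u *: v) v.
  by elim: p => [|p IH]; rewrite ?scale1r // exprS -scalerA IH.
have itE e i m p (v : V) : (phi_ rl q e i m - x.2 e i m *: (1 : U)) ^+ p *: v =
    iter p (fun v : rep_of => act (phi_ rl q e i m) v - x.2 e i m *: v) v.
  apply: etrans (it _ _ _ _ _) (eq_iter _ _ _) => w.
  have e1 := scalerBl (phi_ rl q e i m) (x.2 e i m *: (1 : U)) (w : V).
  exact: e1.
have wE (v : V) : weight_space x.1 v <-> wt (M := rep_of) x.1 v by rewrite weight_spaceE.
apply/seteqP; split=> v [/wE Hv [p Hp]]; split=> //; exists p => e i m.
  exact: etrans (esym (itE e i m p v)) (Hp e i m).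
exact: etrans (itE e i m p v) (Hp e i m).
Qed.

Lemma in_Mod_tame : in_Mod V -> tame rep_of.
Proof.
move=> [[dec _] fin [s cone] int]; split.
- move=> w; have [r [f [Hf ->]]] := dec w; exists r, f; split => // l.
  by rewrite -weight_spaceE.
- move=> l; have [d [b [_ Hb]]] := fin l; exists d, b => v.
  by rewrite -weight_spaceE => /Hb[a [-> _]]; exists a.
- exists s => l [w Hw nw]; apply: cone => e; apply: nw.
  by move: Hw; rewrite -weight_spaceE e.
- move=> l i; have [N HN] := int l i; exists N => r Nr.
  have [e1 e2] := HN r Nr; split=> v Hv.
    by have : [set (0 : V)] v by rewrite -e1 weight_spaceE.
  by have : [set (0 : V)] v by rewrite -e2 weight_spaceE.
Qed.

Lemma cdim_neq0 (W : set V) : subspace (V := cmod V) W -> fin_dim (V := cmod V) W ->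
  cdim W != 0%N <-> exists2 w, W w & w <> 0.
Proof.
move=> sW fW.
have [d [b [fb Wb spb]]] := lbasis_exists sW fW.
have basis_b : is_basis b W.
  split=> // v /spb[a va]; exists [ffun i => a i]; split.
    by rewrite va; apply: eq_bigr => i _; rewrite ffunE.
  move=> a' va'; apply/ffunP => i; rewrite ffunE; apply/eqP; rewrite -subr_eq0.
  apply/eqP; apply: (fb (fun i => a i - a' i)).
  rewrite -[RHS](subrr v) {1}va va' -sumrB; apply: eq_bigr => j _.
  exact: scalerBl.
have : [set d | exists b : 'I_d -> V, is_basis b W] (cdim W).
  by rewrite /cdim; apply: xgetPex; exists d, b.
move=> [b' [Wb' Hb']]; split=> [d0|[w Ww nw]].
  have i0 : 'I_(cdim W) := Ordinal (ltac:(by rewrite lt0n) : (0 < cdim W)%N).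
  exists (b' i0) => // b0.
  have [a0 [_ uniq]] := Hb' 0 sW.1.
  pose z : {ffun 'I_(cdim W) -> C} := [ffun=> 0].
  pose o : {ffun 'I_(cdim W) -> C} := [ffun j => (j == i0)%:R].
  have hz : a0 = z.
    apply: uniq; rewrite big1 // => j _; rewrite ffunE.
    exact: (scale0r (b' j : cmod V)).
  have ho : a0 = o.
    apply: uniq; rewrite big1 // => j _; rewrite ffunE; case: eqP => [->|_].
      by rewrite b0; exact: (scaler0 (cmod V)).
    exact: (scale0r (b' j : cmod V)).
  have := congr1 (fun f : {ffun _} => f i0) (etrans (esym hz) ho).
  by rewrite !ffunE eqxx => /eqP; rewrite eq_sym oner_eq0.
apply/eqP => d0; apply: nw; have [a [-> _]] := Hb' w Ww.
rewrite big1 // => j _; have : (j < 0)%N by rewrite -[X in (_ < X)%N]d0 ltn_ord.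
by [].
Qed.

Lemma dominant_monomialsE : in_Mod V -> dominant_monomials V = dominant_at [set: rep_of].
Proof.
move=> HV; have tM := in_Mod_tame HV.
have dimE x : cdim (lweight_space x : set V) != 0%N <-> exists2 w : V, lwt (M := rep_of) x w & w <> 0.
  rewrite lweight_spaceE; apply: cdim_neq0; first exact: subspace_lwt.
  by apply: fin_dimS (tame_fin tM x.1) => w [].
have sole (x : lweight R rl) (m : monomial R rl) : QPlplus q x -> is_Y q x m ->
    [set y : lweight R rl | QPlplus q y /\ is_Y q y m] = [set x].
  move=> Qx Yx; apply/seteqP; split=> [y [_ Yy]|y ->//].
  exact: is_Y_inj Yy Yx.
apply/seteqP; split=> m.
  move=> [nz dm]; split => //.
  have [x [Qx Yx]] : exists x, QPlplus q x /\ is_Y q x m.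
    apply: contrapT => none; move: nz; rewrite /qchar.
    rewrite (_ : [set x | _] = set0) ?fsbig_set0 ?eqxx //.
    by apply/seteqP; split => // x Hx; apply: none; exists x.
  exists x; split => //; move: nz; rewrite /qchar (sole x m Qx Yx) fsbig_set1.
  by rewrite eqz_nat => /dimE[w xw nw]; exists w.
move=> [dm [x [Qx Yx [w [_ xw nw]]]]]; split => //.
rewrite /qchar (sole x m Qx Yx) fsbig_set1 eqz_nat; apply/dimE; by exists w.
Qed.

End OneModule.
End Bridge.

Theorem proposition5p24 (R : realType) (n : nat) (c : cartan_datum n)
    (rl : realization c) (q : qparam R[i])
    (HC : forall i j : 'I_n, cmat c i j < -1 -> cr c i = 1%N /\ cmat c j i = -1)
    (V : lmodType (Uq rl q)) (HV : in_Mod V) :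
  (l_highest_weight V -> finite_set (dominant_monomials V)) /\
  (has_finite_composition_series V <-> finite_set (dominant_monomials V)).
Proof.
have tM := in_Mod_tame HV; rewrite dominant_monomialsE //.
have simpleE (W W' : set V) : simple_step W W' <-> simple_over (M := rep_of V) W W'.
  by split=> -[h1 h2 h3]; split => // N /is_submoduleE; exact: h3.
split; last split.
- move=> [x [v [_ Hv gen Xv _]]].
  pose E0 := [set w : rep_of V | wt x.1 w /\ forall i r, Xop (rep_of V) false i r w = 0].
  have sE0 : subspace E0.
    split=> [|a u w [Hu Xu] [Hw Xw]].
      by split; [exact: (subspace_wt _ _).1 | move=> i r; rewrite linear0].
    split; first exact: (subspace_wt _ _).2.
    by move=> i r; rewrite linearP Xu Xw scaler0 addr0.
  have E0wt : E0 `<=` wt x.1 by move=> w [].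
  have E0H : stable (Hop (rep_of V)) E0.
    move=> y w [Hw Xw]; split; first exact: wt_H.
    move=> i r; have := Hop_X false i y r w.
    by rewrite !Xw linear0 scaler0 addr0 => <-.
  have E0v : E0 v.
    by split; [rewrite -weight_spaceE | move=> i r; rewrite Xop.unlock; exact: Xv].
  have mL := submodule_lower_span sE0 E0wt E0H (fun i r w Ew => Ew.2 i r).
  apply: sub_finite_set (lower_span_dominant_finite HC tM sE0 E0wt E0H).
  move=> m [dm [y [Qy Yy [w [_ yw nw]]]]]; split=> //; exists y; split => //.
  exists w; split => //; have [u ->] := gen w.
  exact: (mL.2 u v (lower_base E0v)).
- move=> [k [W [W0 Wk sub simp]]]; apply: (series_dominant_finite HC tM (k := k) (Ws := W)).
  split => // i ik; first exact/is_submoduleE/sub.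
  exact/simpleE/simp.
- move=> /(series_exists tM)[k [W [W0 Wk sub simp]]]; exists k, W; split => // i ik.
    exact/is_submoduleE/sub.
  exact/simpleE/simp.
Qed.
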